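(* Let $(H,C,\mathrm{tr})$ be an affine Cayley-Hamilton Hopf algebra over an algebraically closed field $\Bbbk$ of characteristic zero. If $H$ has the Chevalley property, then all the discriminant ideals of $(H,C,\mathrm{tr})$ are trivial, i.e. for every positive integer $k$ the ideal $D_k(H/C;\mathrm{tr})$ is either $0$ or $C$.
   Context: Affine means that $H$ is finitely generated as a $\Bbbk$-algebra. Algebra with trace: a triple $(A,C,\mathrm{tr})$ where $A$ is a $\Bbbk$-algebra, $C$ a central subalgebra and $\mathrm{tr}:A\to C$ a $C$-linear map with $\mathrm{tr}(ab)=\mathrm{tr}(ba)$ for all $a,b\in A$. For $a\in A$ and $k\ge 1$ define $c_k(a)=\frac{1}{k!}\det M_k(a)\in C$, where $M_k(a)$ is the $k\times k$ matrix with entries $(M_k)_{ij}=\mathrm{tr}(a^{i-j+1})$ for $j\le i$, $(M_k)_{i,i+1}=i$, and $0$ for $j>i+1$. The $n$-th characteristic polynomial of $a$ is $p_{n,a}(t)=t^n-c_1(a)t^{n-1}+\cdots+(-1)^n c_n(a)\in C[t]$. $(A,C,\mathrm{tr})$ is a Cayley-Hamilton algebra of degree $n$ if $p_{n,a}(a)=0$ for all $a\in A$ and $\mathrm{tr}(1)=n$. A Cayley-Hamilton Hopf algebra is a Cayley-Hamilton algebra $(H,C,\mathrm{tr})$ (of some degree) such that $H$ is a Hopf algebra and $C$ is a central Hopf subalgebra of $H$. A Hopf algebra has the Chevalley property if the tensor product of any two of its finite-dimensional irreducible modules is completely reducible. For a positive integer $k$, the $k$-discriminant ideal $D_k(H/C;\mathrm{tr})$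 is the ideal of $C$ generated by all $\det(\mathrm{tr}(a_ia_j))_{i,j=1}^k$ with $(a_1,\dots,a_k)\in H^k$. *)

(* Defs.v *)
From HB Require Import structures.
From mathcomp Require Import all_boot all_order all_algebra.
From mathcomp Require Import boolp classical_sets.

Set Implicit Arguments.
Unset Strict Implicit.
Unset Printing Implicit Defensive.

Import GRing.Theory.
Local Open Scope ring_scope.
Local Open Scope quotient_scope.

(* U ⊗ V is the quotient of the formal sums \sum_i u_i ⊗ v_i, represented as   *)
(* sequences of pairs, by the relation that every bilinear map takes the same  *)
(* value on both; tlift and its lemmas give the universal property.            *)
Section TensorProduct.
Variables (K : fieldType) (U V : lmodType K).

Definition sum_eval (W : lmodType K) (f : U -> V -> W) (s : seq (U * V)) : W :=
  \sum_(p <- s) f p.1 p.2.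

Definition tensor_rel (s t : seq (U * V)) : bool :=
  `[< forall (W : lmodType K) (f : {bilinear U -> V -> W}),
        sum_eval f s = sum_eval f t >].

Lemma tensor_rel_refl : reflexive tensor_rel.
Proof. by move=> s; apply/asboolP. Qed.

Lemma tensor_rel_sym : symmetric tensor_rel.
Proof.
by move=> s t; apply/asboolP/asboolP => st W f; rewrite (st W f).
Qed.

Lemma tensor_rel_trans : transitive tensor_rel.
Proof.
move=> t s r /asboolP st /asboolP tr; apply/asboolP => W f.
by rewrite (st W f) (tr W f).
Qed.

Canonical tensor_equiv :=
  EquivRel tensor_rel tensor_rel_refl tensor_rel_sym tensor_rel_trans.

Definition tensor : Type := {eq_quot tensor_equiv}.

HB.instance Definition _ := Choice.on tensor.
HB.instance Definition _ := EqQuotient.on tensor.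

Definition tens (u : U) (v : V) : tensor := \pi_tensor [:: (u, v)].

(* Meaningful when f is bilinear, see tlift_tens. *)
Definition tlift (W : lmodType K) (f : U -> V -> W) (t : tensor) : W :=
  sum_eval f (repr t).

Lemma eq_tensorP (s t : seq (U * V)) :
  (forall (W : lmodType K) (f : {bilinear U -> V -> W}),
     sum_eval f s = sum_eval f t) <-> \pi_tensor s = \pi_tensor t.
Proof.
split=> [st|/eqmodP /asboolP //].
by apply/eqmodP/asboolP.
Qed.

Lemma tlift_pi (W : lmodType K) (f : {bilinear U -> V -> W}) s :
  tlift f (\pi_tensor s) = sum_eval f s.
Proof.
exact: ((@eq_tensorP (repr (\pi_tensor s)) s).2 (reprK (\pi_tensor s)) W f).
Qed.

Lemma tlift_ext (x y : tensor) :
  (forall (W : lmodType K) (f : {bilinear U -> V -> W}), tlift f x = tlift f y)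
  -> x = y.
Proof. by move=> xy; rewrite -[x]reprK -[y]reprK; apply/eq_tensorP. Qed.

Definition tensor_add (x y : tensor) : tensor := \pi_tensor (repr x ++ repr y).
Definition tensor_scale (a : K) (x : tensor) : tensor :=
  \pi_tensor [seq (a *: p.1, p.2) | p <- repr x].
Definition tensor_zero : tensor := \pi_tensor [::].
Definition tensor_opp (x : tensor) : tensor := tensor_scale (-1) x.

Let liftD (W : lmodType K) (f : {bilinear U -> V -> W}) x y :
  tlift f (tensor_add x y) = tlift f x + tlift f y.
Proof. by rewrite tlift_pi /sum_eval big_cat. Qed.

Let liftZ (W : lmodType K) (f : {bilinear U -> V -> W}) a x :
  tlift f (tensor_scale a x) = a *: tlift f x.
Proof.
rewrite tlift_pi /sum_eval big_map scaler_sumr.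
by apply: eq_bigr => p _; rewrite linearZl_LR.
Qed.

Let lift0 (W : lmodType K) (f : {bilinear U -> V -> W}) : tlift f tensor_zero = 0.
Proof. by rewrite tlift_pi /sum_eval big_nil. Qed.

Let addA : associative tensor_add.
Proof. by move=> x y z; apply: tlift_ext => W f; rewrite !liftD addrA. Qed.
Let addC : commutative tensor_add.
Proof. by move=> x y; apply: tlift_ext => W f; rewrite !liftD addrC. Qed.
Let add0 : left_id tensor_zero tensor_add.
Proof. by move=> x; apply: tlift_ext => W f; rewrite liftD lift0 add0r. Qed.
Let addN : left_inverse tensor_zero tensor_opp tensor_add.
Proof.
by move=> x; apply: tlift_ext => W f; rewrite liftD liftZ lift0 scaleN1r addNr.
Qed.

HB.instance Definition _ := GRing.isZmodule.Build tensor addA addC add0 addN.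

Let scaleA a b x : tensor_scale a (tensor_scale b x) = tensor_scale (a * b) x.
Proof. by apply: tlift_ext => W f; rewrite !liftZ scalerA. Qed.
Let scale1 : left_id 1 tensor_scale.
Proof. by move=> x; apply: tlift_ext => W f; rewrite liftZ scale1r. Qed.
Let scaleDr : right_distributive tensor_scale +%R.
Proof.
by move=> a x y; apply: tlift_ext => W f; rewrite !(liftZ, liftD) scalerDr.
Qed.
Let scaleDl x : {morph tensor_scale^~ x : a b / a + b}.
Proof.
by move=> a b; apply: tlift_ext => W f; rewrite liftZ liftD !liftZ scalerDl.
Qed.

HB.instance Definition _ :=
  GRing.Zmodule_isLmodule.Build K tensor scaleA scale1 scaleDr scaleDl.

Lemma tlift_linear (W : lmodType K) (f : {bilinear U -> V -> W}) : linear (tlift f).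
Proof. by move=> a x y; rewrite liftD liftZ. Qed.

HB.instance Definition _ (W : lmodType K) (f : {bilinear U -> V -> W}) :=
  GRing.isLinear.Build K tensor W *:%R (tlift f) (tlift_linear f).

Lemma tlift_tens (W : lmodType K) (f : {bilinear U -> V -> W}) u v :
  tlift f (tens u v) = f u v.
Proof. by rewrite tlift_pi /sum_eval big_seq1. Qed.

Lemma tens_bilinear : bilinear_for *:%R *:%R tens.
Proof.
by split=> [v a u u'|u a v v']; apply: tlift_ext => W f;
  rewrite linearP /= !tlift_tens ?linearPl ?linearPr.
Qed.

HB.instance Definition _ :=
  bilinear_isBilinear.Build K U V tensor *:%R *:%R tens tens_bilinear.

Lemma tensorE (x : tensor) : x = \sum_(p <- repr x) tens p.1 p.2.
Proof.
apply: tlift_ext => W f; rewrite linear_sum.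
by apply: eq_bigr => p _; rewrite /= tlift_tens.
Qed.

Lemma tensor_ind_eq (W : lmodType K) (f g : {linear tensor -> W}) :
  (forall u v, f (tens u v) = g (tens u v)) -> f =1 g.
Proof.
by move=> fg x; rewrite (tensorE x) !linear_sum; apply: eq_bigr => p _.
Qed.

End TensorProduct.

Notation "U ⊗ V" := (tensor U V) (at level 40, left associativity) : type_scope.

Section UnbundledLift.
Variables (K : fieldType) (U V W : lmodType K) (f : U -> V -> W).
Hypothesis fP : bilinear_for *:%R *:%R f.

Let F := HB.pack_for {bilinear U -> V -> W} f
  (bilinear_isBilinear.Build K U V W *:%R *:%R f fP).

Lemma tliftE u v : tlift f (tens u v) = f u v.
Proof. exact: (tlift_tens F). Qed.

Lemma tlift_is_linear : linear (tlift f).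
Proof. exact: (tlift_linear F). Qed.

End UnbundledLift.

Definition tmap (K : fieldType) (U V U' V' : lmodType K)
    (f : U -> U') (g : V -> V') : U ⊗ V -> U' ⊗ V' :=
  tlift (fun u v => tens (f u) (g v)).

Definition tassoc (K : fieldType) (U V W : lmodType K) :
    (U ⊗ V) ⊗ W -> U ⊗ (V ⊗ W) :=
  tlift (fun x w => tlift (fun u v => tens u (tens v w)) x).

Definition tmul (K : fieldType) (A B : algType K) (x y : A ⊗ B) : A ⊗ B :=
  tlift (fun a b => tmap ( *%R a) ( *%R b) y) x.

Section TensorOps.
Variable K : fieldType.

Lemma tmap_bilinear (U V U' V' : lmodType K)
    (f : {linear U -> U'}) (g : {linear V -> V'}) :
  bilinear_for *:%R *:%R (fun u v => tens (f u) (g v)).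
Proof.
by split=> [v a u u'|u a v v'] /=; rewrite linearP ?linearPl ?linearPr.
Qed.

Lemma tmap_tens (U V U' V' : lmodType K)
    (f : {linear U -> U'}) (g : {linear V -> V'}) u v :
  tmap f g (tens u v) = tens (f u) (g v).
Proof. exact: (tliftE (tmap_bilinear f g)). Qed.

Lemma tassoc_tens (U V W : lmodType K) (u : U) (v : V) (w : W) :
  tassoc (tens (tens u v) w) = tens u (tens v w).
Proof.
have inner w' : bilinear_for *:%R *:%R (fun u v => tens u (tens v w') : U ⊗ (V ⊗ W)).
  by split=> [y a x x'|x a y y'] /=; rewrite ?linearPl ?linearPr.
rewrite /tassoc tliftE ?(tliftE (inner w)) //.
split=> [w' a x x'|x a y y'] /=; first exact: tlift_is_linear.
rewrite /tlift /sum_eval scaler_sumr -big_split /=.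
by apply: eq_bigr => p _; rewrite !linearPr.
Qed.

Lemma tmul_tens (A B : algType K) (a c : A) (b d : B) :
  tmul (tens a b) (tens c d) = tens (a * c) (b * d).
Proof.
have inner x y : bilinear_for *:%R *:%R (fun u v => tens (x * u : A) (y * v : B)).
  by split=> [v k u u'|u k v v'];
    rewrite mulrDr -scalerAr ?linearPl ?linearPr.
rewrite /tmul /tmap tliftE ?(tliftE (inner a b)) //.
split=> [y k x x'|x k y y'] /=; rewrite /tlift /sum_eval scaler_sumr -big_split /=;
  apply: eq_bigr => p _.
  by rewrite mulrDl -scalerAl linearPl.
by rewrite mulrDl -scalerAl linearPr.
Qed.

End TensorOps.

Record hopf_structure (K : fieldType) (H : algType K) := HopfStructure {
  comul : {linear H -> H ⊗ H};
  counit : {linear H -> K^o};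
  antipode : {linear H -> H};
  comul1 : comul 1 = tens 1 1;
  comulM : forall a b, comul (a * b) = tmul (comul a) (comul b);
  counit1 : counit 1 = 1;
  counitM : forall a b, counit (a * b) = counit a * counit b;
  coassoc : forall h,
    tassoc (tmap comul id (comul h)) = tmap id comul (comul h);
  counitl : forall h, tlift (fun a b => counit a *: b) (comul h) = h;
  counitr : forall h, tlift (fun a b => counit b *: a) (comul h) = h;
  antipodel : forall h,
    tlift (fun a b => antipode a * b) (comul h) = (counit h)%:A;
  antipoder : forall h,
    tlift (fun a b => a * antipode b) (comul h) = (counit h)%:A
}.

Record central_subalg (K : fieldType) (A : algType K) := CentralSubalg {
  csub_pred : {pred A};
  csub_closed : subalg_closed csub_pred;
  csub_central : forall c, c \in csub_pred -> forall a, c * a = a * c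
}.

Section CentralSubalgType.
Variables (K : fieldType) (A : algType K) (C : central_subalg A).

HB.instance Definition _ :=
  GRing.isSubalgClosed.Build K A (csub_pred C) (csub_closed C).

Definition csub_type : Type := {x : A | x \in csub_pred C}.

HB.instance Definition _ := SubChoice.on csub_type.
HB.instance Definition _ := [SubChoice_isSubAlgebra of csub_type by <:].

Let csub_mulC : commutative (@GRing.mul csub_type).
Proof. by move=> x y; apply: val_inj; rewrite !rmorphM /= (csub_central (valP x)). Qed.

HB.instance Definition _ :=
  GRing.PzSemiRing_hasCommutativeMul.Build csub_type csub_mulC.

End CentralSubalgType.

Coercion csub_type : central_subalg >-> Sortclass.

Definition hopf_subalg (K : fieldType) (H : algType K) (hH : hopf_structure H)
    (C : central_subalg H) : Prop :=
  forall c : C,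
    (exists s : seq (C * C),
       comul hH (val c) = \sum_(p <- s) tens (val p.1) (val p.2))
    /\ antipode hH (val c) \in csub_pred C.

Definition affine (K : fieldType) (A : algType K) : Prop :=
  exists s : seq A, forall S : {pred A},
    subalg_closed S -> {subset s <= S} -> forall x, x \in S.

Section CayleyHamilton.
Variables (K : fieldType) (A : algType K) (C : central_subalg A).
Variable tr : A -> C.

Definition is_trace : Prop :=
  (forall (c : C) (a b : A), tr (val c * a + b) = c * tr a + tr b)
  /\ (forall a b : A, tr (a * b) = tr (b * a)).

(* Indices are shifted by one with respect to the usual 1-based convention.    *)
Definition ch_mx (k : nat) (a : A) : 'M[C]_k :=
  \matrix_(i, j) if (j <= i)%N then tr (a ^+ (i - j + 1))
                 else if j == i.+1 :> nat then i.+1%:R else 0.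

Definition ch_coef (k : nat) (a : A) : C :=
  (k`!%:R : K)^-1 *: \det (ch_mx k a).

Definition ch_poly (n : nat) (a : A) : {poly C} :=
  'X^n + \sum_(1 <= k < n.+1) ((-1) ^+ k * ch_coef k a) *: 'X^(n - k).

Definition cayley_hamilton (n : nat) : Prop :=
  [/\ is_trace, forall a : A, (map_poly val (ch_poly n a)).[a] = 0
    & tr 1 = n%:R].

Definition discriminant (k : nat) (a : 'I_k -> A) : C :=
  \det (\matrix_(i, j) tr (a i * a j)).

Definition ideal_gen (R : comNzRingType) (X : set R) : set R :=
  [set x | exists s : seq (R * R),
     (forall p, p \in s -> X p.2) /\ x = \sum_(p <- s) p.1 * p.2]%classic.

Definition discriminant_ideal (k : nat) : set C :=
  ideal_gen (range (@discriminant k)).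

End CayleyHamilton.

Definition cayley_hamilton_hopf (K : fieldType) (H : algType K)
    (hH : hopf_structure H) (C : central_subalg H) (tr : H -> C) : Prop :=
  hopf_subalg hH C /\ exists n, cayley_hamilton tr n.

Section Modules.
Variables (K : fieldType) (H : algType K).

(* A left H-module is a vector space M with an action act : H -> M -> M; it is *)
(* not an lmodType H because M also keeps its K-structure.                     *)
Definition is_action (M : lmodType K) (act : H -> M -> M) : Prop :=
  [/\ forall v, linear (act^~ v), forall h, linear (act h),
      forall v, act 1 v = v
    & forall g h v, act (g * h) v = act g (act h v)].

Definition submodule (M : lmodType K) (act : H -> M -> M) (N : {pred M}) : Prop :=
  submod_closed N /\ forall h v, v \in N -> act h v \in N.

Definition irreducible (M : lmodType K) (act : H -> M -> M) (N : {pred M}) : Prop :=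
  [/\ submodule act N, exists2 v, v \in N & v != 0
    & forall L : {pred M}, submodule act L -> {subset L <= N} ->
        L =i pred1 0 \/ L =i N].

(* M is a finite direct sum of irreducible submodules; this is used for        *)
(* finite-dimensional M only.                                                  *)
Definition completely_reducible (M : lmodType K) (act : H -> M -> M) : Prop :=
  exists (m : nat) (N : 'I_m -> {pred M}),
    (forall i, irreducible act (N i))
    /\ forall v, exists! u : {ffun 'I_m -> M},
         (forall i, u i \in N i) /\ v = \sum_i u i.

Definition tensor_act (hH : hopf_structure H) (V W : lmodType K)
    (actV : H -> V -> V) (actW : H -> W -> W) (h : H) (t : V ⊗ W) : V ⊗ W :=
  tlift (fun a b => tmap (actV a) (actW b) t) (comul hH h).

Definition chevalley (hH : hopf_structure H) : Prop :=
  forall (V W : vectType K) (actV : H -> V -> V) (actW : H -> W -> W),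
    is_action actV -> irreducible actV predT ->
    is_action actW -> irreducible actW predT ->
    completely_reducible (tensor_act hH actV actW).

End Modules.

(* Main.v *)
Require Import Defs.
From HB Require Import structures.
From mathcomp Require Import all_boot all_order all_algebra.
From mathcomp Require Import boolp classical_sets ring.

Set Implicit Arguments.
Unset Strict Implicit.
Unset Printing Implicit Defensive.

Import GRing.Theory.
Local Open Scope ring_scope.
Local Open Scope quotient_scope.

(** A point is a morphism of algebras [chi : C -> K].  The symmetric form
    [chi (tr (a b))] on [H] has a radical [J], a two-sided ideal; the fibre at [chi]
    is the algebra [A = H / J].  In characteristic zero a symmetric form of rank [r]
    has a nonzero Gram determinant of size [k] just when [k <= r], so [D_k] vanishes
    at [chi] if and only if [dim A < k].  The theorem thus follows from three facts:
    all fibres have the same finite dimension, a proper ideal of [C] vanishes at some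
    point, and an element of [C] that vanishes at all points is [0].

    The dimension of the fibres ([peirce], [comul_radical], [fibre_dim_le]).  In a
    fibre nilpotent elements have trace [0] and orthogonal idempotents are at most
    [n], by the Cayley-Hamilton identity.  A maximal system of orthogonal idempotents
    [e_i] then has [e_i A e_i = K e_i] and [e_i A e_j] at most a line, so [A] has
    dimension at most [n ^ 2] and is a sum of irreducible modules [A e_i].  For points
    [g] and [h], the Chevalley property makes [A_g ⊗ A_h] a semisimple [H]-module
    over the point [g h].  The radical at [g h] is nil modulo the ideal of that point,
    so it acts by zero, that is, the coproduct induces a map from [A_(g h)] to
    [A_g ⊗ A_h].  The canonical map [a ⊗ b |-> a b_1 ⊗ b_2] therefore goes from
    [A_g ⊗ A_(g h)] to [A_g ⊗ A_h], and the antipode shows that it is onto.  Hence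
    [dim A_h <= dim A_(g h)] for all [g] and [h], and all dimensions are equal because
    the points form a group.

    Enough points ([affine_finite], [zariski], [point_avoiding]).  Filter [H] by the
    length of words in its generators.  By Cayley-Hamilton the associated graded
    algebra is nil of index [n] over [C], so nilpotent by the Nagata-Higman theorem:
    long words are [C]-combinations of shorter ones.  The coefficients that occur
    generate an affine algebra over which [H] is a finite module; so ideals of [C]
    satisfy the ascending chain condition and [C] is integral over this algebra.
    Zariski's lemma then provides points at which an ideal vanishes and an element,
    no power of which is in the ideal, does not.

    [C] is reduced ([nilpotent_ideal_pow], [krull_intersection], [central_reduced]).
    This is Cartier's theorem.  An Euler operator made of invariant derivations shows
    that nilpotents lie in all powers of the kernel of the counit; by Krull's theorem
    they vanish near the unit, and by translation at every point, so their annihilator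
    is not a proper ideal. *)

(** * Additive subgroups with torsion-free quotient *)

Definition subgroup (V : zmodType) (G : V -> Prop) : Prop :=
  G 0 /\ forall x y, G x -> G y -> G (x - y).

Definition pure (V : zmodType) (G : V -> Prop) : Prop :=
  forall k x, G (x *+ k.+1) -> G x.

Section Subgroup.
Variables (V : zmodType) (G : V -> Prop).
Hypothesis sG : subgroup G.

Lemma subgroupN x : G x -> G (- x).
Proof. by move=> Gx; rewrite -sub0r; apply: sG.2 => //; exact: sG.1. Qed.

Lemma subgroupD x y : G x -> G y -> G (x + y).
Proof. by move=> Gx Gy; rewrite -[y]opprK; apply: sG.2 => //; exact: subgroupN. Qed.

Lemma subgroup_sum (I : Type) (r : seq I) (P : pred I) (F : I -> V) :
  (forall i, P i -> G (F i)) -> G (\sum_(i <- r | P i) F i).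
Proof. by move=> GF; apply: (big_ind G); [exact: sG.1|exact: subgroupD|]. Qed.

Lemma subgroup_sum_seq (I : eqType) (r : seq I) (F : I -> V) :
  (forall i, i \in r -> G (F i)) -> G (\sum_(i <- r) F i).
Proof. by move=> GF; rewrite big_seq_cond; apply: subgroup_sum => i /andP[/GF]. Qed.

(** Replacing [l] by [2 l] and subtracting [2 ^ d] times the original removes
    the top coefficient: a Vandermonde argument that divides by integers only. *)
Lemma coef_in_subgroup d (m : nat -> V) : pure G ->
  (forall l, G (\sum_(j < d) m j *+ (l ^ j)%N)) -> forall j, (j < d)%N -> G (m j).
Proof.
move=> pG; elim: d m => // d IH m Gm.
have Glow j : (j < d)%N -> G (m j).
  move=> jd; have gt0 : (0 < 2 ^ d - 2 ^ j)%N by rewrite subn_gt0 ltn_exp2l.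
  apply: (pG (2 ^ d - 2 ^ j).-1); rewrite prednK //.
  apply: (IH (fun j => m j *+ (2 ^ d - 2 ^ j)%N)) => // l.
  have -> : \sum_(i < d) m i *+ (2 ^ d - 2 ^ i)%N *+ (l ^ i)%N =
            \sum_(i < d.+1) m i *+ (l ^ i)%N *+ (2 ^ d)%N
              - \sum_(i < d.+1) m i *+ ((2 * l) ^ i)%N.
    rewrite !big_ord_recr /= expnMn -mulrnA (mulnC (l ^ d)%N) opprD addrACA subrr addr0.
    rewrite -sumrB; apply: eq_bigr => i _.
    rewrite mulrnBr ?leq_exp2l ?(ltnW (ltn_ord i)) // mulrnBl.
    by rewrite expnMn -!mulrnA (mulnC (l ^ i)%N).
  apply: sG.2 => //; rewrite sumrMnl.
  by elim: (2 ^ d)%N => [|k IHk]; rewrite ?mulr0n ?mulrS;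
    [exact: sG.1 | exact: subgroupD].
move=> j; rewrite ltnS leq_eqVlt => /orP[/eqP ->|/Glow //].
have := Gm 1%N; rewrite big_ord_recr /= exp1n => Gs.
rewrite -[m d](addKr (\sum_(i < d) m i *+ (1 ^ i)%N)) addrC.
by apply: sG.2 => //; apply: subgroup_sum => i _; rewrite exp1n; apply: Glow.
Qed.

End Subgroup.

(** * Nil algebras of bounded index are nilpotent *)

Section NagataHigman.
Variables (R : nzRingType) (P : R -> Prop).
Hypothesis sP : subgroup P.
Hypothesis mulP : forall x y, P x -> P y -> P (x * y).

Definition ideal_of (G : R -> Prop) : Prop :=
  [/\ subgroup G, pure G & forall x g, P x -> G g -> G (x * g) /\ G (g * x)].

Lemma coef01_expDX (x y : R) m :
  ((x%:P + y *: 'X) ^+ m)`_0 = x ^+ m /\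
  ((x%:P + y *: 'X) ^+ m.+1)`_1 = \sum_(i < m.+1) x ^+ i * y * x ^+ (m - i).
Proof.
elim: m => [|m [IH0 IH1]].
  by rewrite !expr0 coef1 expr1 coefD coefC coefZ coefX /= big_ord1 !mulr1 mul1r add0r.
have step k p : (((x%:P + y *: 'X) * p)`_k.+1 = x * p`_k.+1 + y * p`_k)%R.
  by rewrite mulrDl coefD coefCM -scalerAl coefZ coefXM.
have IH0' : ((x%:P + y *: 'X) ^+ m.+1)`_0 = x ^+ m.+1.
  by rewrite exprS mulrDl coefD coefCM -scalerAl coefZ coefXM /= mulr0 addr0 IH0 -exprS.
split=> //; rewrite exprS step IH1 IH0' [RHS]big_ord_recl expr0 mul1r subn0 addrC.
congr (_ + _); rewrite mulr_sumr; apply: eq_bigr => i _.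
by rewrite /= /bump /= add1n subSS exprS !mulrA.
Qed.

Section Step.
Variables (G : R -> Prop) (n : nat).
Hypothesis iG : ideal_of G.
Hypothesis nilG : forall x, P x -> G (x ^+ n.+1).

Lemma linearized_power_in x y :
  P x -> P y -> G (\sum_(i < n.+1) x ^+ i * y * x ^+ (n - i)).
Proof.
have [sG pG _] := iG; move=> Px Py.
pose q := (x%:P + y *: 'X) ^+ n.+1; rewrite -(coef01_expDX x y n).2 -/q.
have G1 : forall j, (j < (size q).+2)%N -> G q`_j.
  apply: (coef_in_subgroup sG pG) => l.
  suff -> : \sum_(j < (size q).+2) q`_j *+ (l ^ j)%N = (x + y *+ l) ^+ n.+1.
    apply: nilG; apply: (subgroupD sP) => //.
    by elim: l => [|l IH]; rewrite ?mulr0n ?mulrS; [exact: sP.1 | exact: subgroupD].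
  have c_l p : comm_poly p (l%:R : R) by rewrite /comm_poly; apply/esym/commr_nat.
  transitivity (q.[l%:R]).
    rewrite (horner_coef_wide _ (leqW (leqnSn (size q)))).
    by apply: eq_bigr => i _; rewrite -natrX mulr_natr.
  rewrite horner_exp_comm // hornerD hornerC hornerZ hornerX mulr_natr //.
exact: G1.
Qed.

Let expP x i : P x -> P (x ^+ i.+1).
Proof. by move=> Px; elim: i => // i IH; rewrite exprS; apply: mulP. Qed.

Let mulGr x g i : P x -> G g -> G (g * x ^+ i).
Proof.
move=> Px Gg; case: i => [|i]; first by rewrite mulr1.
by case: iG => _ _ h; exact: (h _ _ (expP i Px) Gg).2.
Qed.

(** Summing [x ^ (n - i) z y ^ j x ^ i y ^ (n - j)] over [i] first shows that the
    double sum lies in [G]; summing over [j] first leaves only the terms with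
    [i = 0], which are [n + 1] times [x ^ n z y ^ n]. *)
Lemma power_mul_power_in x y z :
  P x -> P y -> P z -> G (x ^+ n * z * y ^+ n).
Proof.
have [sG pG mG] := iG; move=> Px Py Pz.
pose T i j := x ^+ (n - i) * z * y ^+ j * x ^+ i * y ^+ (n - j).
have GT : G (\sum_(i < n.+1) \sum_(j < n.+1) T i j).
  rewrite exchange_big; apply: (subgroup_sum sG) => j _ /=.
  rewrite -mulr_suml; apply: mulGr => //.
  have Pzy : P (z * y ^+ j).
    by case: (j : nat) => [|k]; [rewrite mulr1 | apply/mulP/expP].
  have := linearized_power_in Px Pzy.
  rewrite (reindex_inj rev_ord_inj) /=.
  congr G; apply: eq_bigr => i _.
  by rewrite subSS subKn -1?ltnS // !mulrA.
apply: (pG n).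
have -> : x ^+ n * z * y ^+ n *+ n.+1 = \sum_(j < n.+1) T 0%N j.
  rewrite (eq_bigr (fun=> x ^+ n * z * y ^+ n)) ?sumr_const ?card_ord // => j _.
  by rewrite /T subn0 mulr1 -mulrA -exprD subnKC // -ltnS.
rewrite big_ord_recl in GT.
rewrite -[X in G X](addrK (\sum_(i < n) \sum_(j < n.+1) T (lift ord0 i) j)).
apply: sG.2 => //; apply: (subgroup_sum sG) => i _.
have -> : \sum_(j < n.+1) T (lift ord0 i) j =
  x ^+ (n - i.+1) * z * \sum_(j < n.+1) y ^+ j * x ^+ i.+1 * y ^+ (n - j).
  rewrite mulr_sumr; apply: eq_bigr => j _.
  by rewrite /T /= /bump /= add1n !mulrA.
have Gf := linearized_power_in Py (expP i Px).
have Pxz : P (x ^+ (n - i.+1) * z).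
  by case: (_ - _)%N => [|k]; [rewrite mul1r | apply: mulP => //; apply: expP].
exact: (mG _ _ Pxz Gf).1.
Qed.

End Step.

(** The Nagata-Higman theorem, relative to an ideal [G] of the non-unital ring
    [P].  If [x ^ (n + 2)] lies in [G] for all [x], then the [g] with
    [g P x ^ (n + 1)] inside [G] form an ideal modulo which [P] has nil index
    [n + 1]; so do, for a long product [w], the [g] with [w P g] inside [G]. *)
Theorem nagata_higman n (G : R -> Prop) :
  ideal_of G -> (forall x, P x -> G (x ^+ n.+1)) ->
  forall s : seq R, size s = (2 ^ n.+1).-1 -> (forall x, x \in s -> P x) ->
    G (\prod_(x <- s) x).
Proof.
elim: n G => [|n IH] G iG nilG s.
  case: s => [|x [|]] //= _ Ps; rewrite big_seq1 -[x]expr1.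
  by apply: nilG; apply: Ps; rewrite mem_head.
have [sG pG mG] := iG; move=> szs Ps.
pose G1 g := forall z y, P z -> P y -> G (g * z * y ^+ n.+1).
have iG1 : ideal_of G1.
  split.
  - split=> [z y _ _|a b Ga Gb z y Pz Py]; first by rewrite !mul0r; exact: sG.1.
    by rewrite !mulrBl; apply: sG.2; [exact: Ga | exact: Gb].
  - move=> k x Gx z y Pz Py; apply: (pG k).
    by rewrite -!mulrnAl; exact: Gx.
  - move=> x g Px Gg; split=> z y Pz Py.
      by rewrite -!mulrA; apply: (mG _ _ Px _).1; rewrite mulrA; exact: Gg.
    by rewrite -(mulrA g); apply: Gg => //; exact: mulP.
have nilG1 x : P x -> G1 (x ^+ n.+1).
  by move=> Px z y Pz Py; exact: (power_mul_power_in iG nilG).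
pose k := (2 ^ n.+1).-1.
have k2 : (2 ^ n.+2).-1 = (k + k.+1)%N.
  by rewrite /k prednK ?expn_gt0 // (expnS 2 n.+1) mul2n -addnn -subn1 -subn1 addnBAC ?expn_gt0.
pose w1 := \prod_(x <- take k s) x.
have sz1 : size (take k s) = k by rewrite size_take szs k2 -addSnnS leq_addr.
have G1w : G1 w1.
  by apply: (IH G1) => // x /mem_take; exact: Ps.
pose G2 g := forall z, P z -> G (w1 * z * g).
have iG2 : ideal_of G2.
  split.
  - split=> [z _|a b Ga Gb z Pz]; first by rewrite mulr0; exact: sG.1.
    by rewrite mulrBr; apply: sG.2; [exact: Ga | exact: Gb].
  - by move=> l x Gx z Pz; apply: (pG l); rewrite -mulrnAr; exact: Gx.
  - move=> x g Px Gg; split=> z Pz.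
      by rewrite mulrA -(mulrA w1); apply: Gg; exact: mulP.
    by rewrite mulrA; apply: (mG _ _ Px _).2; exact: Gg.
rewrite -(cat_take_drop k s) big_cat /= -/w1.
have : size (drop k s) = k.+1 by rewrite size_drop szs k2 addKn.
have : forall x, x \in drop k s -> P x by move=> x /mem_drop; exact: Ps.
case: (drop k s) => //= z s2 Ps2 [sz2]; rewrite big_cons mulrA.
have Pz : P z by apply: Ps2; rewrite mem_head.
apply: (IH G2) => // [x Px z' Pz'|x xs]; first exact: G1w.
by apply: Ps2; rewrite inE xs orbT.
Qed.

End NagataHigman.

(** * A finitely generated Cayley-Hamilton algebra is finite over its centre *)

(** A named copy of [val] that carries the structure of an algebra morphism. *)
Section Inclusion.
Variables (K : fieldType) (H : algType K) (C : central_subalg H).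

Definition incl (c : C) : H := \val c.

Lemma incl_is_linear : linear incl. Proof. by []. Qed.
HB.instance Definition _ := GRing.isLinear.Build K C H *:%R incl incl_is_linear.

Lemma incl_is_monoid_morphism : monoid_morphism incl. Proof. by []. Qed.
HB.instance Definition _ := GRing.isMonoidMorphism.Build C H incl incl_is_monoid_morphism.

Lemma incl_inj : injective incl. Proof. exact: val_inj. Qed.

Lemma inclC c x : incl c * x = x * incl c.
Proof. exact: (csub_central (valP c)). Qed.

Lemma inclA k : incl k%:A = k%:A.
Proof. by rewrite linearZ /= rmorph1. Qed.

Lemma inclAZ k x : incl k%:A * x = k *: x.
Proof. by rewrite inclA -scalerAl mul1r. Qed.

End Inclusion.

Section CHAlgebra.
Variables (K : fieldType) (charK : [pchar K] =i pred0).
Variables (H : algType K) (C : central_subalg H) (tr : H -> C) (n : nat).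
Hypothesis CH : cayley_hamilton tr n.

Implicit Types (c : C) (a b x : H).

Lemma natK_neq0 k : k.+1%:R != 0 :> K.
Proof. by rewrite (GRing.pcharf0P _).1. Qed.

Lemma mulrn_inj_lmod (V : lmodType K) k (v : V) : v *+ k.+1 = 0 -> v = 0.
Proof.
move=> v0; have: k.+1%:R *: v = 0 by rewrite scaler_nat.
by move/eqP; rewrite scaler_eq0 (negPf (natK_neq0 k)) => /eqP.
Qed.

Lemma tr_linear c a b : tr (incl c * a + b) = c * tr a + tr b.
Proof. by have [[tr_lin _] _ _] := CH; exact: tr_lin. Qed.

Lemma trC a b : tr (a * b) = tr (b * a).
Proof. by have [[_ tr_comm] _ _] := CH; exact: tr_comm. Qed.

Lemma trD a b : tr (a + b) = tr a + tr b.
Proof. by have := tr_linear 1 a b; rewrite rmorph1 !mul1r. Qed.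

Lemma tr0 : tr 0 = 0.
Proof. by apply: (addrI (tr 0)); rewrite -trD !addr0. Qed.

Lemma trM c a : tr (incl c * a) = c * tr a.
Proof. by have := tr_linear c a 0; rewrite tr0 !addr0. Qed.

Lemma trZ k a : tr (k *: a) = k *: tr a.
Proof. by have := trM k%:A a; rewrite inclAZ mulr_algl. Qed.

Lemma trMn a k : tr (a *+ k) = tr a *+ k.
Proof. by rewrite -!scaler_nat trZ. Qed.

Lemma tr_sum (I : Type) (r : seq I) (F : I -> H) :
  tr (\sum_(i <- r) F i) = \sum_(i <- r) tr (F i).
Proof. exact: (big_morph tr trD tr0). Qed.

Lemma tr1 : tr 1 = n%:R. Proof. by have [] := CH. Qed.

Lemma cayley_hamilton_sum a :
  a ^+ n + \sum_(1 <= k < n.+1) incl ((-1) ^+ k * ch_coef tr k a) * a ^+ (n - k) = 0.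
Proof.
have [_ ch _] := CH.
transitivity ((map_poly (@incl K H C) (ch_poly tr n a)).[a]); last exact: ch.
rewrite /ch_poly rmorphD /= map_polyXn rmorph_sum.
rewrite hornerD hornerXn horner_sum; congr (_ + _); apply: eq_bigr => k _.
by rewrite /= map_polyZ map_polyXn hornerZ hornerXn.
Qed.

Lemma degree_gt0 : (0 < n)%N.
Proof.
rewrite lt0n; apply/eqP => n0; have := cayley_hamilton_sum 0.
by rewrite n0 big_nil addr0 expr0 => /eqP; rewrite oner_eq0.
Qed.

Lemma horner_nat (R : nzRingType) (p : {poly R}) l :
  p.[l%:R] = \sum_(j < size p) p`_j *+ (l ^ j)%N.
Proof. by rewrite horner_coef; apply: eq_bigr => i _; rewrite -natrX mulr_natr. Qed.

Lemma comm_poly_nat (R : nzRingType) (p : {poly R}) l : comm_poly p l%:R.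
Proof. by rewrite /comm_poly; apply/esym/commr_nat. Qed.

(** The coefficients of the characteristic polynomial of [p(l)] are polynomials
    in [l], and a polynomial over [H] that vanishes at all integers is [0]. *)
Lemma cayley_hamilton_poly (p : {poly H}) : p`_0 = 0 ->
  exists2 q : nat -> {poly C}, forall k, (0 < k)%N -> (q k)`_0 = 0 &
    p ^+ n + \sum_(1 <= k < n.+1) map_poly (@incl K H C) (q k) * p ^+ (n - k) = 0.
Proof.
move=> p0.
pose M k : 'M[{poly C}]_k := \matrix_(i, j)
  if (j <= i)%N then map_poly tr (p ^+ (i - j + 1))
  else if j == i.+1 :> nat then i.+1%:R else 0.
pose q k := (-1) ^+ k * ((k`!%:R : K)^-1)%:A%:P * \det (M k).
have trl (r : {poly H}) l : (map_poly tr r).[l%:R] = tr r.[l%:R].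
  rewrite horner_nat [r.[_]]horner_nat tr_sum.
  rewrite -horner_nat (horner_coef_wide _ (size_poly _ _)).
  by apply: eq_bigr => i _; rewrite coef_map_id0 ?tr0 // -natrX mulr_natr trMn.
have ql k l : (q k).[l%:R] = (-1) ^+ k * ch_coef tr k p.[l%:R].
  rewrite /q /ch_coef !hornerE -mulrA mulr_algl.
  congr (_ * (_ *: _)); rewrite -[LHS]/(horner_eval _ _) -det_map_mx.
  congr (\det _); apply/matrixP => i j; rewrite !mxE /= /horner_eval.
  case: ifP => _; first by rewrite trl horner_exp_comm //; exact: comm_poly_nat.
  by case: ifP => _; rewrite ?hornerE // -polyC_natr hornerC.
exists q => [k k0|].
  rewrite -horner_coef0 -[0](_ : 0%:R = 0) // ql horner_coef0 p0 /ch_coef.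
  case: k k0 => // k _; rewrite (expand_det_col _ ord0) big1 ?scaler0 ?mulr0 // => i _.
  by rewrite mxE /= addn1 expr0n /= tr0 mul0r.
set Q := (X in X = 0).
have QE l : Q.[l%:R] = 0.
  transitivity (let a := p.[l%:R] in
    a ^+ n + \sum_(1 <= k < n.+1) incl ((-1) ^+ k * ch_coef tr k a) * a ^+ (n - k));
    last exact: cayley_hamilton_sum.
  rewrite /Q /= hornerD horner_sum.
  rewrite horner_exp_comm ?horner_sum; last exact: comm_poly_nat.
  congr (_ + _); apply: eq_bigr => k _.
  rewrite hornerM_comm; last exact: comm_poly_nat.
  rewrite horner_exp_comm; last exact: comm_poly_nat.
  by rewrite -ql -(horner_map (@incl K H C)) rmorph_nat.
apply/polyP => i; rewrite coef0.
case: (ltnP i (size Q)) => [|/(nth_default 0) //].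
have sg0 : subgroup (fun x : H => x = 0) by split=> // x y -> ->; rewrite subr0.
apply: (coef_in_subgroup sg0 (m := fun j => Q`_j)) => [k x|l].
  exact: mulrn_inj_lmod.
by rewrite -horner_nat.
Qed.

Definition span (T : C -> Prop) (B : seq H) (x : H) : Prop :=
  exists2 r : seq (C * H), (forall p, p \in r -> T p.1 /\ p.2 \in B)
    & x = \sum_(p <- r) incl p.1 * p.2.

Section Span.
Variables (T : C -> Prop).
Hypotheses (T1 : T 1) (TN : forall c, T c -> T (- c)).
Hypothesis TM : forall c d, T c -> T d -> T (c * d).

Lemma span_subgroup B : subgroup (span T B).
Proof.
split; first by exists [::] => //; rewrite big_nil.
move=> _ _ [r rP ->] [s sP ->]; exists (r ++ [seq (- p.1, p.2) | p <- s]).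
  move=> p; rewrite mem_cat => /orP[/rP //|/mapP[u /sP[Tu Bu] ->]].
  by split=> //; exact: TN.
rewrite big_cat big_map /= -sumrN; congr (_ + _); apply: eq_bigr => p _.
by rewrite rmorphN mulNr.
Qed.

Lemma spanM B c x : T c -> span T B x -> span T B (incl c * x).
Proof.
move=> Tc [r rP ->]; exists [seq (c * p.1, p.2) | p <- r].
  by move=> p /mapP[u /rP[Tu Bu] ->]; split=> //; exact: TM.
by rewrite big_map mulr_sumr; apply: eq_bigr => p _; rewrite rmorphM mulrA.
Qed.

Lemma mem_span B x : x \in B -> span T B x.
Proof.
move=> Bx; exists [:: (1, x)] => [p|]; first by rewrite inE => /eqP ->.
by rewrite big_seq1 rmorph1 mul1r.
Qed.

Lemma span_ind B (G : H -> Prop) : subgroup G ->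
  (forall c x, T c -> G x -> G (incl c * x)) -> (forall b, b \in B -> G b) ->
  forall x, span T B x -> G x.
Proof.
move=> sG GZ GB x [r rP ->]; apply: subgroup_sum_seq => // p /rP[Tp Bp].
by apply: GZ => //; exact: GB.
Qed.

End Span.

Section Words.
Variable s : seq H.

Fixpoint words l : seq H :=
  if l is l'.+1 then words l' ++ [seq x * w | x <- s, w <- words l'] else [:: 1].

Lemma wordsS l : words l.+1 = words l ++ [seq x * w | x <- s, w <- words l].
Proof. by []. Qed.

Let M l := span (fun=> True) (words l).

Lemma words_mono l k w : (l <= k)%N -> w \in words l -> w \in words k.
Proof.
move/subnK <-; elim: (k - l)%N => // m IH wl.
by rewrite addSn /= mem_cat IH.
Qed.

Lemma wordsM l k w v : w \in words l -> v \in words k -> w * v \in words (l + k).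
Proof.
elim: l w => [|l IH] w /=; first by rewrite inE => /eqP ->; rewrite mul1r.
rewrite mem_cat => /orP[wl|/allpairsP[[x u] /= [xs ul ->]]] vk.
  by rewrite mem_cat IH.
rewrite mem_cat; apply/orP; right; rewrite -mulrA.
by apply/allpairsP; exists (x, u * v); split=> //; exact: IH.
Qed.

Lemma mem_words1 x : x \in s -> x \in words 1.
Proof.
move=> xs; rewrite wordsS mem_cat; apply/orP; right.
by apply/allpairsP; exists (x, 1); rewrite /= mulr1 inE.
Qed.

Lemma words_split l w : w \in words l.+1 -> w \in words l \/
  exists2 u : seq H, size u = l.+1 /\ {subset u <= s} & w = \prod_(x <- u) x.
Proof.
elim: l w => [|l IH] w.
  rewrite wordsS mem_cat => /orP[|]; first by left.
  move=> /allpairsP[[x v] /= [xs + ->]]; rewrite inE => /eqP ->.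
  right; exists [:: x]; last by rewrite big_seq1 mulr1.
  by split=> // y; rewrite inE => /eqP ->.
rewrite wordsS mem_cat => /orP[|]; first by left.
move=> /allpairsP[[x v] /= [xs vl ->]].
have [vl'|[u [szu us] ->]] := IH v vl.
  by left; apply: (wordsM (l := 1)) => //; exact: mem_words1.
right; exists (x :: u); last by rewrite big_cons.
by split=> [|y]; [rewrite /= szu|rewrite inE => /orP[/eqP ->|/us]].
Qed.

Let sM l : subgroup (M l). Proof. exact: span_subgroup. Qed.
Let MZ l c x : M l x -> M l (incl c * x). Proof. exact: spanM. Qed.

Let M_mono l k x : (l <= k)%N -> M l x -> M k x.
Proof.
move=> lk; apply: span_ind => [|c y _|b bl]; [exact: sM|exact: MZ|].
by apply: mem_span => //; exact: words_mono bl.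
Qed.

Let MM l k x y : M l x -> M k y -> M (l + k) (x * y).
Proof.
move=> Mx My; move: x Mx; apply: span_ind.
- split=> [|a b Ma Mb]; first by rewrite mul0r; exact: (sM _).1.
  by rewrite mulrBl; exact: (sM _).2.
- by move=> c x _ Mx; rewrite -mulrA; exact: MZ.
move=> w wl; move: y My; apply: span_ind.
- split=> [|a b Ma Mb]; first by rewrite mulr0; exact: (sM _).1.
  by rewrite mulrBr; exact: (sM _).2.
- by move=> c x _ Mx; rewrite mulrA -inclC -mulrA; exact: MZ.
by move=> v vk; apply: mem_span => //; exact: wordsM.
Qed.

Let M_pure l : pure (M l).
Proof.
move=> k x /(MZ ((k.+1%:R : K)^-1)%:A); rewrite inclAZ.
by rewrite -scaler_nat scalerA mulVf ?scale1r //; exact: natK_neq0.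
Qed.

(** The Rees ring of the filtration of [H] by the length of words, without its
    constant terms, is nil of index [n] modulo the elements whose length falls:
    in [p ^ n = - \sum_k c_k p ^ (n - k)] the coefficient [c_k] takes up at least
    one degree and has length [0]. *)
Lemma long_word_span (u : seq H) : size u = (2 ^ n).-1 -> {subset u <= s} ->
  M (2 ^ n).-2 (\prod_(x <- u) x).
Proof.
move=> szu us; have n0 := degree_gt0; have nK := prednK n0.
pose P (p : {poly H}) := p`_0 = 0 /\ forall l, M l p`_l.
pose G (p : {poly H}) := p`_0 = 0 /\ forall l, M l p`_l.+1.
have sP : subgroup P.
  split; first by split=> [|l]; rewrite coef0 //; exact: (sM l).1.
  move=> p q [p0 Mp] [q0 Mq]; split=> [|l]; rewrite coefB ?p0 ?q0 ?subr0 //.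
  exact: (sM l).2.
have MprodP (p q : {poly H}) : (forall l, M l p`_l) -> (forall l, M l q`_l) -> forall l, M l (p * q)`_l.
  move=> Mp Mq l; rewrite coefM; apply: (subgroup_sum (sM l)) => i _.
  by rewrite -[X in M X _](subnKC (m := i) (n := l)) -1?ltnS //; exact: MM.
have PM p q : P p -> P q -> P (p * q).
  move=> [p0 Mp] [q0 Mq]; split; last exact: MprodP.
  by rewrite coefM big_ord1 p0 mul0r.
have iG : ideal_of P G.
  split.
  - split; first by split=> [|l]; rewrite coef0 //; exact: (sM l).1.
    move=> p q [p0 Mp] [q0 Mq]; split=> [|l]; rewrite coefB ?p0 ?q0 ?subr0 //.
    exact: (sM l).2.
  - move=> k p [p0 Mp]; split; first by move: p0; rewrite coefMn; exact: mulrn_inj_lmod.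
    by move=> l; have := Mp l; rewrite coefMn; exact: M_pure.
  - move=> p q [p0 Mp] [q0 Mq]; split; (split; first by
      rewrite coefM big_ord1 ?p0 ?q0 ?mulr0 ?mul0r) => l; rewrite coefM.
      rewrite big_ord_recr /= subnn q0 mulr0 addr0; apply: (subgroup_sum (sM l)) => i _.
      rewrite subSn -1?ltnS // -[X in M X _](subnKC (m := i) (n := l)) -1?ltnS //.
      exact: MM.
    rewrite big_ord_recl q0 mul0r add0r; apply: (subgroup_sum (sM l)) => i _.
    rewrite lift0 subSS -[X in M X _](subnKC (m := i) (n := l)) -1?ltnS //.
    exact: MM.
have nilG p : P p -> G (p ^+ n.-1.+1).
  move=> [p0 Mp]; rewrite nK.
  have Mpow k l : M l (p ^+ k)`_l.
    elim: k l => [|k IH] l; last by rewrite exprS; exact: MprodP.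
    rewrite expr0 coef1; case: eqP => [->|_]; last exact: (sM l).1.
    by apply: mem_span; rewrite // inE.
  split; first by rewrite -nK exprS coefM big_ord1 p0 mul0r.
  move=> l; have [q q0] := cayley_hamilton_poly p0.
  move/eqP; rewrite addr_eq0 => /eqP ->.
  rewrite coefN; apply: (subgroupN (sM l)); rewrite coef_sum.
  apply: subgroup_sum_seq; first exact: sM.
  move=> k; rewrite mem_index_iota => /andP[k0 _]; rewrite coefM big_ord_recl.
  have -> : (map_poly (@incl K H C) (q k))`_0 = 0.
    by rewrite coef_map /= q0 // linear0.
  rewrite mul0r add0r; apply: (subgroup_sum (sM l)) => i _.
  rewrite lift0 subSS coef_map; apply: MZ.
  by apply: (M_mono (l := l - i)); rewrite ?leq_subr.
have [] := nagata_higman sP PM iG nilG (s := [seq x *: 'X | x <- u]).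
- by rewrite size_map nK.
- move=> p /mapP[x xu ->]; split=> [|l]; rewrite coefZ coefX ?mulr0 //.
  case: eqP => [->|_]; last by rewrite mulr0; exact: (sM l).1.
  rewrite mulr1; apply: mem_span => //; apply: mem_words1; exact: us.
move=> _ /(_ (2 ^ n).-2); rewrite big_map.
have -> : \prod_(x <- u) (x *: 'X) = (\prod_(x <- u) x) *: 'X^(size u) :> {poly H}.
  elim: (u) => [|x v IH]; first by rewrite !big_nil scale1r.
  rewrite !big_cons IH exprS -!mul_polyC polyCM -!mulrA; congr (_ * _).
  by rewrite !mulrA commr_polyX.
have n2 : (0 < (2 ^ n).-1)%N by rewrite -subn1 subn_gt0 -{1}(expn0 2) ltn_exp2l.
by rewrite szu -[(2 ^ n).-1]prednK // coefZ coefXn eqxx mulr1.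
Qed.

End Words.

(** The generated subalgebra, as the intersection of the subalgebras that contain
    [ts]: the form in which [affine] speaks of generators. *)
Definition gen (ts : seq C) (c : C) : Prop :=
  forall S : {pred C}, subalg_closed S -> {subset ts <= S} -> c \in S.

Section Gen.
Variable ts : seq C.

Lemma gen_mem c : c \in ts -> gen ts c. Proof. by move=> cts S _; apply. Qed.
Lemma gen1 : gen ts 1. Proof. by move=> S [] . Qed.
Lemma genZD k c d : gen ts c -> gen ts d -> gen ts (k *: c + d).
Proof. by move=> gc gd S cS tsS; have [_ + _] := cS; apply; [exact: gc|exact: gd]. Qed.
Lemma genM c d : gen ts c -> gen ts d -> gen ts (c * d).
Proof. by move=> gc gd S cS tsS; have [_ _] := cS; apply; [exact: gc|exact: gd]. Qed.
Lemma gen0 : gen ts 0.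
Proof. by have := genZD (-1) gen1 gen1; rewrite scaleN1r addNr. Qed.
Lemma genZ k c : gen ts c -> gen ts (k *: c).
Proof. by move=> gc; have := genZD k gc gen0; rewrite addr0. Qed.
Lemma genN c : gen ts c -> gen ts (- c).
Proof. by move/(genZ (-1)); rewrite scaleN1r. Qed.
Lemma genD c d : gen ts c -> gen ts d -> gen ts (c + d).
Proof. by move=> gc; rewrite -[c]scale1r; exact: genZD. Qed.
End Gen.

Lemma gen_ind ts (S : C -> Prop) : S 1 -> (forall k c d, S c -> S d -> S (k *: c + d)) ->
  (forall c d, S c -> S d -> S (c * d)) -> (forall t, t \in ts -> S t) ->
  forall c, gen ts c -> S c.
Proof.
move=> S1 SD SM St c gc; apply/asboolP; apply: (gc [pred c | `[< S c >]]).
  split; first exact/asboolP.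
  - by move=> k x y /asboolP Sx /asboolP Sy; apply/asboolP; exact: SD.
  - by move=> x y /asboolP Sx /asboolP Sy; apply/asboolP; exact: SM.
by move=> t /St St'; exact/asboolP.
Qed.

Lemma affine_ind (s : seq H) :
  (forall S : {pred H}, subalg_closed S -> {subset s <= S} -> forall x, x \in S) ->
  forall G : H -> Prop, G 1 -> (forall k x y, G x -> G y -> G (k *: x + y)) ->
  (forall x y, G x -> G y -> G (x * y)) -> (forall x, x \in s -> G x) ->
  forall x, G x.
Proof.
move=> gens G G1 GD GM Gs x; apply/asboolP.
apply: (gens [pred x | `[< G x >]]) => [|y /Gs Gy]; last exact/asboolP.
split; first exact/asboolP.
- by move=> k u v /asboolP Gu /asboolP Gv; apply/asboolP; exact: GD.
- by move=> u v /asboolP Gu /asboolP Gv; apply/asboolP; exact: GM.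
Qed.

(** Longer words reduce to words shorter than [2 ^ n - 1] with coefficients in [C].
    Only the finitely many words of length [2 ^ n - 1] have to be rewritten, so
    the coefficients that occur generate an affine subalgebra of [C]. *)
Theorem affine_finite : affine H ->
  exists (ts : seq C) (B : seq H), forall x, span (gen ts) B x.
Proof.
move=> [s gens]; pose N := (2 ^ n).-2; pose B := words s N.
have n2 : (0 < (2 ^ n).-1)%N by rewrite -subn1 subn_gt0 -{1}(expn0 2) ltn_exp2l // degree_gt0.
have NE : (2 ^ n).-1 = N.+1 by rewrite prednK.
have rew w : exists r : seq (C * H), w \in words s N.+1 ->
    (forall p, p \in r -> p.2 \in B) /\ w = \sum_(p <- r) incl p.1 * p.2.
  case: (boolP (w \in words s N.+1)) => [wN|_]; last by exists [::].
  suff [r rP ->] : span (fun=> True) B w.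
    by exists r => _; split=> // p /rP[].
  have [wN'|[u [szu us] ->]] := words_split wN; first exact: mem_span.
  by apply: long_word_span; rewrite ?NE.
have [r rP] := choice rew.
pose ts := flatten [seq [seq p.1 | p <- r w] | w <- words s N.+1].
exists ts, B.
have sS : subgroup (span (gen ts) B) by apply: span_subgroup => c; exact: genN.
have SZ c x : gen ts c -> span (gen ts) B x -> span (gen ts) B (incl c * x).
  by apply: spanM; exact: genM.
have SN w : w \in words s N.+1 -> span (gen ts) B w.
  move=> wN; have [rB wE] := rP w wN; exists (r w) => // p pr; split; last exact: rB.
  apply: gen_mem; apply/flattenP; exists [seq p.1 | p <- r w]; first exact: map_f.
  exact: map_f.
have Sw l w : w \in words s l -> span (gen ts) B w.
  elim: l w => [|l IH] w.
    by move=> w0; apply: mem_span; [exact: gen1 | exact: words_mono w0].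
  rewrite /= mem_cat => /orP[/IH //|/allpairsP[[x v] /= [xs /IH Sv ->]]].
  move: v Sv; apply: span_ind.
  - split=> [|a b Sa Sb]; first by rewrite mulr0; exact: sS.1.
    by rewrite mulrBr; exact: sS.2.
  - by move=> c v gc Sv; rewrite mulrA -inclC -mulrA; exact: SZ.
  move=> b bB; apply: SN; rewrite -add1n; apply: wordsM => //.
  exact: mem_words1.
pose G x := exists l, span (gen [::]) (words s l) x.
suff allG x : G x.
  move=> x; have [l] := allG x; apply: span_ind => // [c y gc|b bl]; last exact: Sw bl.
  by apply: SZ; move=> S cS tsS; apply: gc.
have gmono l k y : (l <= k)%N -> span (gen [::]) (words s l) y ->
    span (gen [::]) (words s k) y.
  move=> lk [q qP ->]; exists q => // p /qP[? pl]; split=> //.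
  exact: words_mono pl.
have sg l : subgroup (span (gen [::]) (words s l)).
  by apply: span_subgroup => c; exact: genN.
have gZ l c y : gen [::] c -> span (gen [::]) (words s l) y ->
    span (gen [::]) (words s l) (incl c * y).
  by apply: spanM; exact: genM.
move: x; apply: (affine_ind gens).
- by exists 0%N; apply: mem_span; [exact: gen1|rewrite inE].
- move=> k x y [l Gx] [m Gy]; exists (maxn l m).
  apply: (subgroupD (sg _)); last exact: gmono (leq_maxr _ _) Gy.
  rewrite -(inclAZ C).
  apply: gZ; first exact/genZ/gen1.
  exact: gmono (leq_maxl _ _) Gx.
- move=> x y [l Gx] [m Gy]; exists (l + m)%N; move: x Gx; apply: span_ind.
  + split=> [|a b Sa Sb]; first by rewrite mul0r; exact: (sg _).1.
    by rewrite mulrBl; exact: (sg _).2.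
  + by move=> c x gc Gx; rewrite -mulrA; exact: gZ.
  move=> w wl; move: y Gy; apply: span_ind.
  + split=> [|a b Sa Sb]; first by rewrite mulr0; exact: (sg _).1.
    by rewrite mulrBr; exact: (sg _).2.
  + by move=> c x gc Gx; rewrite mulrA -inclC -mulrA; exact: gZ.
  by move=> v vm; apply: mem_span; [exact: gen1|exact: wordsM].
- move=> x xs; exists 1%N; apply: mem_span; first exact: gen1.
  exact: mem_words1.
Qed.

End CHAlgebra.

(** * Chain conditions *)

Definition subspace (K : fieldType) (V : lmodType K) (U : V -> Prop) : Prop :=
  U 0 /\ forall k x y, U x -> U y -> U (k *: x + y).

Section Subspace.
Variables (K : fieldType) (V : lmodType K) (U : V -> Prop).
Hypothesis sU : subspace U.

Lemma subspaceZ k x : U x -> U (k *: x).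
Proof. by move=> Ux; rewrite -[_ *: _]addr0; apply: sU.2 => //; exact: sU.1. Qed.

Lemma subspaceD x y : U x -> U y -> U (x + y).
Proof. by move=> Ux; rewrite -[x]scale1r; exact: sU.2. Qed.

Lemma subspaceN x : U x -> U (- x).
Proof. by move/(subspaceZ (-1)); rewrite scaleN1r. Qed.

Lemma subspaceB x y : U x -> U y -> U (x - y).
Proof. by move=> Ux /subspaceN; exact: subspaceD. Qed.

Lemma subspace_subgroup : subgroup U.
Proof. by split; [exact: sU.1 | exact: subspaceB]. Qed.

End Subspace.

Section Noetherian.
Variables (K : fieldType) (H : algType K) (C : central_subalg H).
Implicit Types (t : C) (ts : seq C) (N : H -> Prop) (L : nat -> H -> Prop).

Definition stable ts N : Prop := forall t, t \in ts -> forall x, N x -> N (incl t * x).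

Definition increasing (T : Type) (L : nat -> T -> Prop) : Prop :=
  forall i x, L i x -> L i.+1 x.

Lemma increasing_le (T : Type) (L : nat -> T -> Prop) i j x :
  increasing L -> (i <= j)%N -> L i x -> L j x.
Proof. by move=> incL /subnK <- Lx; elim: (j - i)%N => // k /incL. Qed.

(** Chains of [ts]-stable subspaces of [N] are stationary; [K[ts]] is not made a
    ring, only its generators act. *)
Definition noetherian ts N : Prop := forall L,
  (forall i, subspace (L i)) -> (forall i, stable ts (L i)) -> increasing L ->
  (forall i x, L i x -> N x) -> exists m, forall i x, L i x -> L m x.

Lemma noetherian0 ts : noetherian ts (fun x => x = 0).
Proof. by move=> L sL _ _ LN; exists 0%N => i x /LN ->; exact: (sL _).1. Qed.

Definition add_line N (b : H) (x : H) : Prop := exists k : K, N (x - k *: b).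

Lemma add_line_subspace N b : subspace N -> subspace (add_line N b).
Proof.
move=> sN; split; first by exists 0; rewrite scale0r subr0; exact: sN.1.
move=> k x y [a Nx] [c Ny]; exists (k * a + c).
rewrite scalerDl -scalerA opprD addrACA -scalerBr.
exact: sN.2.
Qed.

Lemma noetherian_add_line N b :
  subspace N -> noetherian [::] N -> noetherian [::] (add_line N b).
Proof.
move=> sN nN L sL stL incL LN.
have [m0 m0P] : exists m, forall i x, L i x /\ N x -> L m x /\ N x.
  apply: (nN (fun i x => L i x /\ N x)).
  - move=> i; split; first by split; [exact: (sL i).1 | exact: sN.1].
    by move=> k x y [Lx Nx] [Ly Ny]; split; [exact: (sL i).2 | exact: sN.2].
  - by [].
  - by move=> i x [/incL].
  - by move=> i x [].
pose big := exists i x k, [/\ L i x, k != 0 & N (x - k *: b)].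
have [[m1 [y [k [Ly k0 Ny]]]]|nobig] := pselect big.
  exists (maxn m0 m1) => i x Lx; have [a Nx] := LN i x Lx.
  have Lmy j : (m1 <= j)%N -> L j y by move=> mj; exact: increasing_le Ly.
  rewrite -[x](subrK ((a / k) *: y)); apply: (subspaceD (sL _)); last first.
    by apply: (subspaceZ (sL _)); apply: Lmy; exact: leq_maxr.
  apply: (increasing_le incL (leq_maxl m0 m1)).
  apply: (m0P (maxn i m1) _ _).1; split.
    apply: (subspaceB (sL _)); first exact: increasing_le (leq_maxl _ _) Lx.
    by apply: (subspaceZ (sL _)); apply: Lmy; exact: leq_maxr.
  have -> : x - (a / k) *: y = (x - a *: b) - (a / k) *: (y - k *: b).
    by rewrite scalerBr scalerA divfK // opprB addrA subrK.
  by apply: (subspaceB sN) => //; exact: (subspaceZ sN).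
exists m0 => i x Lx; apply: (m0P i x _).1; split=> //.
have [a Nx] := LN i x Lx; have [a0|a0] := eqVneq a 0.
  by move: Nx; rewrite a0 scale0r subr0.
by case: nobig; exists i, x, a.
Qed.

Definition poly_ext N t (x : H) : Prop :=
  exists2 p : {poly H}, forall i, N p`_i & x = p.[incl t].

Lemma poly_ext_subspace N t : subspace N -> subspace (poly_ext N t).
Proof.
move=> sN; split; first by exists 0; rewrite ?horner0 // => i; rewrite coef0; exact: sN.1.
move=> k _ _ [p Np ->] [q Nq ->]; exists (k%:A *: p + q) => [i|].
  by rewrite coefD coefZ mulr_algl; exact: sN.2.
by rewrite hornerD hornerZ mulr_algl.
Qed.

Lemma poly_ext_mem N t x : subspace N -> N x -> poly_ext N t x.
Proof.
move=> sN Nx; exists x%:P; last by rewrite hornerC.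
by move=> i; rewrite coefC; case: eqP => // _; exact: sN.1.
Qed.

Lemma poly_ext_stable N t ts : subspace N -> stable ts N -> stable (t :: ts) (poly_ext N t).
Proof.
move=> sN stN u; rewrite inE => /orP[/eqP ->|uts] _ [p Np ->].
  exists (p * 'X) => [i|]; last by rewrite hornerMX inclC.
  by rewrite coefMX; case: eqP => // _; exact: sN.1.
exists (incl u *: p) => [i|]; last by rewrite hornerZ.
by rewrite coefZ; exact: stN.
Qed.

(** The value at which the diagonal becomes stationary bounds all columns of
    larger index; the finitely many other columns are stationary one by one. *)
Lemma diagonal_stationary (T : Type) (A : nat -> nat -> T -> Prop) :
  (forall i j x, A i j x -> A i.+1 j x) -> (forall i j x, A i j x -> A i j.+1 x) ->
  (forall L : nat -> T -> Prop, (exists f : nat -> nat * nat,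
     forall i, L i = A (f i).1 (f i).2) -> increasing L ->
     exists m, forall i x, L i x -> L m x) ->
  exists m, forall i j x, A i j x -> A m j x.
Proof.
move=> A1 A2 acc.
have [d dP] : exists m, forall i x, A i i x -> A m m x.
  by apply: acc; [exists (fun i => (i, i))|move=> i x /A1/A2].
have col j : exists m, forall i x, A i j x -> A m j x.
  by apply: (acc (fun i => A i j)); [exists (fun i => (i, j))|move=> i x /A1].
have [c cP] := choice col.
have A1le i i' j x : (i <= i')%N -> A i j x -> A i' j x.
  by move=> ii'; apply: (increasing_le (L := fun i => A i j)) => // k y; exact: A1.
have A2le i j j' x : (j <= j')%N -> A i j x -> A i j' x.
  by move=> jj'; apply: (increasing_le (L := A i)) => // k y; exact: A2.
exists (maxn d (\max_(j < d) c j)) => i j x Ax.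
have [jd|dj] := ltnP j d.
  apply: (A1le (c j)); last exact: cP Ax.
  by apply: leq_trans (leq_maxr _ _); exact: (leq_bigmax (Ordinal jd)).
apply: (A1le d); first exact: leq_maxl.
apply: (A2le _ d) => //; apply: (dP (maxn i j)).
apply: (A2le _ j); first exact: leq_maxr.
by apply: (A1le i); first exact: leq_maxl.
Qed.

(** Hilbert's basis theorem: a chain of submodules of [N[t]] is stationary as
    soon as the subspaces of leading coefficients in each degree are. *)
Lemma noetherian_poly_ext N t ts : subspace N -> stable ts N ->
  noetherian ts N -> noetherian (t :: ts) (poly_ext N t).
Proof.
move=> sN stN nN L sL stL incL LN.
have sLt i : stable ts (L i) by move=> u uts; apply: stL; rewrite inE uts orbT.
have Lt i x : L i x -> L i (incl t * x) by apply: stL; rewrite mem_head.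
pose A i j (a : H) := exists p : {poly H},
  [/\ forall k, N p`_k, (size p <= j.+1)%N, p`_j = a & L i p.[incl t]].
have [m mP] : exists m, forall i j a, A i j a -> A m j a.
  apply: diagonal_stationary.
  - by move=> i j a [p [Np szp pj /incL]]; exists p.
  - move=> i j a [p [Np szp pj Lp]]; exists (p * 'X); split.
    + by move=> k; rewrite coefMX; case: eqP => // _; exact: sN.1.
    + by rewrite (leq_trans (size_polyMleq _ _)) // size_polyX addn2.
    + by rewrite coefMX.
    + by rewrite hornerMX -inclC; exact: Lt.
  move=> _ [f /funext ->] inc; apply: nN => //.
  - move=> i; split.
      exists 0; split=> [k|||]; rewrite ?size_poly0 ?coef0 ?horner0 //.
        exact: sN.1.
      exact: (sL _).1.
    move=> k _ _ [p [Np szp <- Lp]] [q [Nq szq <- Lq]]; exists (k%:A *: p + q); split.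
    + by move=> l; rewrite coefD coefZ mulr_algl; exact: sN.2.
    + rewrite (leq_trans (size_polyD _ _)) // geq_max szq andbT.
      exact: leq_trans (size_scale_leq _ _) szp.
    + by rewrite coefD coefZ mulr_algl.
    + by rewrite hornerD hornerZ mulr_algl; exact: (sL _).2.
  - move=> i u uts _ [p [Np szp <- Lp]]; exists (incl u *: p); split.
    + by move=> l; rewrite coefZ; exact: stN.
    + exact: leq_trans (size_scale_leq _ _) szp.
    + by rewrite coefZ.
    + by rewrite hornerZ; exact: sLt.
  - by move=> i _ [p [Np _ <- _]].
exists m => i x Lx.
have main d i' (p : {poly H}) : (size p <= d)%N -> (forall k, N p`_k) ->
    L i' p.[incl t] -> L m p.[incl t].
  elim: d i' p => [|d IH] i' p szp Np Lp.
    by move: szp; rewrite leqn0 size_poly_eq0 => /eqP ->; rewrite horner0; exact: (sL m).1.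
  have [q [Nq szq qd Lq]] : A m d p`_d by apply: (mP i'); exists p.
  rewrite -[p](subrK q) hornerD; apply: (subspaceD (sL m)) => //.
  apply: (IH (maxn i' m)).
  - apply/leq_sizeP => j; rewrite leq_eqVlt coefB => /orP[/eqP <-|dj].
      by rewrite qd subrr.
    by rewrite !nth_default ?subrr // ?(leq_trans szp) ?(leq_trans szq).
  - by move=> k; rewrite coefB; exact: (subspaceB sN).
  rewrite hornerD hornerN; apply: (subspaceB (sL _)).
    exact: increasing_le (leq_maxl _ _) Lp.
  exact: increasing_le (leq_maxr _ _) Lq.
have [p Np xE] := LN i x Lx; rewrite xE; apply: (main (size p) i) => //.
by rewrite -xE.
Qed.

Definition lines (B : seq H) : H -> Prop :=
  foldr (fun b N => add_line N b) (fun x => x = 0) B.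

Definition poly_exts (B : seq H) ts : H -> Prop :=
  foldr (fun t N => poly_ext N t) (lines B) ts.

Lemma lines_subspace B : subspace (lines B).
Proof.
elim: B => [|b B IH] /=; last exact: add_line_subspace.
by split=> // k x y -> ->; rewrite scaler0 addr0.
Qed.

Lemma mem_lines B b : b \in B -> lines B b.
Proof.
elim: B => // b' B IH; rewrite inE => /orP[/eqP ->|/IH Bb] /=.
  by exists 1; rewrite scale1r subrr; exact: (lines_subspace B).1.
by exists 0; rewrite scale0r subr0.
Qed.

Lemma poly_exts_subspace B ts : subspace (poly_exts B ts).
Proof.
by elim: ts => [|t ts IH] /=; [exact: lines_subspace | exact: poly_ext_subspace].
Qed.

Lemma poly_exts_stable B ts : stable ts (poly_exts B ts).
Proof.
elim: ts => // t ts IH; apply: poly_ext_stable => //; exact: poly_exts_subspace.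
Qed.

Lemma noetherian_poly_exts B ts : noetherian ts (poly_exts B ts).
Proof.
elim: ts => [|t ts IH] /=.
  elim: B => [|b B IH] /=; first exact: noetherian0.
  by apply: noetherian_add_line => //; exact: lines_subspace.
apply: noetherian_poly_ext => //; [exact: poly_exts_subspace | exact: poly_exts_stable].
Qed.

Lemma mem_poly_exts B ts b : b \in B -> poly_exts B ts b.
Proof.
move/mem_lines=> Bb; elim: ts => //= t ts IH.
by apply: poly_ext_mem => //; exact: poly_exts_subspace.
Qed.

Lemma stable_gen ts N : subspace N -> stable ts N ->
  forall c, gen ts c -> forall x, N x -> N (incl c * x).
Proof.
move=> sN stN; apply: gen_ind => [x|k c d Nc Nd x Nx|c d Nc Nd x Nx|t tts x].
- by rewrite rmorph1 mul1r.
- rewrite linearP mulrDl -scalerAl; apply: sN.2; [exact: Nc | exact: Nd].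
- by rewrite rmorphM -mulrA; apply: Nc; exact: Nd.
- exact: stN.
Qed.

End Noetherian.

Definition is_ideal (R : comNzRingType) (I : R -> Prop) : Prop :=
  [/\ I 0, forall x y, I x -> I y -> I (x + y) & forall c x, I x -> I (c * x)].

Section IsIdeal.
Variables (R : comNzRingType) (I : R -> Prop).
Hypothesis iI : is_ideal I.

Lemma ideal_sum (J : Type) (r : seq J) (P : pred J) (F : J -> R) :
  (forall i, P i -> I (F i)) -> I (\sum_(i <- r | P i) F i).
Proof. by case: iI => I0 ID _ IF; apply: (big_ind I). Qed.

Lemma idealN x : I x -> I (- x).
Proof. by case: iI => _ _ IM Ix; rewrite -mulN1r; exact: IM. Qed.

Lemma idealB x y : I x -> I y -> I (x - y).
Proof. by case: iI => _ ID _ Ix /idealN; exact: ID. Qed.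
End IsIdeal.

Definition ideal_span (R : comNzRingType) (X : seq R) (x : R) : Prop :=
  exists2 r : seq (R * R), (forall p, p \in r -> p.2 \in X) & x = \sum_(p <- r) p.1 * p.2.

Lemma ideal_span_ideal (R : comNzRingType) (X : seq R) : is_ideal (ideal_span X).
Proof.
split; first by exists [::]; rewrite ?big_nil.
- move=> _ _ [r rP ->] [s sP ->]; exists (r ++ s); last by rewrite big_cat.
  by move=> p; rewrite mem_cat => /orP[/rP|/sP].
- move=> c _ [r rP ->]; exists [seq (c * p.1, p.2) | p <- r].
    by move=> p /mapP[q /rP ? ->].
  by rewrite big_map mulr_sumr; apply: eq_bigr => p _; rewrite mulrA.
Qed.

Lemma mem_ideal_span (R : comNzRingType) (X : seq R) x : x \in X -> ideal_span X x.
Proof.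
by exists [:: (1, x)]; rewrite ?big_seq1 ?mul1r // => p; rewrite inE => /eqP ->.
Qed.

Definition ideal_acc (R : comNzRingType) : Prop := forall L : nat -> R -> Prop,
  (forall i, is_ideal (L i)) -> increasing L -> exists m, forall i x, L i x -> L m x.

Section ACC.
Variable R : comNzRingType.
Hypothesis acc : ideal_acc R.

Lemma maximal_ideal_in (F : (R -> Prop) -> Prop) :
  (forall I, F I -> is_ideal I) -> (exists I, F I) ->
  exists2 I, F I & forall I', F I' -> (forall x, I x -> I' x) -> forall x, I' x -> I x.
Proof.
move=> Fid [I0 FI0]; apply: contrapT => nomax.
have next (I : {I | F I}) : exists I' : {I | F I},
    (forall x, sval I x -> sval I' x) /\ exists2 x, sval I' x & ~ sval I x.
  case: I => I FI /=; apply: contrapT => no; apply: nomax; exists I => // I' FI' II' x I'x.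
  by apply: contrapT => nIx; apply: no; exists (exist _ I' FI'); split=> //; exists x.
have [f fP] := choice next.
pose L i := sval (iter i f (exist _ I0 FI0)).
have [|i x|m mP] := acc (L := L); first by move=> i; apply: Fid; exact: svalP.
  exact: (fP (iter i f (exist _ I0 FI0))).1.
have [_ [x]] := fP (iter m f (exist _ I0 FI0)).
by rewrite -iterS => /(mP m.+1).
Qed.

Lemma ideal_fg I : is_ideal I -> exists2 X : seq R,
  (forall x, x \in X -> I x) & forall x, I x -> ideal_span X x.
Proof.
move=> iI; have [I0 ID IM] := iI.
pose F J := exists2 X : seq R, (forall x, x \in X -> I x) & J = ideal_span X.
have [J [X XI JE] Jmax] : exists2 J, F J & forall J', F J' ->
    (forall x, J x -> J' x) -> forall x, J' x -> J x.
  apply: maximal_ideal_in; first by move=> _ [X _ ->]; exact: ideal_span_ideal.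
  by exists (ideal_span [::]), [::].
exists X => // x Ix; rewrite -JE; apply: (Jmax (ideal_span (x :: X))).
- by exists (x :: X) => // y; rewrite inE => /orP[/eqP ->|/XI].
- move=> y; rewrite JE => -[r rP ->]; exists r => // p /rP.
  by rewrite inE orbC => ->.
- by apply: mem_ideal_span; rewrite mem_head.
Qed.

End ACC.

Section FiniteOverSubalgebra.
Variables (K : fieldType) (H : algType K) (C : central_subalg H).
Variables (ts : seq C) (B : seq H).
Hypothesis finite : forall x, span (gen ts) B x.

Lemma poly_exts_full x : poly_exts B ts x.
Proof.
have sP := poly_exts_subspace B ts.
move: x (finite x) => x; apply: span_ind; first exact: subspace_subgroup.
  by move=> c y gc; apply: stable_gen gc _; [exact: sP | exact: poly_exts_stable].
by move=> b; exact: mem_poly_exts.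
Qed.

Lemma noetherianH : noetherian ts (fun _ : H => True).
Proof.
move=> L sL stL incL _; apply: (noetherian_poly_exts (B := B)) => // i x _.
exact: poly_exts_full.
Qed.

Lemma central_acc : ideal_acc C.
Proof.
move=> L iL incL.
have [|i t tts _ [c Lc <-]|i _ [c /incL Lc <-]|//|m mP] :=
  noetherianH (L := fun i x => exists2 c, L i c & incl c = x).
- move=> i; have [L0 LD LM] := iL i.
  split; first by exists 0; rewrite ?rmorph0.
  move=> k _ _ [c Lc <-] [d Ld <-]; exists (k%:A * c + d); first exact/LD/Ld/LM.
  by rewrite rmorphD rmorphM inclAZ.
- by exists (t * c); rewrite ?rmorphM //; have [_ _] := iL i; apply.
- by exists c.
exists m => i c Lc; have [|d Ld /incl_inj <- //] := mP i (incl c).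
by exists c.
Qed.

(** The spans of [1, c, ..., c ^ (i - 1)] over [K[ts]] form a stationary chain in
    [H]; where it stops, [c ^ m] is a combination of lower powers. *)
Lemma central_integral c : exists p : {poly C},
  [/\ p \is monic, root p c & forall i, gen ts p`_i].
Proof.
pose L i x := exists2 p : {poly C}, (size p <= i)%N /\ (forall j, gen ts p`_j)
  & incl p.[c] = x.
have [|i t tts _ [p [szp gp] <-]|i _ [p [szp gp] <-]|//|m mP] := noetherianH (L := L).
- move=> i; split.
    exists 0; last by rewrite horner0 rmorph0.
    by rewrite size_poly0; split=> // j; rewrite coef0; exact: gen0.
  move=> k _ _ [p [szp gp] <-] [q [szq gq] <-]; exists (k%:A *: p + q).
    split=> [|j]; last by rewrite coefD coefZ mulr_algl; exact: genZD.
    rewrite (leq_trans (size_polyD _ _)) // geq_max szq andbT.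
    exact: leq_trans (size_scale_leq _ _) szp.
  by rewrite hornerD hornerZ mulr_algl linearP.
- exists (t *: p); last by rewrite hornerZ rmorphM.
  split=> [|j]; first exact: leq_trans (size_scale_leq _ _) szp.
  by rewrite coefZ; apply: genM => //; exact: gen_mem.
- by exists p => //; split=> //; exact: leqW.
have [|p [szp gp] /incl_inj pc] := mP m.+1 (incl (c ^+ m)).
  exists 'X^m; last by rewrite hornerXn.
  split=> [|j]; first by rewrite size_polyXn.
  by rewrite coefXn; case: eqP => _; [exact: gen1 | exact: gen0].
exists ('X^m - p); split.
- rewrite monicE lead_coefDl ?lead_coefXn // size_polyN size_polyXn ltnS //.
- by rewrite /root hornerD hornerN hornerXn pc subrr.
- move=> i; rewrite coefB coefXn; apply: genD; last exact: genN.
  by case: eqP => _; [exact: gen1 | exact: gen0].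
Qed.

End FiniteOverSubalgebra.

(** * Zariski's lemma and points of [C] *)

Section SubfieldType.
Variables (L : fieldType) (S : {pred L}) (cS : divring_closed S).

HB.instance Definition _ := GRing.isDivringClosed.Build L S cS.

Definition subfield : Type := {x : L | x \in S}.
HB.instance Definition _ := SubChoice.on subfield.
HB.instance Definition _ := [SubChoice_isSubIntegralDomain of subfield by <:].
HB.instance Definition _ := [SubIntegralDomain_isSubField of subfield by <:].

Lemma subfield_field : exists (F : fieldType) (i : {rmorphism F -> L}),
  forall x, (x \in S) <-> exists y, x = i y.
Proof.
exists subfield, (val : {rmorphism subfield -> L}) => x; split; last by move=> [y ->]; exact: valP.
by move=> xS; exists (exist _ x xS).
Qed.

End SubfieldType.

Section Zariski.

(** [L] is integral over the ring generated by [i F] and [ts]: phrased as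
    integrality over every ring over which [i F] and [ts] are integral, so that
    no type for the generated ring is required. *)
Definition integral_over_gens (F L : fieldType) (i : F -> L) (ts : seq L) : Prop :=
  forall (R : comNzRingType) (rho : {rmorphism R -> L}),
    (forall a, integralOver rho (i a)) -> (forall t, t \in ts -> integralOver rho t) ->
    integralRange rho.

Section Step.
Variables (F L : fieldType) (i : {rmorphism F -> L}) (t : L).

Definition ev : {poly F} -> L := horner_morph (fun a => mulrC t (i a)).
HB.instance Definition _ := GRing.RMorphism.on ev.

Lemma evX : ev 'X = t. Proof. exact: horner_morphX. Qed.
Lemma evC a : ev a%:P = i a. Proof. exact: horner_morphC. Qed.

Definition frac_pred : {pred L} :=
  [pred x | `[< exists p q, ev q != 0 /\ x = ev p / ev q >]].

Lemma frac_predP x :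
  reflect (exists p q, ev q != 0 /\ x = ev p / ev q) (x \in frac_pred).
Proof. exact: asboolP. Qed.

Lemma frac_pred_closed : divring_closed frac_pred.
Proof.
split.
- by apply/frac_predP; exists 1, 1; rewrite rmorph1 oner_eq0 divr1.
- move=> _ _ /frac_predP[p [q [q0 ->]]] /frac_predP[p' [q' [q0' ->]]].
  apply/frac_predP; exists (p * q' - p' * q), (q * q').
  rewrite rmorphM mulf_neq0 //; split=> //.
  by rewrite -mulNr addf_div // rmorphB !rmorphM mulNr.
- move=> _ _ /frac_predP[p [q [q0 ->]]] /frac_predP[p' [q' [q0' ->]]].
  apply/frac_predP; have [p0|p0] := eqVneq (ev p') 0.
    by exists 0, 1; rewrite rmorph1 oner_eq0 p0 mul0r invr0 mulr0 rmorph0 mul0r.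
  exists (p * q'), (q * p'); rewrite rmorphM mulf_neq0 //; split=> //.
  by rewrite rmorphM invf_div mulf_div.
Qed.

Section Localization.
Variables (f : {poly F}) (f0 : ev f != 0).

(** The two variables take the values [t] and [1/f], so that [F[t][1/f]] appears
    only as the image of a polynomial ring. *)
Definition loc : {poly {poly F}} -> L := horner_morph (fun a => mulrC (ev f)^-1 (ev a)).
HB.instance Definition _ := GRing.RMorphism.on loc.

Lemma locX : loc 'X = (ev f)^-1. Proof. exact: horner_morphX. Qed.
Lemma locC a : loc a%:P = ev a. Proof. exact: horner_morphC. Qed.

Lemma loc_integral p : integralOver loc (ev p / ev f).
Proof.
have -> : ev p / ev f = loc (p%:P * 'X).
  by rewrite rmorphM /= locC locX.
exact: integral_id.
Qed.

Lemma loc_denominator P : exists p e, loc P * ev f ^+ e = ev p.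
Proof.
elim/poly_ind: P => [|P c [p [e PE]]]; first by exists 0, 0%N; rewrite !rmorph0 mul0r.
exists (p + c * f ^+ e.+1), e.+1.
rewrite !(rmorphD, rmorphM, rmorphXn) /= locX locC -PE mulrDl exprS.
by rewrite !mulrA mulfVK.
Qed.

(** If all of [L] were integral over [F[t][1/f]], so would be [1/(1 + t f)]; a
    monic equation for it makes [1 + X f], which is prime to [f], divide a power
    of [f]. *)
Lemma not_integral_loc : injective ev -> ~ integralRange loc.
Proof.
move=> evI int.
have fN0 : f != 0 by apply: contraNneq f0 => ->; rewrite rmorph0.
pose g := 1 + 'X * f.
have szg : (1 < size g)%N.
  by rewrite /g addrC size_polyDl mulrC size_mulX // ?size_poly1 ltnS size_poly_gt0.
have g0 : ev g != 0.
  rewrite -[0](rmorph0 ev) (inj_eq evI); apply: contraTneq szg => ->.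
  by rewrite size_poly0.
have [P Pm Px] := int (ev g)^-1.
have [N szP] : exists N, size P = N.+1.
  by exists (size P).-1; rewrite prednK // size_poly_gt0 monic_neq0.
have {Px} PE : - 1 = ev g * \sum_(j < N) loc P`_j * ev (g ^+ (N - j.+1)).
  move: Px; rewrite /root horner_coef size_map_poly_id0; last first.
    by rewrite (monicP Pm) rmorph1 oner_eq0.
  rewrite szP big_ord_recr /= addr_eq0 => /eqP.
  move/(congr1 (fun z => z * ev g ^+ N)).
  have -> : (map_poly loc P)`_N = 1.
    by rewrite coef_map /=; have := monicP Pm; rewrite /lead_coef szP /= => ->; rewrite rmorph1.
  rewrite mul1r mulNr -exprMn mulVf // expr1n => <-.
  rewrite mulr_suml mulr_sumr; apply: eq_bigr => j _.
  rewrite coef_map /= -mulrA [RHS]mulrCA; congr (_ * _).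
  rewrite rmorphXn /= -exprS -subSn // subSS exprVn.
  have -> : ev g ^+ N = ev g ^+ j * ev g ^+ (N - j) by rewrite -exprD subnKC // ltnW.
  by rewrite mulKf // expf_neq0.
have [A [e AE]] : exists A e,
    (\sum_(j < N) loc P`_j * ev (g ^+ (N - j.+1))) * ev f ^+ e = ev A.
  elim: (index_enum _) => [|j r [A [e AE]]].
    by exists 0, 0%N; rewrite big_nil mul0r rmorph0.
  have [B [e' BE]] := loc_denominator P`_j.
  exists (B * g ^+ (N - j.+1) * f ^+ e + A * f ^+ e'), (e' + e)%N.
  rewrite big_cons mulrDl exprD !(rmorphD, rmorphM, rmorphXn) /= -AE -BE !mulrA.
  by congr (_ * _ + _); rewrite mulrAC.
have dvd : g %| f ^+ e.
  apply/dvdpP; exists (- A); apply: evI; rewrite rmorphM rmorphN /= -AE rmorphXn /=.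
  by rewrite -[LHS]mul1r -[1]opprK PE !mulNr -mulrA mulrC.
have cop : coprimep g (f ^+ e).
  apply: coprimep_expr; rewrite coprimep_sym.
  by apply/Bezout_coprimepP; exists (- 'X, 1); rewrite /g /= mul1r mulNr addrC addrK eqpxx.
have : size g == 1%N by have := coprimepp g; rewrite (coprimep_dvdl dvd cop) => <-.
by move/eqP=> sz1; rewrite sz1 in szg.
Qed.

End Localization.

Lemma common_denominator (ys : seq L) : (forall y, y \in ys -> y \in frac_pred) ->
  exists2 f, ev f != 0 & forall y, y \in ys -> exists p, y = ev p / ev f.
Proof.
elim: ys => [|y ys IH] ysP; first by exists 1; rewrite ?rmorph1 ?oner_eq0.
have [|f f0 fP] := IH; first by move=> z zys; apply: ysP; rewrite inE zys orbT.
have /frac_predP[p [q [q0 yE]]] := ysP y (mem_head _ _).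
exists (q * f); first by rewrite rmorphM mulf_neq0.
move=> z; rewrite inE => /orP[/eqP ->|/fP[r ->]].
  by exists (p * f); rewrite yE !rmorphM -mulf_div divff // mulr1.
by exists (q * r); rewrite !rmorphM -mulf_div divff // mul1r.
Qed.

End Step.

(** Zariski's lemma, by induction on the number of generators: all of [L] is
    algebraic over [F(t)]; if [t] were transcendental, [L] would be integral over
    [F[t][1/f]], where [f] is a common denominator of the equations of the other
    generators. *)
Theorem zariski (F L : fieldType) (i : {rmorphism F -> L}) (ts : seq L) :
  integral_over_gens i ts -> integralRange i.
Proof.
elim: ts F i => [|t ts IH] F i int.
  by apply: int => // a; exact: integral_id.
have [F' [i' i'P]] := subfield_field (frac_pred_closed i t).
have i'i a : i a \in frac_pred i t.
  apply/frac_predP; exists a%:P, 1.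
  by rewrite rmorph1 oner_eq0 divr1 evC.
have i't : t \in frac_pred i t.
  apply/frac_predP; exists 'X, 1.
  by rewrite rmorph1 oner_eq0 divr1 evX.
have int' : integralRange i'.
  apply: (IH F' i') => R rho inti' intts; apply: int => [a|u].
    by have [b ->] := (i'P _).1 (i'i a).
  by rewrite inE => /orP[/eqP ->|/intts //]; have [b ->] := (i'P _).1 i't.
have [intt|nint] := pselect (integralOver i t).
  have inti' y : integralOver i (i' y).
    have := (i'P (i' y)).2 (ex_intro _ y erefl).
    move=> /frac_predP[p [q [_ ->]]].
    have intev r : integralOver i (ev i t r).
      rewrite /ev /horner_morph; apply: integral_horner => //.
      by apply/integral_poly => j; rewrite coef_map; exact: integral_id.
    exact: integral_div.
  move=> x; have [p pm px] := int' x.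
  apply: (integral_root_monic (p := map_poly i' p)) => //; first by rewrite monic_map.
  by apply/integral_poly => j; rewrite coef_map; exact: inti'.
exfalso.
have evI : injective (ev i t).
  apply: raddf_inj => p pt; apply: contrapT => /eqP p0; apply: nint.
  by apply/integral_algebraic; exists p => //; apply/eqP.
have eqn u : exists p : {poly F'}, p \is monic /\ root (map_poly i' p) u.
  by have [p pm pu] := int' u; exists p.
have [P PP] := choice eqn.
have [f f0 fP] : exists2 f, ev i t f != 0 &
    forall y, y \in flatten [seq polyseq (map_poly i' (P u)) | u <- ts] ->
      exists p, y = ev i t p / ev i t f.
  apply: common_denominator => y /flattenP[s /mapP[u _ ->]] /(nthP 0)[j _ <-].
  by apply/i'P; exists (P u)`_j; rewrite coef_map.
apply: (not_integral_loc f0 evI); apply: int.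
  move=> a; have -> : i a = ev i t (a%:P * f) / ev i t f.
    by rewrite rmorphM mulfK //= evC.
  exact: (loc_integral i t f).
move=> u; rewrite inE => /orP[/eqP ->|uts].
  have tE : t = ev i t ('X * f) / ev i t f by rewrite rmorphM mulfK //= evX.
  rewrite [X in integralOver _ X]tE.
  exact: (loc_integral i t f).
have [Pm Pu] := PP u.
apply: (integral_root_monic (p := map_poly i' (P u))) => //; first by rewrite monic_map.
move=> y yP; have [|p ->] := fP y; last exact: (loc_integral i t f).
by apply/flattenP; exists (polyseq (map_poly i' (P u))) => //; apply/mapP; exists u.
Qed.

End Zariski.

(** * Points *)

Section FractionField.

Lemma fraction_split (B : idomainType) (z : {fraction B}) :
  exists x y, y != 0 /\ z = tofrac x / tofrac y.
Proof.
elim/quotW: z => x; exists \n_x, \d_x; split; first exact: denom_ratioP.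
apply: (canRL (mulfK _)); first by rewrite tofrac_eq0 denom_ratioP.
unlock tofrac; rewrite -[LHS]FracField.pi_mul /FracField.mulf.
apply/eqmodP; rewrite /= /FracField.equivf /= !numden_Ratio ?oner_eq0 ?mulr1 ?denom_ratioP //.
by rewrite mulrC.
Qed.

End FractionField.


Section PrimeIdeal.
Variables (R : comNzRingType) (p : R -> Prop).
Hypotheses (ip : is_ideal p) (p1 : ~ p 1).
Hypothesis prime : forall x y, p (x * y) -> p x \/ p y.

Let S : {pred R} := [pred x | `[< p x >]].
Let S_idealr : idealr_closed S.
Proof.
have [p0 pD pM] := ip; split; [exact/asboolP | exact/asboolP |].
by move=> a u v /asboolP pu /asboolP pv; apply/asboolP/pD/pv/pM.
Qed.
Let S_prime : prime_idealr_closed S.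
Proof. by move=> u v /asboolP/prime[] ?; apply/orP; [left|right]; exact/asboolP. Qed.

HB.instance Definition _ := isIdealr.Build R S S_idealr.
HB.instance Definition _ := isPrimeIdealrClosed.Build R S S_prime.

Definition residue := {ideal_quot S}.
HB.instance Definition _ := GRing.ComNzRing.on residue.

Let unit : {pred residue} := [pred x | `[< exists y, y * x = 1 >]].
Let inv (x : residue) : residue :=
  if pselect (exists y, y * x = 1) is left h then sval (cid h) else x.

Let mulVx : {in unit, left_inverse 1 inv *%R}.
Proof. by move=> x /asboolP ux; rewrite /inv; case: pselect => // h; exact: svalP (cid h). Qed.
Let unitPl (x y : residue) : y * x = 1 -> unit x.
Proof. by move=> yx; apply/asboolP; exists y. Qed.
Let inv_out : {in [predC unit], inv =1 id}.
Proof. by move=> x /asboolPn nx; rewrite /inv; case: pselect. Qed.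

HB.instance Definition _ :=
  GRing.ComNzRing_hasMulInverse.Build residue mulVx unitPl inv_out.

Let residue_idomain : GRing.integral_domain_axiom residue.
Proof. exact: (Quotient.rquot_IdomainAxiom (I := S)). Qed.
HB.instance Definition _ := GRing.ComUnitRing_isIntegral.Build residue residue_idomain.

Lemma prime_ideal_field : exists (L : fieldType) (rho : {rmorphism R -> L}),
  (forall x, rho x = 0 <-> p x) /\
  forall z : L, exists x y, ~ p y /\ z = rho x / rho y.
Proof.
pose q : {rmorphism R -> residue} := \pi_{ideal_quot S}.
pose rho : {rmorphism R -> {fraction residue}} := @tofrac residue \o q.
have rho0 x : rho x = 0 <-> p x.
  split=> [/eqP|px].
    rewrite /rho /= tofrac_eq0 -(rmorph0 q) => /eqP/eqmodP /=.
    by rewrite Quotient.equivE subr0 => /asboolP.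
  apply/eqP; rewrite /rho /= tofrac_eq0 -(rmorph0 q); apply/eqP/eqmodP => /=.
  by rewrite Quotient.equivE subr0; apply/asboolP.
exists {fraction residue}, rho; split=> // z.
have [x [y [y0 ->]]] := fraction_split z.
exists (repr x), (repr y); rewrite /rho /= !reprK; split=> //.
by move/rho0; rewrite /rho /= reprK => /eqP; rewrite tofrac_eq0 (negPf y0).
Qed.

End PrimeIdeal.

Section Points.
Variables (K : closedFieldType) (H : algType K) (C : central_subalg H).
Variables (ts : seq C) (B : seq H).
Hypothesis finite : forall x, span (gen ts) B x.

Definition point := {lrmorphism C -> K^o}.

(** An ideal maximal among those that avoid the powers of [d] is prime, and the
    fraction field of its quotient is generated by [C] and [1/d], so Zariski's
    lemma applies to it.  With [d = 1] this is the weak Nullstellensatz, with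
    [I = 0] it says that [C] is a Jacobson ring. *)
Theorem point_avoiding (I : C -> Prop) (d : C) :
  is_ideal I -> (forall s, ~ I (d ^+ s)) ->
  exists chi : point, (forall c, I c -> chi c = 0) /\ chi d != 0.
Proof.
move=> iI Id.
pose F J := [/\ is_ideal J, forall c, I c -> J c & forall s, ~ J (d ^+ s)].
have [p [ip Ip dp] pmax] : exists2 p, F p & forall J, F J ->
    (forall c, p c -> J c) -> forall c, J c -> p c.
  apply: maximal_ideal_in; first exact: (central_acc finite).
    by move=> J [].
  by exists I.
have [p0 pD pM] := ip.
have padd x : ~ p x -> exists s q c, p q /\ d ^+ s = q + c * x.
  move=> px; apply: contrapT => no; apply: px.
  apply: (pmax (fun y => exists q c, p q /\ y = q + c * x)).
  - split.
    + split; first by exists 0, 0; rewrite mul0r addr0.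
        move=> _ _ [q [c [pq ->]]] [q' [c' [pq' ->]]]; exists (q + q'), (c + c').
        by rewrite mulrDl addrACA; split=> //; exact: pD.
      move=> e _ [q [c [pq ->]]]; exists (e * q), (e * c).
      by rewrite mulrDr mulrA; split=> //; exact: pM.
    + by move=> c /Ip pc; exists c, 0; rewrite mul0r addr0.
    + by move=> s [q [c qc]]; apply: no; exists s, q, c.
  - by move=> c pc; exists c, 0; rewrite mul0r addr0.
  - by exists 0, 1; rewrite mul1r add0r.
have prime x y : p (x * y) -> p x \/ p y.
  move=> pxy; have [|npx] := pselect (p x); first by left.
  right; apply: contrapT => npy.
  have [s [q [c [pq sE]]]] := padd x npx; have [s' [q' [c' [pq' sE']]]] := padd y npy.
  apply: (dp (s + s')%N); rewrite exprD sE sE' mulrDl; apply: (pD _ _).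
    by rewrite mulrC; exact: pM.
  rewrite mulrDr; apply: (pD _ _); first exact: pM.
  by rewrite mulrACA; exact: pM.
have [L [rho [rho0 rhof]]] := prime_ideal_field ip (dp 0%N) prime.
pose i : {rmorphism K -> L} := rho \o in_alg C.
have rd0 : rho d != 0 by apply/eqP => /rho0; rewrite -[d]expr1; exact: dp.
have int : integralRange i.
  apply: (@zariski K L i ((rho d)^-1 :: map rho ts)) => R sigma inti intg z.
  have intC c : integralOver sigma (rho c).
    have [P [Pm Pc Pg]] := central_integral finite c.
    apply: (integral_root_monic (p := map_poly rho P)).
    - by rewrite monic_map.
    - by rewrite /root horner_map (rootP Pc) rmorph0.
    apply/integral_poly => j; rewrite coef_map; move: (P`_j) (Pg j) => c'.
    apply: (gen_ind (S := fun c => integralOver sigma (rho c))).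
    - by rewrite rmorph1; exact: integral1.
    - move=> k a b inta intb; rewrite rmorphD -mulr_algl rmorphM.
      by apply: integral_add => //; apply: integral_mul => //; exact: inti.
    - by move=> a b inta intb; rewrite rmorphM; exact: integral_mul.
    - by move=> t tts; apply: intg; rewrite inE map_f ?orbT.
  have [x [y [npy ->]]] := rhof z; have [s [q [c [/rho0 pq sE]]]] := padd y npy.
  have yE : (rho y)^-1 = rho c * (rho d)^-1 ^+ s.
    have rdE : rho d ^+ s = rho c * rho y by rewrite -rmorphXn sE rmorphD pq add0r rmorphM.
    have ry0 : rho y != 0 by apply/eqP => /rho0.
    by apply: (mulIf ry0); rewrite mulVf // mulrAC -rdE -exprMn divff // expr1n.
  rewrite yE; apply: integral_mul => //; apply: integral_mul => //.
  elim: s {sE yE} => [|s IHs]; first exact: integral1.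
  by rewrite exprS; apply: integral_mul => //; apply: intg; rewrite mem_head.
have isur z : exists k, z = i k.
  have [P Pm Pz] := int z; have [r rE] := closed_field_poly_normal P.
  move: Pz; rewrite rE (monicP Pm) scale1r rmorph_prod.
  have -> : \prod_(a <- r) map_poly i ('X - a%:P) = \prod_(a <- map i r) ('X - a%:P).
    by rewrite big_map; apply: eq_bigr => a _; rewrite rmorphB /= map_polyX map_polyC.
  by rewrite root_prod_XsubC => /mapP[k _ ->]; exists k.
have [inv invP] := choice (fun z => isur (rho z)).
have invE c k : rho c = i k -> inv c = k by rewrite invP => /fmorph_inj.
have chi_lin : linear (inv : C -> K^o).
  move=> k a b; apply: invE.
  rewrite -[X in i X]/(k * inv a + inv b).
  by rewrite (rmorphD rho) -mulr_algl (rmorphM rho) (rmorphD i) (rmorphM i) -!invP.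
have chi_mul : monoid_morphism (inv : C -> K^o).
  by split=> [|a b]; apply: invE; rewrite ?rmorph1 // (rmorphM rho) (rmorphM i) -!invP.
pose chiL := GRing.isLinear.Build K C K^o *:%R (inv : C -> K^o) chi_lin.
pose chiM := GRing.isMonoidMorphism.Build C K^o (inv : C -> K^o) chi_mul.
pose chi : point := HB.pack (inv : C -> K^o) chiL chiM.
exists chi; split=> [c /Ip/rho0 rc|].
  by apply: invE; rewrite rc rmorph0.
by apply: contraNneq rd0 => /= d0; rewrite invP d0 rmorph0.
Qed.

End Points.

(** * Sums over a coproduct *)

Section TensorSums.
Variables (K : fieldType) (U V W : lmodType K).

Lemma linear_fun0 (f : U -> V) : linear f -> f 0 = 0.
Proof. by move=> lf; have := lf (-1) 0 0; rewrite !scaleN1r !addNr. Qed.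

Lemma linear_funZ (f : U -> V) k x : linear f -> f (k *: x) = k *: f x.
Proof. by move=> lf; have := lf k x 0; rewrite (linear_fun0 lf) !addr0. Qed.

Lemma linear_big (f : U -> V) (I : Type) (r : seq I) (F : I -> U) : linear f ->
  f (\sum_(i <- r) F i) = \sum_(i <- r) f (F i).
Proof.
move=> lf; apply: (big_morph f); last exact: linear_fun0.
by move=> x y; rewrite -[x]scale1r lf !scale1r.
Qed.

End TensorSums.

Section TensorSums.
Variable K : fieldType.

Lemma tlift_sum (U V W : lmodType K) (f : U -> V -> W) (I : Type) (r : seq I) (F : I -> U ⊗ V) :
  bilinear_for *:%R *:%R f -> tlift f (\sum_(i <- r) F i) = \sum_(i <- r) tlift f (F i).
Proof. by move=> fP; rewrite (linear_big _ _ (tlift_is_linear fP)). Qed.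

Lemma tlift0 (U V W : lmodType K) (f : U -> V -> W) :
  bilinear_for *:%R *:%R f -> tlift f 0 = 0.
Proof.
by move=> fP; exact: linear_fun0 (tlift_is_linear fP).
Qed.

Lemma tlift_tens_sum (U V W : lmodType K) (f : U -> V -> W) (r : seq (U * V)) :
  bilinear_for *:%R *:%R f ->
  tlift f (\sum_(p <- r) tens p.1 p.2) = \sum_(p <- r) f p.1 p.2.
Proof.
by move=> fP; rewrite tlift_sum //; apply: eq_bigr => p _; rewrite tliftE.
Qed.

Lemma tensP (U V : lmodType K) : bilinear_for *:%R *:%R (@tens K U V).
Proof. exact: tens_bilinear. Qed.

Lemma bilinear_comp (U V U' V' W : lmodType K) (f : U -> V -> W)
    (g : {linear U' -> U}) (h : {linear V' -> V}) :
  bilinear_for *:%R *:%R f -> bilinear_for *:%R *:%R (fun u v => f (g u) (h v)).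
Proof.
move=> [fl fr]; split=> [v a u u'|u a v v'] /=; rewrite linearP; first exact: fl.
exact: fr.
Qed.

Lemma tlift_linear_param (U V W X : lmodType K) (f : X -> U -> V -> W) (t : U ⊗ V) :
  (forall u v, linear (fun x => f x u v)) -> linear (fun x => tlift (f x) t).
Proof.
move=> fP a x y; rewrite /tlift /sum_eval scaler_sumr -big_split /=.
by apply: eq_bigr => p _; exact: fP.
Qed.

Lemma tmul_left_bilinear (A B : algType K) (y : A ⊗ B) :
  bilinear_for *:%R *:%R (fun a b => tmap ( *%R a) ( *%R b) y).
Proof.
split=> [b k a a'|a k b b'] /=; rewrite /tmap /tlift /sum_eval scaler_sumr -big_split /=;
  apply: eq_bigr => p _; rewrite mulrDl -scalerAl.
- by rewrite linearPl.
- by rewrite linearPr.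
Qed.

Lemma tmul_bilinear (A B : algType K) : bilinear_for *:%R *:%R (@tmul K A B).
Proof.
split=> [y|x] k z z' /=; first exact: (tlift_is_linear (tmul_left_bilinear y)).
rewrite /tmul /tlift /sum_eval scaler_sumr -big_split /=; apply: eq_bigr => p _.
apply: tlift_is_linear; split=> [v a u u'|u a v v'] /=;
  by rewrite mulrDr -scalerAr ?linearPl ?linearPr.
Qed.

Lemma tmul_sum (A B : algType K) (r s : seq (A * B)) :
  tmul (\sum_(p <- r) tens p.1 p.2) (\sum_(q <- s) tens q.1 q.2) =
  \sum_(p <- r) \sum_(q <- s) tens (p.1 * q.1) (p.2 * q.2).
Proof.
rewrite (linear_big _ _ ((tmul_bilinear A B).1 _)); apply: eq_bigr => p _.
rewrite (linear_big _ _ ((tmul_bilinear A B).2 _)); apply: eq_bigr => q _.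
exact: tmul_tens.
Qed.

End TensorSums.

Section Coassociativity.
Variables (K : fieldType) (H : algType K) (hH : hopf_structure H).

Local Notation Delta := (comul hH).

Lemma coassoc_sum (W : lmodType K) (f : H -> H -> H -> W) h :
  (forall b c, linear (fun a => f a b c)) -> (forall a c, linear (fun b => f a b c)) ->
  (forall a b, linear (f a b)) ->
  tlift (fun a b => tlift (fun a1 a2 => f a1 a2 b) (Delta a)) (Delta h) =
  tlift (fun a b => tlift (f a) (Delta b)) (Delta h).
Proof.
move=> f1 f2 f3.
pose F a x := tlift (fun b c => f a b c) x.
have FP : bilinear_for *:%R *:%R F.
  split=> [x k a a'|a k x x'] /=; first exact: tlift_linear_param.
  by apply: tlift_is_linear; split=> [c|b]; [exact: f2 | exact: f3].
have inner c : bilinear_for *:%R *:%R (fun u v : H => tens u (tens v c)).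
  by split=> [v a u u'|u a v v'] /=; rewrite ?linearPl ?linearPr.
have assocP : bilinear_for *:%R *:%R
    (fun (x : H ⊗ H) (c : H) => tlift (fun u v => tens u (tens v c)) x).
  split=> [c|x k c c'] /=; first exact: tlift_is_linear.
  rewrite /tlift /sum_eval scaler_sumr -big_split /=.
  by apply: eq_bigr => p _; rewrite !linearPr.
have FL := tlift_is_linear FP; have AL := tlift_is_linear assocP.
pose r := repr (Delta h).
have eqF : tlift F (tassoc (\sum_(p <- r) tens (Delta p.1) p.2)) =
           tlift F (\sum_(p <- r) tens p.1 (Delta p.2)).
  have <- : tmap Delta id (Delta h) = \sum_(p <- r) tens (Delta p.1) p.2 by [].
  by rewrite coassoc.
transitivity (tlift F (tassoc (\sum_(p <- r) tens (Delta p.1) p.2))).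
  rewrite /tassoc (linear_big _ _ AL) (linear_big _ _ FL) [LHS]/tlift /sum_eval.
  apply: eq_bigr => p _; rewrite (tliftE assocP) [X in tlift F X]/tlift /sum_eval.
  rewrite (linear_big _ _ FL) [LHS]/tlift /sum_eval; apply: eq_bigr => q _.
  by rewrite (tliftE FP) /F tliftE.
rewrite eqF (linear_big _ _ FL) [RHS]/tlift /sum_eval; apply: eq_bigr => p _.
by rewrite (tliftE FP).
Qed.

End Coassociativity.

(** * The Hopf algebra [C] *)

Section CentralHopf.
Variables (K : fieldType) (H : algType K) (hH : hopf_structure H).
Variables (C : central_subalg H) (hC : hopf_subalg hH C).
(** A linear retraction turns identities between coproducts of elements of [C],
    which hold in [H ⊗ H], into identities for sums over [C]. *)
Variables (E : {linear H -> C}) (EK : forall c, E (incl c) = c).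

Local Notation Delta := (comul hH).

Lemma ex_coproduct (c : C) : exists s : seq (C * C),
  Delta (incl c) = \sum_(p <- s) tens (incl p.1) (incl p.2).
Proof. exact: (hC c).1. Qed.

Definition coproduct (c : C) : seq (C * C) := sval (cid (ex_coproduct c)).

Lemma coproductE c : Delta (incl c) = \sum_(p <- coproduct c) tens (incl p.1) (incl p.2).
Proof. exact: svalP (cid (ex_coproduct c)). Qed.

Definition sweedler (W : lmodType K) (f : C -> C -> W) (c : C) : W :=
  \sum_(p <- coproduct c) f p.1 p.2.

Section Sweedler.
Variables (W : lmodType K) (f : C -> C -> W).
Hypothesis fP : bilinear_for *:%R *:%R f.

Lemma sweedler_tlift c : sweedler f c = tlift (fun a b => f (E a) (E b)) (Delta (incl c)).
Proof.
rewrite coproductE tlift_sum; last exact: bilinear_comp.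
apply: eq_bigr => p _; rewrite tliftE ?EK //; exact: bilinear_comp.
Qed.

Lemma sweedler_linear : linear (sweedler f).
Proof.
move=> k c d; rewrite !sweedler_tlift !linearP /=.
exact: (tlift_is_linear (bilinear_comp E E fP)).
Qed.

Lemma sweedler_eq c (r : seq (C * C)) :
  Delta (incl c) = \sum_(p <- r) tens (incl p.1) (incl p.2) ->
  sweedler f c = \sum_(p <- r) f p.1 p.2.
Proof.
move=> cE; rewrite sweedler_tlift cE tlift_sum; last exact: bilinear_comp.
apply: eq_bigr => p _; rewrite tliftE ?EK //; exact: bilinear_comp.
Qed.

Lemma sweedler1 : sweedler f 1 = f 1 1.
Proof.
rewrite (@sweedler_eq 1 [:: (1, 1)]) ?big_seq1 //.
by rewrite rmorph1; exact: comul1.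
Qed.

Lemma sweedlerM c d : sweedler f (c * d) =
  \sum_(p <- coproduct c) \sum_(q <- coproduct d) f (p.1 * q.1) (p.2 * q.2).
Proof.
rewrite (@sweedler_eq _ [seq (p.1 * q.1, p.2 * q.2) | p <- coproduct c, q <- coproduct d]).
  by rewrite big_allpairs_dep.
have inclE e : Delta (incl e) =
    \sum_(p <- [seq (incl p.1, incl p.2) | p <- coproduct e]) tens p.1 p.2.
  by rewrite big_map; exact: coproductE.
rewrite rmorphM comulM !inclE tmul_sum big_allpairs_dep big_map.
apply: eq_bigr => p _; rewrite big_map; apply: eq_bigr => q _.
by rewrite !rmorphM.
Qed.

End Sweedler.

Definition epsilon (c : C) : K^o := counit hH (incl c).

Lemma epsilon_linear : linear epsilon.
Proof. by move=> k c d; rewrite /epsilon !linearP. Qed.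
Lemma epsilon_monoid_morphism : monoid_morphism epsilon.
Proof.
by split=> [|c d]; rewrite /epsilon ?rmorph1 ?rmorphM ?counit1 ?counitM.
Qed.
HB.instance Definition _ := GRing.isLinear.Build K C K^o *:%R epsilon epsilon_linear.
HB.instance Definition _ :=
  GRing.isMonoidMorphism.Build C K^o epsilon epsilon_monoid_morphism.

Lemma sweedler_counitl c : sweedler (W := C) (fun a b : C => (epsilon a : K) *: b) c = c.
Proof.
have fP : bilinear_for *:%R *:%R (fun a b : H => counit hH a *: b).
  by split=> [b k a a'|a k b b'] /=; rewrite ?linearP /= ?scalerDl ?scalerDr ?scalerA // mulrC.
apply: (@incl_inj K H C); rewrite linear_sum -[RHS](counitl hH) coproductE tlift_sum //.
by apply: eq_bigr => p _; rewrite tliftE // linearZ.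
Qed.

Lemma sweedler_counitr c : sweedler (W := C) (fun a b : C => (epsilon b : K) *: a) c = c.
Proof.
have fP : bilinear_for *:%R *:%R (fun a b : H => counit hH b *: a).
  by split=> [b k a a'|a k b b'] /=; rewrite ?linearP /= ?scalerDl ?scalerDr ?scalerA // mulrC.
apply: (@incl_inj K H C); rewrite linear_sum -[RHS](counitr hH) coproductE tlift_sum //.
by apply: eq_bigr => p _; rewrite tliftE // linearZ.
Qed.

Definition antipodeC (c : C) : C := E (antipode hH (incl c)).

Lemma incl_antipodeC c : incl (antipodeC c) = antipode hH (incl c).
Proof.
have SC := (hC c).2; have SE : antipode hH (incl c) = incl (exist (fun x => x \in csub_pred C) _ SC : C) by [].
by rewrite /antipodeC SE EK.
Qed.

Lemma antipodeC_linear : linear antipodeC.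
Proof. by move=> k c d; rewrite /antipodeC !linearP. Qed.
HB.instance Definition _ := GRing.isLinear.Build K C C *:%R antipodeC antipodeC_linear.

Lemma sweedler_antipodel c : sweedler (W := C) (fun a b : C => antipodeC a * b) c = (epsilon c : K) *: 1.
Proof.
have fP : bilinear_for *:%R *:%R (fun a b : H => antipode hH a * b).
  split=> [b k a a'|a k b b'] /=; first by rewrite linearP mulrDl -scalerAl.
  by rewrite mulrDr -scalerAr.
apply: (@incl_inj K H C); rewrite inclA -(antipodel hH) coproductE tlift_sum // linear_sum.
by apply: eq_bigr => p _; rewrite tliftE //= rmorphM /= incl_antipodeC.
Qed.

Lemma sweedler_antipoder c : sweedler (W := C) (fun a b : C => a * antipodeC b) c = (epsilon c : K) *: 1.
Proof.
have fP : bilinear_for *:%R *:%R (fun a b : H => a * antipode hH b).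
  split=> [b k a a'|a k b b'] /=; first by rewrite mulrDl -scalerAl.
  by rewrite linearP mulrDr -scalerAr.
apply: (@incl_inj K H C); rewrite inclA -(antipoder hH) coproductE tlift_sum // linear_sum.
by apply: eq_bigr => p _; rewrite tliftE //= rmorphM /= incl_antipodeC.
Qed.

Lemma sweedler_coassoc (W : lmodType K) (f : C -> C -> C -> W) c :
  (forall b c, linear (fun a => f a b c)) -> (forall a c, linear (fun b => f a b c)) ->
  (forall a b, linear (f a b)) ->
  sweedler (fun a b => sweedler (fun a1 a2 => f a1 a2 b) a) c =
  sweedler (fun a b => sweedler (f a) b) c.
Proof.
move=> f1 f2 f3.
have P12 d : bilinear_for *:%R *:%R (fun a b => f a b d) by split=> [b|a]; [exact: f1|exact: f2].
have P23 d : bilinear_for *:%R *:%R (fun a b => f d a b) by split=> [b|a]; [exact: f2|exact: f3].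
pose g a b d := f (E a) (E b) (E d).
have g1 b d : linear (fun a => g a b d) by move=> k x y; rewrite /g linearP; exact: f1.
have g2 a d : linear (fun b => g a b d) by move=> k x y; rewrite /g linearP; exact: f2.
have g3 a b : linear (g a b) by move=> k x y; rewrite /g linearP; exact: f3.
have Pl : bilinear_for *:%R *:%R (fun a b => tlift (fun a1 a2 => g a1 a2 b) (Delta a)).
  split=> [b k a a'|a] /=; last by apply: tlift_linear_param => u v; exact: g3.
  rewrite linearP; apply: tlift_is_linear; split=> [y|x]; [exact: g1|exact: g2].
have Pr : bilinear_for *:%R *:%R (fun a b => tlift (g a) (Delta b)).
  split=> [b|a k b b'] /=; first by apply: tlift_linear_param => u v; exact: g1.
  rewrite linearP; apply: tlift_is_linear; split=> [y|x]; [exact: g2|exact: g3].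
have := coassoc_sum hH (incl c) g1 g2 g3; rewrite coproductE !tlift_sum //.
move=> eqg; transitivity (\sum_(p <- coproduct c)
    tlift (fun a b => tlift (fun a1 a2 => g a1 a2 b) (Delta a)) (tens (incl p.1) (incl p.2))).
  apply: eq_bigr => p _; rewrite tliftE // sweedler_tlift //.
  by rewrite /g EK.
rewrite eqg; apply: eq_bigr => p _; rewrite tliftE // sweedler_tlift //.
by rewrite /g EK.
Qed.

End CentralHopf.

(** * Subspaces of finite codimension *)

Section FiniteCodimension.
Variables (K : fieldType) (V : lmodType K) (U : V -> Prop).
Hypothesis sU : subspace U.

Definition spans_mod k (x : 'I_k -> V) : Prop :=
  forall v, exists c : 'rV[K]_k, U (v - \sum_j c 0 j *: x j).

(** A shortest spanning family modulo [U] is a basis of the quotient by [U]. *)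
Lemma finite_codim k (x : 'I_k -> V) : spans_mod x ->
  exists r (phi : {linear V -> 'rV[K]_r}) (sigma : 'rV[K]_r -> V),
    (forall w, phi (sigma w) = w) /\ forall v, phi v = 0 <-> U v.
Proof.
move=> xP; pose P k := `[< exists x : 'I_k -> V, spans_mod x >].
have exP : exists k, P k by exists k; apply/asboolP; exists x.
have [r /asboolP[{xP}x xP] rmin] := ex_minnP exP.
have free (c : 'rV[K]_r) : U (\sum_j c 0 j *: x j) -> c = 0.
  move=> Uc; apply/rowP => i; rewrite mxE; apply: contrapT => /eqP ci0.
  case: r i => [[]//|r] i in x xP rmin c Uc ci0 *.
  suff /rmin : P r by rewrite ltnn.
  apply/asboolP; exists (fun j => x (lift i j)) => v; have [d Ud] := xP v.
  exists (\row_j (d 0 (lift i j) - d 0 i / c 0 i * c 0 (lift i j))).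
  have -> : \sum_j (\row_j (d 0 (lift i j) - d 0 i / c 0 i * c 0 (lift i j))) 0 j *: x (lift i j)
      = \sum_j d 0 (lift i j) *: x (lift i j)
        - (d 0 i / c 0 i) *: \sum_j c 0 (lift i j) *: x (lift i j).
    rewrite scaler_sumr -sumrB; apply: eq_bigr => j _.
    by rewrite mxE scalerBl scalerA.
  have -> : forall s, v - (s - (d 0 i / c 0 i) *: \sum_j c 0 (lift i j) *: x (lift i j)) =
      (d 0 i / c 0 i) *: (\sum_j c 0 j *: x j) + (v - (d 0 i *: x i + s)).
    move=> s; rewrite (bigD1_ord i) //= scalerDr scalerA divfK // opprB opprD.
    by rewrite [v + (- _ - _)]addrCA addrACA subrr add0r addrCA.
  by rewrite (bigD1_ord i) //= in Ud; exact: sU.2.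
have [coord coordP] := choice xP.
have coordE v (c : 'rV[K]_r) : U (v - \sum_j c 0 j *: x j) -> coord v = c.
  move=> Uc; apply/eqP; rewrite -subr_eq0; apply/eqP; apply: free.
  have -> : \sum_j (coord v - c) 0 j *: x j =
      (v - \sum_j c 0 j *: x j) - (v - \sum_j coord v 0 j *: x j).
    rewrite opprB [RHS]addrC addrA subrK -sumrB.
    by apply: eq_bigr => j _; rewrite !mxE scalerBl.
  exact: subspaceB.
have coord_linear : linear coord.
  move=> a v w; apply: coordE.
  have -> : a *: v + w - \sum_j (a *: coord v + coord w) 0 j *: x j =
      a *: (v - \sum_j coord v 0 j *: x j) + (w - \sum_j coord w 0 j *: x j).
    rewrite scalerBr addrACA -opprD scaler_sumr -big_split; congr (_ - _).
    by apply: eq_bigr => j _; rewrite !mxE scalerDl scalerA.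
  exact: sU.2.
pose phiL := GRing.isLinear.Build K V 'rV[K]_r *:%R coord coord_linear.
pose phi : {linear V -> 'rV[K]_r} := HB.pack coord phiL.
exists r, phi, (fun w => \sum_j w 0 j *: x j); split=> [w|v].
  by apply: coordE; rewrite subrr; exact: sU.1.
split=> [/= v0|Uv].
  have := coordP v; rewrite v0 big1 ?subr0 // => j _.
  by rewrite mxE scale0r.
apply: coordE; rewrite big1 ?subr0 // => j _.
by rewrite mxE scale0r.
Qed.

End FiniteCodimension.

(** * Translations and points *)

Section Translations.
Variables (K : closedFieldType) (H : algType K) (hH : hopf_structure H).
Variables (C : central_subalg H) (hC : hopf_subalg hH C).
Variables (E : {linear H -> C}) (EK : forall c, E (incl c) = c).

Local Notation linearform := {linear C -> K^o}.
Local Notation point := (@point K H C).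
Local Notation coproduct := (coproduct hC).
Local Notation eps := (@epsilon K H hH C).

Lemma linearform_scale (phi : linearform) k c : phi (k *: c) = k * phi c.
Proof. by rewrite linearZ. Qed.

(** For a point [chi] this is the comorphism of the translation by [chi]. *)
Definition translate (phi : C -> K) (c : C) : C :=
  sweedler hC (W := C) (fun a b : C => phi a *: b) c.

Lemma translate_bilinear (phi : linearform) :
  bilinear_for *:%R *:%R (fun a b : C => phi a *: b).
Proof.
split=> [b k a a'|a k b b'] /=; first by rewrite linearP scalerDl scalerA.
by rewrite scalerDr !scalerA mulrC.
Qed.

Lemma translate_linear (phi : linearform) : linear (translate phi).
Proof. exact: (sweedler_linear hC EK (translate_bilinear phi)). Qed.

Lemma translateZ (phi : linearform) k c : translate phi (k *: c) = k *: translate phi c.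
Proof.
have t0 : translate phi 0 = 0.
  by have := translate_linear phi (-1) 0 0; rewrite !scaleN1r !addNr.
by have := translate_linear phi k c 0; rewrite t0 !addr0.
Qed.

Lemma translate_form (phi psi : linearform) c :
  psi (translate phi c) = \sum_(p <- coproduct c) phi p.1 * psi p.2.
Proof. by rewrite linear_sum; apply: eq_bigr => p _; rewrite linearform_scale. Qed.

Lemma epsilon_translate (phi : linearform) c : eps (translate phi c) = phi c.
Proof.
rewrite translate_form -[in RHS](sweedler_counitr hC c) linear_sum.
by apply: eq_bigr => p _; rewrite linearform_scale mulrC.
Qed.

Lemma translate_epsilon c : translate (eps) c = c.
Proof. exact: (sweedler_counitl hC). Qed.

Lemma translate_comp (phi psi theta : linearform) c :
  (forall a, theta a = phi (translate psi a)) ->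
  translate phi (translate psi c) = translate theta c.
Proof.
move=> thetaE; rewrite (linear_big _ _ (translate_linear phi)).
pose f (a b d : C) := (psi a * phi b) *: d.
transitivity (sweedler hC (W := C) (fun a b => sweedler hC (W := C) (f a) b) c).
  apply: eq_bigr => p _; rewrite translateZ scaler_sumr.
  by apply: eq_bigr => q _; rewrite scalerA.
rewrite -(sweedler_coassoc hC EK) /f.
- apply: eq_bigr => p _; rewrite thetaE translate_form scaler_suml.
  by apply: eq_bigr => q _.
- move=> b d k a a'; rewrite linearD linearform_scale mulrDl scalerDl -mulrA scalerA.
  reflexivity.
- move=> a d k b b'; rewrite linearD linearform_scale mulrDr scalerDl mulrCA scalerA.
  reflexivity.
- by move=> a b k d d'; rewrite scalerDr !scalerA mulrC.
Qed.

Section Point.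
Variable chi : point.

Lemma translateM a b : translate chi (a * b) = translate chi a * translate chi b.
Proof.
rewrite {1}/translate (sweedlerM hC EK (translate_bilinear chi)) mulr_suml.
apply: eq_bigr => p _; rewrite mulr_sumr; apply: eq_bigr => q _.
by rewrite rmorphM -scalerAl -scalerAr scalerA.
Qed.

Lemma translate1 : translate chi 1 = 1.
Proof. by rewrite /translate (sweedler1 hC EK (translate_bilinear chi)) rmorph1 scale1r. Qed.

Definition inverse_form : linearform := chi \o antipodeC hH E.

Lemma inverse_translate c : inverse_form (translate chi c) = eps c.
Proof.
rewrite translate_form.
have := congr1 chi (sweedler_antipoder hC EK c).
rewrite linear_sum linearform_scale rmorph1 mulr1 => <-.
by apply: eq_bigr => p _; rewrite rmorphM.
Qed.

Lemma translate_inverse c : chi (translate inverse_form c) = eps c.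
Proof.
rewrite translate_form.
have := congr1 chi (sweedler_antipodel hC EK c).
rewrite linear_sum linearform_scale rmorph1 mulr1 => <-.
by apply: eq_bigr => p _; rewrite rmorphM.
Qed.

Lemma translateK c : translate inverse_form (translate chi c) = c.
Proof.
rewrite (translate_comp (theta := eps)) ?translate_epsilon // => a.
exact/esym/inverse_translate.
Qed.

Lemma translateKV c : translate chi (translate inverse_form c) = c.
Proof.
rewrite (translate_comp (theta := eps)) ?translate_epsilon // => a.
exact/esym/translate_inverse.
Qed.

(** The inverse of an algebra automorphism is multiplicative; this spares a proof
    that the antipode is. *)
Lemma translate_inverseM a b : translate inverse_form (a * b) =
  translate inverse_form a * translate inverse_form b.
Proof.
by rewrite -[X in translate _ X](_ : translate chi (translate inverse_form a * translate inverse_form b) = _)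
  ?translateK // translateM !translateKV.
Qed.

Lemma translate_inverse1 : translate inverse_form 1 = 1.
Proof. by rewrite -{1}translate1 translateK. Qed.

End Point.

(** In the group of points take [g = gamma h^-1]; the translations compose
    accordingly, and [g] is multiplicative because they are. *)
Lemma point_left_quotient (gamma h : point) :
  exists g : point, forall c, gamma c = \sum_(p <- coproduct c) g p.1 * h p.2.
Proof.
pose g c : K^o := inverse_form h (translate gamma c).
have gE c : g c = eps (translate (inverse_form h) (translate gamma c)).
  by rewrite epsilon_translate.
have g_lin : linear g.
  by move=> k a b; rewrite /g translate_linear linearP.
have g_mul : monoid_morphism g.
  split=> [|a b]; rewrite !gE ?translate1 ?translate_inverse1 ?rmorph1 //.
  by rewrite translateM translate_inverseM rmorphM.
pose gL := GRing.isLinear.Build K C K^o *:%R g g_lin.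
pose gM := GRing.isMonoidMorphism.Build C K^o g g_mul.
pose gp : point := HB.pack g gL gM.
exists gp => c; rewrite -translate_form.
rewrite -(translate_comp (phi := inverse_form h) (psi := gamma) (theta := gp)) //.
by rewrite -[RHS]/(h _) translate_inverse epsilon_translate.
Qed.

End Translations.

(** * Krull's intersection theorem *)

Section Krull.
Variables (R : comNzRingType) (acc : ideal_acc R).
Variables (I : R -> Prop) (iI : is_ideal I).

Fixpoint ideal_pow (m : nat) (z : R) : Prop :=
  if m is m'.+1 then
    exists2 r : seq (R * R), (forall p, p \in r -> I p.1 /\ ideal_pow m' p.2)
      & z = \sum_(p <- r) p.1 * p.2
  else True.

Lemma ideal_powM m x z : I x -> ideal_pow m z -> ideal_pow m.+1 (x * z).
Proof.
by exists [:: (x, z)]; rewrite ?big_seq1 // => p; rewrite inE => /eqP ->.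
Qed.

Lemma ideal_pow_ideal m : is_ideal (ideal_pow m).
Proof.
elim: m => [|m [_ _ IM]]; first by [].
split; first by exists [::]; rewrite ?big_nil.
- move=> _ _ [r rP ->] [s sP ->]; exists (r ++ s); last by rewrite big_cat.
  by move=> p; rewrite mem_cat => /orP[/rP|/sP].
- move=> c _ [r rP ->]; exists [seq (p.1, c * p.2) | p <- r].
    by move=> p /mapP[q /rP[Iq Iq'] ->]; split=> //; exact: IM.
  by rewrite big_map mulr_sumr; apply: eq_bigr => p _; rewrite mulrCA.
Qed.

Lemma ideal_pow1 x : I x -> ideal_pow 1 x.
Proof. by rewrite -{2}[x]mulr1 => Ix; exact: ideal_powM. Qed.

Lemma ideal_powD2 m x z : ideal_pow 2 x -> ideal_pow m z -> ideal_pow m.+2 (x * z).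
Proof.
move=> [r rP ->] Iz; rewrite mulr_suml; have iP := ideal_pow_ideal m.+2.
rewrite big_seq_cond; apply: (ideal_sum iP) => p /andP[/rP[Ip [s sP ->]] _].
rewrite -mulrA mulr_suml mulr_sumr big_seq_cond; apply: (ideal_sum iP) => q /andP[/sP[Iq _] _].
rewrite -mulrA; apply: ideal_powM => //; apply: ideal_powM => //.
by have [_ _] := ideal_pow_ideal m; apply.
Qed.

Lemma nilpotent_products (Q : R -> Prop) (X : seq R) : is_ideal Q ->
  (forall x, x \in X -> exists k, Q (x ^+ k)) ->
  exists s, forall w : seq R, {subset w <= X} -> (s <= size w)%N -> Q (\prod_(x <- w) x).
Proof.
move=> [_ _ QM]; elim: X => [|x X IH] nilX.
  by exists 1%N => -[|y w] // /(_ y); rewrite mem_head => /(_ isT).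
have [|s sP] := IH; first by move=> y yX; apply: nilX; rewrite inE yX orbT.
have [k Qk] := nilX x (mem_head _ _).
exists (s + k)%N => w wX szw.
have wE : perm_eq w (filter (pred1 x) w ++ filter (predC (pred1 x)) w).
  by rewrite perm_sym perm_filterC.
rewrite (perm_big _ wE) big_cat /=.
have -> : \prod_(y <- filter (pred1 x) w) y = x ^+ count_mem x w.
  rewrite big_filter (eq_bigr (fun=> x)) => [|y /eqP //].
  by rewrite big_const_seq iter_mulr_1.
have [kc|ck] := leqP k (count_mem x w).
  by rewrite -(subnK kc) exprD mulrC mulrA; exact: QM.
apply: QM; apply: sP => [y|].
  by rewrite mem_filter => /andP[/= yx /wX]; rewrite inE (negPf yx).
rewrite size_filter -(leq_add2r k) (leq_trans szw) // -(count_predC (pred1 x) w).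
by rewrite addnC leq_add2l ltnW.
Qed.

Lemma ideal_pow_sub (X : seq R) : (forall x, I x -> ideal_span X x) ->
  forall m (Q : R -> Prop), is_ideal Q ->
    (forall w : seq R, {subset w <= X} -> size w = m -> Q (\prod_(x <- w) x)) ->
    forall z, ideal_pow m z -> Q z.
Proof.
move=> XI; elim=> [|m IH] Q iQ QX z; have [Q0 QD QM] := iQ.
  by move=> _; rewrite -[z]mulr1; apply: QM; have := QX [::]; rewrite big_nil; apply.
move=> [r rP ->]; rewrite big_seq_cond; apply: (ideal_sum iQ) => p /andP[/rP[/XI[s sP ->] Ip] _].
rewrite mulr_suml big_seq_cond; apply: (ideal_sum iQ) => q /andP[/sP qX _].
rewrite -mulrA; apply: (QM _ _); move: Ip; apply: (IH (fun c => Q (q.2 * c))).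
  split; first by rewrite mulr0.
  - by move=> x y Qx Qy; rewrite mulrDr; exact: QD.
  - by move=> c x Qx; rewrite mulrCA; exact: QM.
move=> w wX szw; have := QX (q.2 :: w); rewrite big_cons; apply; last by rewrite /= szw.
by move=> x; rewrite inE => /orP[/eqP ->|/wX].
Qed.

(** If [y] is not in [I y], let [Q] be an ideal that contains [I y] but not [y] and
    is maximal for this.  Some power of each [x] in [I] lies in [Q], for otherwise
    [y = q + c x ^ m], and [x y = x q + c x ^ (m + 1)] puts [c x ^ (m + 1)], hence
    [c x ^ m], in [Q] if [m] is large.  So a power of [I], hence [y], is in [Q]. *)
Theorem krull_intersection y : (forall m, ideal_pow m y) ->
  exists2 z, I z & y = z * y.
Proof.
move=> Iy; apply: contrapT => nIy; have [I0 ID IM] := iI.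
pose F Q := [/\ is_ideal Q, forall z, I z -> Q (z * y) & ~ Q y].
have [Q [iQ IQ Qy] Qmax] : exists2 Q, F Q & forall Q', F Q' ->
    (forall x, Q x -> Q' x) -> forall x, Q' x -> Q x.
  apply: (maximal_ideal_in acc); first by move=> Q [].
  exists (fun x => exists2 z, I z & x = z * y); split.
  - split; first by exists 0; rewrite ?mul0r.
      move=> _ _ [z Iz ->] [z' Iz' ->]; exists (z + z'); first exact: ID.
      by rewrite mulrDl.
    move=> c _ [z Iz ->]; exists (c * z); first exact: IM.
    by rewrite mulrA.
  - by move=> z Iz; exists z.
  - exact: nIy.
have [Q0 QD QM] := iQ.
have nilI x : I x -> exists k, Q (x ^+ k).
  move=> Ix; have [|j c|m mP] := acc (L := fun j c => Q (c * x ^+ j)).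
  - move=> j; split; first by rewrite mul0r.
      by move=> a b Qa Qb; rewrite mulrDl; exact: QD.
    by move=> c a Qa; rewrite -mulrA; exact: QM.
  - by rewrite exprS mulrCA; exact: QM.
  exists m; apply: contrapT => nQ; apply: nQ.
  have [Qy'|nQy'] := pselect (exists q c, Q q /\ y = q + c * x ^+ m).
    case: Qy => {Qmax}; have [q [c [Qq yE]]] := Qy'; rewrite yE; apply: (QD _ _ Qq).
    apply: (mP m.+1); have -> : c * x ^+ m.+1 = x * y - x * q.
      by rewrite yE mulrDr addrC addKr exprS mulrCA.
    by apply: (idealB iQ); [exact: IQ | exact: QM].
  apply: (Qmax (fun z => exists q c, Q q /\ z = q + c * x ^+ m)).
  - split.
    + split; first by exists 0, 0; rewrite mul0r addr0.
        move=> _ _ [q [c [Qq ->]]] [q' [c' [Qq' ->]]]; exists (q + q'), (c + c').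
        by rewrite mulrDl addrACA; split=> //; exact: QD.
      move=> e _ [q [c [Qq ->]]]; exists (e * q), (e * c).
      by rewrite mulrDr mulrA; split=> //; exact: QM.
    + by move=> z /IQ Qz; exists (z * y), 0; rewrite mul0r addr0.
    + by [].
  - by move=> q Qq; exists q, 0; rewrite mul0r addr0.
  - by exists 0, 1; rewrite mul1r add0r.
have [X XI IX] := ideal_fg acc iI.
have [s sP] := nilpotent_products iQ (fun x xX => nilI x (XI x xX)).
by apply: Qy; apply: (ideal_pow_sub IX iQ _ (Iy s)) => w wX szw; apply: sP; rewrite ?szw.
Qed.

End Krull.

(** * [C] is reduced *)

Section Derivation.
Variable R : comNzRingType.
Variables (D : {additive R -> R}) (DM : forall a b, D (a * b) = a * D b + D a * b).
Hypothesis divR : forall k (x : R), x *+ k.+1 = 0 -> x = 0.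

Lemma derivation1 : D 1 = 0.
Proof. by apply: (addrI (D 1)); rewrite addr0 -{3}[1]mulr1 DM mul1r mulr1. Qed.

Lemma derivationX a k : D (a ^+ k.+1) = a ^+ k * D a *+ k.+1.
Proof.
elim: k => [|k IH]; first by rewrite expr1 expr0 mul1r.
by rewrite exprS DM IH mulrnAr mulrA -exprS [D a * _]mulrC -mulrSr.
Qed.

(** From [y ^ (j + 1) (D y) ^ b = 0] one gets [y ^ j (D y) ^ (b + 2) = 0] by
    applying [D] and multiplying by [D y]. *)
Lemma derivation_nilpotent y s : y ^+ s = 0 -> exists s', (D y) ^+ s' = 0.
Proof.
suff main j b : y ^+ j * (D y) ^+ b = 0 -> exists s', (D y) ^+ s' = 0.
  by move=> ys; apply: (main s 0%N); rewrite mulr1.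
elim: j b => [|j IH] b; first by rewrite mul1r; exists b.
move=> yb; apply: (IH b.+2); apply: (divR (k := j)).
have := congr1 (fun z => D z * D y) yb; rewrite raddf0 mul0r DM mulrDl.
rewrite derivationX.
have -> : y ^+ j.+1 * D (D y ^+ b) * D y = 0.
  case: b yb => [|b] yb; first by rewrite expr0 derivation1 mulr0 mul0r.
  rewrite derivationX mulrnAr mulrnAl -!mulrA [D (D y) * _]mulrC.
  by rewrite (mulrA (D y ^+ b)) -exprSr mulrA yb mul0r mul0rn.
rewrite add0r => <-; rewrite !mulrnAl; congr (_ *+ _).
by rewrite -!mulrA -exprSr -exprS.
Qed.
End Derivation.

Section Reduced.
Variables (K : closedFieldType) (charK : [pchar K] =i pred0).
Variables (H : algType K) (hH : hopf_structure H).
Variables (C : central_subalg H) (hC : hopf_subalg hH C).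
Variables (E : {linear H -> C}) (EK : forall c, E (incl c) = c).
Variables (ts : seq C) (B : seq H).
Hypothesis finite : forall x, span (gen ts) B x.

Local Notation eps := (@epsilon K H hH C).
Local Notation coproduct := (coproduct hC).

Let I (c : C) : Prop := eps c = 0.

Let iI : is_ideal I.
Proof.
split; rewrite /I; first by rewrite linear0.
  by move=> x y x0 y0; rewrite linearD /= x0 y0 addr0.
by move=> c x x0; rewrite rmorphM /= x0 mulr0.
Qed.

Let acc : ideal_acc C := central_acc finite.

(** A tangent vector [delta] at the unit of the group extends to the invariant
    vector field [(id ⊗ delta) Delta]. *)
Lemma invariant_derivation (delta : {linear C -> K^o}) :
  (forall a b, delta (a * b) = eps a * delta b + delta a * eps b) ->
  exists D : {additive C -> C}, (forall a b, D (a * b) = a * D b + D a * b) /\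
    forall c, eps (D c) = delta c.
Proof.
move=> deltaM; pose D c := sweedler hC (W := C) (fun a b : C => (delta b : K) *: a) c.
have DP : bilinear_for *:%R *:%R (fun a b : C => (delta b : K) *: a).
  split=> [b k a a'|a k b b'] /=; first by rewrite scalerDr !scalerA mulrC.
  by rewrite linearD linearform_scale scalerDl scalerA.
have DL : linear D := sweedler_linear hC EK DP.
pose DA := GRing.isLinear.Build K C C *:%R D DL.
pose Dl : {linear C -> C} := HB.pack D DA.
exists Dl; split=> [a b|c] /=; last first.
  rewrite linear_sum -[in RHS](sweedler_counitl hC c) linear_sum.
  by apply: eq_bigr => p _; rewrite !linearform_scale mulrC.
have cE d : \sum_(p <- coproduct d) (eps p.2 : K) *: p.1 = d := sweedler_counitr hC d.
transitivity ((\sum_(p <- coproduct a) (eps p.2 : K) *: p.1) * D b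
    + D a * (\sum_(q <- coproduct b) (eps q.2 : K) *: q.1)); last by rewrite !cE.
rewrite /D (sweedlerM hC EK DP) /sweedler mulr_suml mulr_suml -big_split; apply: eq_bigr => p _.
rewrite !mulr_sumr -big_split; apply: eq_bigr => q _ /=.
rewrite deltaM scalerDl -!scalerAl -!scalerAr !scalerA.
by congr (_ + _).
Qed.

(** A basis of [I / I ^ 2] and the invariant vector fields that extend its dual
    basis: [\sum_i x_i D_i] is an Euler operator, the identity on [I / I ^ 2]. *)
Lemma maximal_ideal_cotangent : exists r (x : 'I_r -> C) (D : 'I_r -> {additive C -> C}),
  [/\ forall i, I (x i), forall i a b, D i (a * b) = a * D i b + D i a * b
    & forall c, I c -> ideal_pow I 2 (c - \sum_i x i * D i c)].
Proof.
pose U c := exists k : K, ideal_pow I 2 (c - k *: 1).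
have [_ I2D I2M] := ideal_pow_ideal I 2; have [I20 _ _] := ideal_pow_ideal I 2.
have sU : subspace U.
  split; first by exists 0; rewrite scale0r subr0.
  move=> k x y [a Ux] [b Uy]; exists (k * a + b).
  have -> : k *: x + y - (k * a + b) *: 1 = k%:A * (x - a *: 1) + (y - b *: 1).
    by rewrite mulr_algl scalerBr scalerA scalerDl opprD addrACA.
  by apply: I2D => //; exact: I2M.
have epsB c : I (c - (eps c : K) *: 1).
  by rewrite /I linearB linearform_scale rmorph1 mulr1 subrr.
have [X XI IX] := ideal_fg acc iI.
have XU : spans_mod U (fun j : 'I_(size X) => X`_j).
  pose S v := exists c : 'rV[K]_(size X), U (v - \sum_j c 0 j *: X`_j).
  have SU v : U v -> S v.
    move=> Uv; exists 0; rewrite big1 ?subr0 // => j _; by rewrite mxE scale0r.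
  have SL k a b : S a -> S b -> S (k *: a + b).
    move=> [c Uc] [d Ud]; exists (k *: c + d).
    have -> : k *: a + b - \sum_j (k *: c + d) 0 j *: X`_j =
        k *: (a - \sum_j c 0 j *: X`_j) + (b - \sum_j d 0 j *: X`_j).
      rewrite scalerBr addrACA -opprD scaler_sumr -big_split; congr (_ - _).
      by apply: eq_bigr => j _; rewrite !mxE scalerDl scalerA.
    exact: sU.2.
  have SX a : a \in X -> S a.
    move=> /(nthP 0)[j jX <-]; exists (delta_mx 0 (Ordinal jX)).
    rewrite (bigD1 (Ordinal jX)) //= mxE !eqxx scale1r big1 => [|l lj].
      by rewrite addr0 subrr; exact: sU.1.
    by rewrite mxE eqxx (negPf lj) scale0r.
  move=> v; suff : S v by [].
  have -> : v = (eps v : K) *: 1 + 1 *: (v - (eps v : K) *: 1) + 0.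
    by rewrite scale1r addr0 addrC subrK.
  have S0 : S 0 by apply: SU; exact: sU.1.
  rewrite -addrA; apply: (SL _ _ _); first by apply: SU; exists 1; rewrite scale1r subrr.
  apply: (SL _ _ _) => //; have [q qP ->] := IX _ (epsB v).
  elim: q qP => [|p q IH] qP; first by rewrite big_nil.
  rewrite big_cons.
  have -> : p.1 * p.2 = (eps p.1 : K) *: p.2 + (p.1 - (eps p.1 : K) *: 1) * p.2.
    by rewrite mulrBl -scalerAl mul1r addrC subrK.
  have pX : p.2 \in X by apply: qP; rewrite mem_head.
  rewrite -addrA; apply: (SL _ _ _); first exact: SX.
  rewrite -[X in X + _]scale1r; apply: (SL _ _ _); last first.
    by apply: IH => p' p'q; apply: qP; rewrite inE p'q orbT.
  apply: SU; exists 0; rewrite scale0r subr0; apply: ideal_powM; first exact: epsB.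
  by apply: ideal_pow1; exact: XI.
have [r [phi [sigma [phiK phi0]]]] := finite_codim sU XU.
pose x i := sigma (delta_mx 0 i) - (eps (sigma (delta_mx 0 i)) : K) *: 1.
have phi1 : phi 1 = 0.
  by apply/phi0; exists 1; rewrite scale1r subrr.
have phiI2 c : ideal_pow I 2 c -> phi c = 0.
  by move=> Ic; apply/phi0; exists 0; rewrite scale0r subr0.
have phiM a b : phi (a * b) = (eps a : K) *: phi b + (eps b : K) *: phi a.
  have := phiI2 _ (ideal_powM (epsB a) (ideal_pow1 (epsB b))).
  rewrite mulrBr !mulrBl -!scalerAr -!scalerAl !mulr1 !mul1r scalerA.
  rewrite 3!linearB !linearZ /= phi1 oppr0 scaler0 addr0 scalerN => /eqP.
  by rewrite -addrA -opprD subr_eq0 => /eqP.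
have phiZ k a : phi (k *: a) = k *: phi a by rewrite linearZ.
have phix i : phi (x i) = delta_mx 0 i.
  by rewrite /x (linearB phi) phiZ phi1 scaler0 subr0 phiK.
have dP i : exists D : {additive C -> C}, (forall a b, D (a * b) = a * D b + D a * b) /\
    forall c, eps (D c) = phi c 0 i.
  pose d c : K^o := phi c 0 i.
  have dL : linear d by move=> k a b; rewrite /d linearP !mxE.
  pose dLin := GRing.isLinear.Build K C K^o *:%R d dL.
  pose delta : {linear C -> K^o} := HB.pack d dLin.
  apply: (@invariant_derivation delta) => a b.
  by rewrite /= /d phiM !mxE [_ * phi a 0 i]mulrC.
have [D DP] := choice dP.
have Ix0 i : eps (x i) = 0 by exact: epsB.
exists r, x, D; split=> [i|i|c Ic]; [exact: epsB | exact: (DP i).1 |].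
have [k I2c] : U (c - \sum_i x i * D i c).
  apply/phi0; rewrite linearB linear_sum [X in X - _]row_sum_delta -sumrB big1 // => i _.
  by rewrite phiM (DP i).2 Ix0 scale0r add0r phix subrr.
have eps2 w : ideal_pow I 2 w -> eps w = 0.
  move=> [q qP ->]; have [_ _ IM] := iI.
  rewrite big_seq_cond; apply: (ideal_sum iI) => p /andP[/qP[Ip _] _].
  by rewrite mulrC; exact: IM.
have : eps (c - \sum_i x i * D i c - k *: 1) = 0 by exact: eps2.
rewrite !linearB linearform_scale rmorph1 mulr1 /= Ic linear_sum big1 => [|i _].
  by rewrite !sub0r oppr0 sub0r => /eqP; rewrite oppr_eq0 => /eqP k0; move: I2c; rewrite k0 scale0r subr0.
by rewrite rmorphM /= Ix0 mul0r.
Qed.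

Let divC k (c : C) : c *+ k.+1 = 0 -> c = 0.
Proof. exact: mulrn_inj_lmod. Qed.

(** The Euler operator [Eu] acts on [I ^ m / I ^ (m + 1)] as multiplication by [m].
    If all nilpotents lie in [I ^ m], then so do the [D_i y], hence [Eu y], and
    with it [m y], lies in [I ^ (m + 1)]. *)
Lemma nilpotent_ideal_pow m y s : y ^+ s = 0 -> ideal_pow I m y.
Proof.
have [r [x [D [Ix DM DP]]]] := maximal_ideal_cotangent.
pose Eu c := \sum_i x i * D i c.
have EuD a b : Eu (a + b) = Eu a + Eu b.
  by rewrite /Eu -big_split; apply: eq_bigr => i _; rewrite raddfD mulrDr.
have EuM a b : Eu (a * b) = a * Eu b + Eu a * b.
  rewrite /Eu mulr_sumr mulr_suml -big_split; apply: eq_bigr => i _.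
  by rewrite DM mulrDr mulrCA !mulrA.
have EuP k c : ideal_pow I k c -> ideal_pow I k.+1 (Eu c - c *+ k).
  elim: k c => [|k IH] c.
    move=> _; rewrite mulr0n subr0; have iP := ideal_pow_ideal I 1.
    by apply: (ideal_sum iP) => i _; exact: ideal_powM.
  move=> [q qP ->]; have iP := ideal_pow_ideal I k.+2.
  rewrite (big_morph Eu EuD (_ : Eu 0 = 0)); last first.
    by rewrite /Eu big1 // => i _; rewrite raddf0 mulr0.
  rewrite -sumrMnl -sumrB big_seq_cond; apply: (ideal_sum iP) => p /andP[/qP[Ip Ip'] _].
  have -> : Eu (p.1 * p.2) - p.1 * p.2 *+ k.+1 =
      - ((p.1 - Eu p.1) * p.2) + p.1 * (Eu p.2 - p.2 *+ k).
    rewrite EuM mulrBl mulrBr opprB mulrS mulrnAr opprD addrACA.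
    by rewrite [p.1 * Eu p.2 - _]addrC [_ - p.1 * p.2]addrC addrACA addrC.
  have [_ ID _] := iP; apply: ID.
    by apply: (idealN iP); apply: ideal_powD2 => //; exact: DP.
  by apply: ideal_powM => //; exact: IH.
elim: m y s => [|m IH] y s ys //.
have Im := IH y s ys; have [_ ID IM] := ideal_pow_ideal I m.+1.
case: m => [|m] in IH Im ID IM *.
  apply: ideal_pow1; apply/eqP; apply: contraT => y0; have := congr1 eps ys.
  by rewrite rmorphXn rmorph0 => /eqP; rewrite expf_eq0 (negPf y0) andbF.
have Imy : ideal_pow I m.+2 (y *+ m.+1).
  have -> : y *+ m.+1 = Eu y - (Eu y - y *+ m.+1) by rewrite opprB addrC subrK.
  apply: (idealB (ideal_pow_ideal I m.+2)); last exact: EuP.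
  apply: (ideal_sum (ideal_pow_ideal I m.+2)) => i _; apply: ideal_powM => //.
  have [s' Ds'] := derivation_nilpotent (DM i) divC ys.
  exact: IH Ds'.
have -> : y = ((m.+1%:R : K)^-1)%:A * (y *+ m.+1).
  by rewrite mulr_algl -scaler_nat scalerA mulVf ?scale1r // natK_neq0.
exact: IM.
Qed.

(** Cartier's theorem: nilpotent functions vanish to infinite order at the unit,
    hence around the unit, and by translation everywhere. *)
Theorem central_reduced (y : C) s : y ^+ s = 0 -> y = 0.
Proof.
move=> ys; apply: contrapT => y0.
pose A c := c * y = 0.
have iA : is_ideal A.
  split; rewrite /A; first by rewrite mul0r.
    by move=> a b ay yb; rewrite mulrDl ay yb addr0.
  by move=> c a ay; rewrite -mulrA ay mulr0.
have [|chi [chiA _]] := point_avoiding finite (d := 1) iA.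
  by move=> k; rewrite /A expr1n mul1r.
pose y' := translate hC chi y.
have ys' : y' ^+ s = 0.
  have <- : translate hC chi (y ^+ s) = y' ^+ s.
    elim: (s) => [|k IH]; first by rewrite !expr0 (translate1 hC EK).
    by rewrite !exprS (translateM hC EK) IH.
  by rewrite ys; have := translateZ hC EK chi 0 0; rewrite !scale0r.
have [z Iz yz] := krull_intersection acc iI (fun m => nilpotent_ideal_pow m ys').
pose inv := inverse_form hH E chi.
have /chiA chiu : A (translate hC inv (1 - z)).
  rewrite /A -[X in _ * X](translateK hC EK chi) -/y' -(translate_inverseM hC EK).
  rewrite mulrBl mul1r -yz subrr.
  by have := translateZ hC EK inv 0 0; rewrite !scale0r.
have : eps (1 - z) = 0 by rewrite -(translate_inverse hC EK chi).
by rewrite linearB /= rmorph1 Iz subr0 => /eqP; rewrite oner_eq0.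
Qed.

End Reduced.

(** * Algebras over [K] with a nondegenerate Cayley-Hamilton trace *)

Section Nondegenerate.
Variables (K : closedFieldType) (charK : [pchar K] =i pred0).
Variables (A : algType K) (t : {linear A -> K^o}) (n : nat).
Hypothesis tC : forall a b : A, t (a * b) = t (b * a).
Hypothesis nondeg : forall a : A, (forall b, t (a * b) = 0) -> a = 0.
Hypothesis char_poly : forall a : A, exists p : {poly K},
  [/\ size p = n.+1, horner_alg a p = 0 &
      (forall j, (1 < j)%N -> t (a ^+ j) = 0) -> t a != 0 -> p`_0 != 0].

Implicit Types a b x y e f : A.

Lemma horner_algMX a p c : horner_alg a (p * 'X + c%:P) = horner_alg a p * a + c%:A.
Proof. by rewrite rmorphD rmorphM /= horner_algX horner_algC. Qed.

Lemma coef0_split (R : comNzRingType) (p : {poly R}) : exists q, p = q * 'X + (p`_0)%:P.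
Proof.
by elim/poly_ind: p => [|p c _]; [exists 0 | exists p];
  rewrite ?coefD ?coefMX ?coefC /= ?mul0r ?add0r.
Qed.

(** If [a ^ s = 0] then [t (a ^ j) = 0] for [j >= 2] by induction on [s], because
    [a ^ j] has smaller index; a nonzero trace would then make the constant term
    of the equation of [a] nonzero and [a] invertible. *)
Lemma nilpotent_trace s a : a ^+ s = 0 -> t a = 0.
Proof.
elim/ltn_ind: s a => s IH a as0; have [p [szp pa p0]] := char_poly a.
apply/eqP; apply: contraT => ta; have /p0/(_ ta) {}p0 : forall j, (1 < j)%N -> t (a ^+ j) = 0.
  move=> j j1; case: s => [|[|s]] in IH as0.
  - by have := oner_neq0 A; rewrite -(expr0 a) as0 eqxx.
  - by rewrite expr1 in as0; rewrite as0 linear0 eqxx in ta.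
  apply: (IH s.+1) => //; rewrite -exprM.
  have js : (s.+2 <= j * s.+1)%N.
    by apply: (@leq_trans (2 * s.+1)); rewrite ?leq_mul2r ?j1 ?orbT // mul2n -addnn addSn ltnS leq_addl.
  by rewrite -(subnK js) exprD as0 mulr0.
have [q pE] := coef0_split p; move: pa; rewrite pE horner_algMX => /eqP.
rewrite addr_eq0 => /eqP qa.
have aq : horner_alg a q * a = a * horner_alg a q.
  by rewrite -{2 3}(horner_algX a) -!rmorphM mulrC.
have inv k : (horner_alg a q) ^+ k * a ^+ k = (- p`_0) ^+ k *: 1.
  by rewrite -exprMn_comm // qa -scaleNr exprZn expr1n.
have := inv s; rewrite as0 mulr0 => /esym/eqP.
by rewrite scaler_eq0 oner_eq0 orbF expf_eq0 oppr_eq0 (negPf p0) andbF.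
Qed.

Lemma natr_inj_char0 i j : i%:R = j%:R :> K -> i = j.
Proof.
wlog ij : i j / (i <= j)%N => [th|].
  by case/orP: (leq_total i j) => ij eij; [|apply/esym]; apply: th.
move=> eij; apply/eqP; rewrite eqn_leq ij /= leqNgt -subn_gt0; apply/negP => ji.
have := natK_neq0 charK (j - i).-1; rewrite prednK // natrB ?(ltnW ij) //.
by rewrite eij subrr eqxx.
Qed.

(** [\sum_i i e_i] takes [m] distinct values on orthogonal idempotents. *)
Lemma orthogonal_idempotents_le m (e : 'I_m -> A) : (forall i, e i != 0) ->
  (forall i j, e i * e j = if i == j then e i else 0) -> (m <= n)%N.
Proof.
move=> e0 ee; pose a := \sum_(i < m) (i : nat)%:R *: e i.
have ae j : a * e j = (j : nat)%:R *: e j.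
  rewrite mulr_suml (bigD1 j) //= -scalerAl ee eqxx big1 ?addr0 // => i ij.
  by rewrite -scalerAl ee (negPf ij) scaler0.
have pae p j : horner_alg a p * e j = p.[(j : nat)%:R] *: e j.
  elim/poly_ind: p => [|p c IH]; first by rewrite rmorph0 mul0r horner0 scale0r.
  rewrite horner_algMX mulrDl -mulrA ae -scalerAr IH -scalerAl mul1r.
  by rewrite hornerMXaddC scalerDl scalerA mulrC.
have [p [szp pa _]] := char_poly a.
have p0 : p != 0 by rewrite -size_poly_gt0 szp.
have rootp (j : 'I_m) : root p (j : nat)%:R.
  by have := pae p j; rewrite pa mul0r => /esym/eqP; rewrite scaler_eq0 (negPf (e0 j)) orbF.
have := max_poly_roots (rs := [seq (nat_of_ord j)%:R | j : 'I_m]) p0.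
rewrite size_map size_enum_ord szp ltnS; apply.
  by apply/allP => _ /mapP[j _ ->].
by rewrite map_inj_uniq ?enum_uniq // => i j /natr_inj_char0/val_inj.
Qed.

Definition primitive_idempotent e : Prop :=
  [/\ e != 0, e * e = e & forall f, f * f = f -> e * f = f -> f * e = f -> f = 0 \/ f = e].

(** A system with the largest number of members cannot be refined. *)
Lemma primitive_system : exists m (e : 'I_m -> A),
  \sum_i e i = 1 /\ forall i, primitive_idempotent (e i).
Proof.
pose P m := `[< exists e : 'I_m -> A, [/\ \sum_i e i = 1, forall i, e i != 0 &
  forall i j, e i * e j = if i == j then e i else 0] >].
have Ple m : P m -> (m <= n)%N by move/asboolP => [e [_]]; exact: orthogonal_idempotents_le.
have exP : exists m, P m.
  exists 1%N; apply/asboolP; exists (fun=> 1); split=> [|i|i j].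
  - by rewrite big_ord1.
  - exact: oner_neq0.
  - by rewrite mulr1 !ord1 eqxx.
have [m /asboolP[e [e1 e0 ee]] mmax] := ex_maxnP exP Ple.
exists m, e; split=> // i0; split=> //; first by rewrite ee eqxx.
move=> f ff ef fe; have [->|f0] := eqVneq f 0; first by left.
right; apply/eqP; rewrite eq_sym; apply: contraT => ef0.
suff /mmax : P m.+1 by rewrite ltnn.
have fek k : k != i0 -> f * e k = 0 by move=> ki; rewrite -fe -mulrA ee eq_sym (negPf ki) mulr0.
have ekf k : k != i0 -> e k * f = 0 by move=> ki; rewrite -ef mulrA ee (negPf ki) mul0r.
pose g k := if k == i0 then e k - f else e k.
have fg k : f * g k = 0.
  by rewrite /g; case: eqP => [->|/eqP/fek //]; rewrite mulrBr fe ff subrr.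
have gf k : g k * f = 0.
  by rewrite /g; case: eqP => [->|/eqP/ekf //]; rewrite mulrBl ef ff subrr.
have gg k l : g k * g l = if k == l then g k else 0.
  rewrite {2}/g; case: (eqVneq l i0) => [->|li].
    rewrite mulrBr gf subr0 /g; case: (eqVneq k i0) => [->|ki].
      by rewrite mulrBl ee eqxx fe.
    by rewrite ee (negPf ki).
  rewrite /g; case: (eqVneq k i0) => [->|ki]; last by rewrite ee.
  by rewrite mulrBl ee fek // subr0 eq_sym (negPf li).
apply/asboolP; exists (fun j => if unlift ord0 j is Some k then g k else f); split.
- rewrite big_ord_recl unlift_none (eq_bigr g) => [|k _]; last by rewrite liftK.
  rewrite -e1 [RHS](bigD1 i0) //= (bigD1 i0) //= {1}/g eqxx addrA addrCA addrN addr0.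
  by congr (_ + _); apply: eq_bigr => k ki; rewrite /g (negPf ki).
- move=> j; case: unliftP => // k _; rewrite /g; case: (eqVneq k i0) => [->|_]; last exact: e0.
  by rewrite subr_eq0.
by move=> j l; case: unliftP => [k ->|->]; case: unliftP => [k' ->|->]; rewrite ?eqxx ?ff.
Qed.

Section Corner.
Variable e : A.
Hypothesis pe : primitive_idempotent e.

Let e0 : e != 0. Proof. by case: pe. Qed.
Let ee : e * e = e. Proof. by case: pe. Qed.

Lemma horner_alg_comm a b p : a * b = b * a -> horner_alg a p * b = b * horner_alg a p.
Proof.
move=> ab; elim/poly_ind: p => [|p c IH]; first by rewrite rmorph0 mul0r mulr0.
by rewrite horner_algMX mulrDl mulrDr -mulrA ab mulrA IH mulrA mulr_algl mulr_algr.
Qed.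

(** For a root [l] of an equation [p] of [x], split [p] into a power of [X - l]
    and a factor [r] prime to it; the idempotent polynomial in [x] that Bezout's
    identity provides is [0] or [e]. *)
Lemma corner_eigenvalue x : e * x = x -> x * e = x ->
  exists l k, e * horner_alg x (('X - l%:P) ^+ k) = 0.
Proof.
move=> ex xe; have [p [szp px _]] := char_poly x.
have hc q : horner_alg x q * e = e * horner_alg x q.
  by apply: horner_alg_comm; rewrite ex xe.
have p0 : p != 0 by rewrite -size_poly_gt0 szp.
have {px} : e * horner_alg x p = 0 by rewrite px mulr0.
have [d] := ubnP (size p); elim: d {szp} p p0 => // d IH p p0 szp px.
have [l pl] : exists l, root p l.
  apply/closed_rootP; apply: contraTN isT => /size_poly1P[c c0 pE].
  move: px; rewrite pE horner_algC mulr_algr => /eqP.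
  by rewrite scaler_eq0 (negPf c0) (negPf e0).
have [k [r]] := multiplicity_XsubC p l; rewrite p0 /= => rl pE.
have k0 : (0 < k)%N.
  rewrite lt0n; apply: contraNneq rl => k0.
  by move: pl; rewrite pE k0 expr0 mulr1.
have r0 : r != 0 by apply: contraNneq p0 => r0; rewrite pE r0 mul0r.
have cop : coprimep r (('X - l%:P) ^+ k) by rewrite coprimep_expr // coprimep_XsubC.
have [[u v] /= uv] := Bezout_eq1_coprimepP _ _ cop.
pose F := u * r.
have Fp q q' : e * horner_alg x (q * p * q') = 0.
  by rewrite mulrAC [_ * p]mulrC rmorphM mulrA px mul0r.
have F1 : F = 1 - v * ('X - l%:P) ^+ k by rewrite -uv addrK.
have Ff : (e * horner_alg x F) * (e * horner_alg x F) = e * horner_alg x (F * F).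
  by rewrite mulrA -(mulrA e _ e) hc mulrA ee -mulrA -rmorphM.
case: pe => _ _ /(_ (e * horner_alg x F)) [].
- rewrite Ff {2}F1 mulrBr mulr1 rmorphB mulrBr.
  have -> : F * (v * ('X - l%:P) ^+ k) = u * p * v by rewrite pE /F; ring.
  by rewrite Fp subr0.
- by rewrite mulrA ee.
- by rewrite -mulrA hc mulrA ee.
- move=> fF; apply: (IH r) => //.
    apply: (@leq_trans (size p)); last by rewrite -ltnS.
    rewrite pE size_Mmonic ?monic_exp ?monicXsubC //.
    by rewrite size_exp_XsubC addnS /= -[X in (X < _)%N]addn0 ltn_add2l.
  have -> : r = F * r + 1 * p * v by rewrite F1 pE; ring.
  rewrite rmorphD mulrDr Fp addr0 rmorphM mulrA fF mul0r //.
- move=> fF; exists l, k; rewrite -fF -mulrA -rmorphM.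
  have -> : F * ('X - l%:P) ^+ k = u * p * 1 by rewrite pE /F; ring.
  exact: Fp.
Qed.

(** A nilpotent of a corner with scalar eigenvalues has only nilpotent multiples
    there: a multiple with an eigenvalue other than [0] would be invertible. *)
Lemma corner_nilpotent x y s : e * x = x -> x * e = x -> e * y = y -> y * e = y ->
  x ^+ s = 0 -> exists k, (x * y) ^+ k = 0.
Proof.
move=> ex xe ey ye xs; pose z := x * y.
have ez : e * z = z by rewrite /z mulrA ex.
have ze : z * e = z by rewrite /z -mulrA ye.
have [l [k lk]] := corner_eigenvalue ez ze.
have [l0|l0] := eqVneq l 0.
  exists k.+1; move: lk; rewrite l0 subr0 rmorphXn /= horner_algX => ek.
  by rewrite -/z exprS -{1}ze -mulrA ek mulr0.
have [q qE] := coef0_split (('X - l%:P) ^+ k).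
have c0 : (('X - l%:P) ^+ k)`_0 != 0.
  by rewrite -horner_coef0 horner_exp hornerXsubC sub0r expf_neq0 // oppr_eq0.
move: lk; set c := (('X - l%:P) ^+ k)`_0 in qE c0; rewrite qE horner_algMX mulrDr => /eqP.
rewrite addr_eq0 mulr_algr => /eqP eqz.
have hz : horner_alg z q * z = z * horner_alg z q by exact: horner_alg_comm.
pose w := - c^-1 *: (y * horner_alg z q).
have exw : e = x * w.
  move: eqz; rewrite hz mulrA ez => eqz.
  by rewrite /w -scalerAr mulrA -/z eqz scaleNr scalerN opprK scalerA mulVf ?scale1r.
have ew : e * w = w by rewrite /w -scalerAr mulrA ey.
have xe0 j : x ^+ j * e = 0 -> e = 0.
  elim: j => [|j IH]; first by rewrite mul1r.
  move=> xj; apply: IH; rewrite {1}exw -ew !mulrA -exprSr xj mul0r //.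
by have := xe0 s; rewrite xs mul0r => /(_ erefl) e00; move: e0; rewrite e00 eqxx.
Qed.

(** The radical of the corner is nil, so it is orthogonal to everything. *)
Lemma corner_scalar a : exists l : K, e * a * e = l *: e.
Proof.
pose x := e * a * e.
have ex : e * x = x by rewrite /x !mulrA ee.
have xe : x * e = x by rewrite /x -!mulrA ee.
have [l [k lk]] := corner_eigenvalue ex xe.
exists l; apply/eqP; rewrite -subr_eq0; apply/eqP; set y := _ - _.
have ey : e * y = y by rewrite /y mulrBr -/x ex -scalerAr ee.
have ye : y * e = y by rewrite /y mulrBl -/x xe -scalerAl ee.
have yk : y ^+ k.+1 = 0.
  have eyj j : e * horner_alg x (('X - l%:P) ^+ j) = e * y ^+ j.
    elim: j => [|j IH]; first by rewrite !expr0 rmorph1.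
    rewrite !exprS rmorphM rmorphB /= horner_algX horner_algC !mulrA.
    have -> : e * (x - l%:A) = y by rewrite mulrBr ex mulr_algr.
    by rewrite -[in LHS]ye -(mulrA y e) IH mulrA ye ey.
  by rewrite exprS -{1}ye -mulrA -eyj lk mulr0.
apply: nondeg => b.
have -> : t (y * b) = t (y * (e * b * e)).
  have -> : y * b = e * (y * (e * b)) by rewrite !mulrA ey ye.
  by rewrite tC !mulrA.
have eb : e * (e * b * e) = e * b * e by rewrite !mulrA ee.
have be : e * b * e * e = e * b * e by rewrite -!mulrA ee.
have [j yj] := corner_nilpotent ey ye eb be yk.
exact: nilpotent_trace yj.
Qed.

Lemma minimal_left_ideal x : x * e != 0 -> exists h, h * x * e = e.
Proof.
move=> xe0; have [y ty] : exists y, t (x * e * y) != 0.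
  apply: contrapT => no; move/negP: xe0; apply; apply/eqP; apply: nondeg => b.
  by apply/eqP; apply: contraT => tb; case: no; exists b.
have [l lE] := corner_scalar (y * x).
have l0 : l != 0.
  apply: contraNneq ty => l0; have -> : x * e * y = (x * e) * (e * y).
    by rewrite mulrA -(mulrA x e e) ee.
  by rewrite tC mulrA -(mulrA e) lE l0 scale0r linear0.
exists (l^-1 *: (e * y)); by rewrite -!scalerAl -(mulrA e) lE scalerA mulVf // scale1r.
Qed.

End Corner.

(** [e A f] is at most a line: if [x] in [e A f] is not [0], then [h x = f] for some
    [h], so [e a f = (e a f h e) x] is a multiple of [x]. *)
Lemma corner_line (e f : A) : primitive_idempotent e -> primitive_idempotent f ->
  exists x, forall a, exists l : K, e * a * f = l *: x.
Proof.
move=> pe pf; have [_ ee _] := pe; have [_ ff _] := pf.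
have [[x0 x00]|no] := pselect (exists a, e * a * f != 0); last first.
  exists 0 => a; exists 0; rewrite scale0r; apply/eqP; apply: contraT => ea.
  by case: no; exists a.
pose x := e * x0 * f; exists x => a.
have [h hx] := minimal_left_ideal pf (x := e * x0) x00.
have [l lE] := corner_scalar pe (a * f * h).
exists l; rewrite -[in LHS]ff -{2}hx /x.
by rewrite scalerAl scalerAl -lE !mulrA.
Qed.

(** The Peirce decomposition [A = \sum e_i A e_j] for a primitive system has at most
    one-dimensional summands, so [A] has finite dimension. *)
Theorem peirce : exists m (e : 'I_m -> A), [/\ \sum_i e i = 1,
  forall i, e i != 0 /\ forall x, x * e i != 0 -> exists h, h * x * e i = e i
  & exists k (x : 'I_k -> A), forall v, exists c : 'rV[K]_k, v = \sum_j c 0 j *: x j].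
Proof.
have [m [e [e1 pe]]] := primitive_system.
exists m, e; split=> // [i|].
  by split; [case: (pe i) | exact: minimal_left_ideal].
have ex ij : exists x, forall a, exists l : K, e ij.1 * a * e ij.2 = l *: x.
  exact: corner_line.
have [x xP] := choice ex.
exists #|{: 'I_m * 'I_m}|, (fun l => x (enum_val l)) => v.
have [c cP] := choice (fun ij => xP ij v).
exists (\row_l c (enum_val l)).
transitivity (\sum_(ij : 'I_m * 'I_m) c ij *: x ij).
  transitivity (\sum_i \sum_j c (i, j) *: x (i, j)); last first.
    by rewrite pair_bigA; apply: eq_bigr => -[].
  rewrite -[LHS]mul1r -[LHS]mulr1 -{1 2}e1 mulr_suml mulr_suml; apply: eq_bigr => i _.
  by rewrite mulr_sumr; apply: eq_bigr => j _; rewrite -cP.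
rewrite (reindex (@enum_val _ predT)) /=; last exact/onW_bij/enum_val_bij.
by apply: eq_bigr => l _; rewrite mxE.
Qed.

End Nondegenerate.

(** * Quotient algebras *)

Section QuotientAlgebra.
Variables (K : fieldType) (H : algType K) (J : H -> Prop).
Hypotheses (sJ : subspace J) (J1 : ~ J 1).
Hypotheses (Jl : forall a x, J x -> J (a * x)) (Jr : forall a x, J x -> J (x * a)).

Definition ideal_rel (x y : H) : bool := `[< J (x - y) >].

Lemma ideal_rel_refl : reflexive ideal_rel.
Proof. by move=> x; apply/asboolP; rewrite subrr; exact: sJ.1. Qed.
Lemma ideal_rel_sym : symmetric ideal_rel.
Proof.
by move=> x y; apply/asboolP/asboolP => /(subspaceN sJ); rewrite opprB.
Qed.
Lemma ideal_rel_trans : transitive ideal_rel.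
Proof.
move=> y x z /asboolP Jxy /asboolP Jyz; apply/asboolP.
by rewrite -(subrKA y); exact: (subspaceD sJ).
Qed.

Canonical ideal_equiv := EquivRel ideal_rel ideal_rel_refl ideal_rel_sym ideal_rel_trans.

Definition quotient_algebra : Type := {eq_quot ideal_equiv}.
Local Notation Q := quotient_algebra.
HB.instance Definition _ := Choice.on Q.
HB.instance Definition _ := EqQuotient.on Q.

Definition quo (x : H) : Q := \pi_Q x.

Lemma quoP x y : quo x = quo y <-> J (x - y).
Proof. by split=> [/eqmodP/asboolP //|Jxy]; apply/eqmodP/asboolP. Qed.

Lemma reprP x : J (repr (quo x) - x).
Proof. by apply/quoP; rewrite /quo reprK. Qed.

Lemma quoK (u : Q) : quo (repr u) = u. Proof. exact: reprK. Qed.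

Definition quo_add (u v : Q) : Q := quo (repr u + repr v).
Definition quo_opp (u : Q) : Q := quo (- repr u).
Definition quo_mul (u v : Q) : Q := quo (repr u * repr v).
Definition quo_scale (k : K) (u : Q) : Q := quo (k *: repr u).

Lemma quo_addE x y : quo_add (quo x) (quo y) = quo (x + y).
Proof. by apply/quoP; rewrite opprD addrACA; apply: (subspaceD sJ); exact: reprP. Qed.
Lemma quo_oppE x : quo_opp (quo x) = quo (- x).
Proof. by apply/quoP; rewrite -opprD; apply: (subspaceN sJ); exact: reprP. Qed.
Lemma quo_scaleE k x : quo_scale k (quo x) = quo (k *: x).
Proof. by apply/quoP; rewrite -scalerBr; apply: (subspaceZ sJ); exact: reprP. Qed.
Lemma quo_mulE x y : quo_mul (quo x) (quo y) = quo (x * y).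
Proof.
apply/quoP; rewrite -(subrKA (x * repr (quo y))) -mulrBl -mulrBr.
by apply: (subspaceD sJ); [apply: Jr | apply: Jl]; exact: reprP.
Qed.

Let quoE := (quo_addE, quo_oppE, quo_scaleE, quo_mulE).

Let addA : associative quo_add.
Proof. by move=> x y z; rewrite -[x]quoK -[y]quoK -[z]quoK !quoE addrA. Qed.
Let addC : commutative quo_add.
Proof. by move=> x y; rewrite -[x]quoK -[y]quoK !quoE addrC. Qed.
Let add0 : left_id (quo 0) quo_add.
Proof. by move=> x; rewrite -[x]quoK !quoE add0r. Qed.
Let addN : left_inverse (quo 0) quo_opp quo_add.
Proof. by move=> x; rewrite -[x]quoK !quoE addNr. Qed.
HB.instance Definition _ := GRing.isZmodule.Build Q addA addC add0 addN.

Let mulA : associative quo_mul.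
Proof. by move=> x y z; rewrite -[x]quoK -[y]quoK -[z]quoK !quoE mulrA. Qed.
Let mul1 : left_id (quo 1) quo_mul.
Proof. by move=> x; rewrite -[x]quoK !quoE mul1r. Qed.
Let mulr1' : right_id (quo 1) quo_mul.
Proof. by move=> x; rewrite -[x]quoK !quoE mulr1. Qed.
Let mulDl : left_distributive quo_mul quo_add.
Proof. by move=> x y z; rewrite -[x]quoK -[y]quoK -[z]quoK !quoE mulrDl. Qed.
Let mulDr : right_distributive quo_mul quo_add.
Proof. by move=> x y z; rewrite -[x]quoK -[y]quoK -[z]quoK !quoE mulrDr. Qed.
Let one_neq0 : quo 1 != 0 :> Q.
Proof. by apply/eqP => /quoP; rewrite subr0. Qed.
HB.instance Definition _ :=
  GRing.Zmodule_isNzRing.Build Q mulA mul1 mulr1' mulDl mulDr one_neq0.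

Let scaleA k l (x : Q) : quo_scale k (quo_scale l x) = quo_scale (k * l) x.
Proof. by rewrite -[x]quoK !quoE scalerA. Qed.
Let scale1 : left_id 1 quo_scale.
Proof. by move=> x; rewrite -[x]quoK !quoE scale1r. Qed.
Let scaleDr : right_distributive quo_scale +%R.
Proof. by move=> k x y; rewrite -[x]quoK -[y]quoK [_ + _]quo_addE !quoE scalerDr -quo_addE. Qed.
Let scaleDl x : {morph quo_scale^~ x : k l / k + l}.
Proof. by move=> k l; rewrite -[x]quoK !quoE scalerDl -quo_addE. Qed.
HB.instance Definition _ :=
  GRing.Zmodule_isLmodule.Build K Q scaleA scale1 scaleDr scaleDl.

Let scaleAl k (x y : Q) : k *: (x * y) = (k *: x) * y.
Proof.
rewrite -[x]quoK -[y]quoK -[LHS]/(quo_scale k (quo_mul _ _)).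
by rewrite -[RHS]/(quo_mul (quo_scale k _) _) !quoE scalerAl.
Qed.
HB.instance Definition _ := GRing.Lmodule_isLalgebra.Build K Q scaleAl.
Let scaleAr k (x y : Q) : k *: (x * y) = x * (k *: y).
Proof.
rewrite -[x]quoK -[y]quoK -[LHS]/(quo_scale k (quo_mul _ _)).
by rewrite -[RHS]/(quo_mul _ (quo_scale k _)) !quoE scalerAr.
Qed.
HB.instance Definition _ := GRing.Lalgebra_isAlgebra.Build K Q scaleAr.

Lemma quo_linear : linear quo.
Proof. by move=> k x y; rewrite -quo_addE -quo_scaleE. Qed.
Lemma quo_monoid_morphism : monoid_morphism quo.
Proof. by split=> // x y; rewrite -quo_mulE. Qed.
HB.instance Definition _ := GRing.isLinear.Build K H Q *:%R quo quo_linear.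
HB.instance Definition _ := GRing.isMonoidMorphism.Build H Q quo quo_monoid_morphism.

Lemma quotient_algebraP : exists (A : algType K) (pi : {lrmorphism H -> A}),
  (forall a, exists h, pi h = a) /\ forall h, pi h = 0 <-> J h.
Proof.
exists Q, (quo : {lrmorphism H -> Q}); split=> [a|h].
  by exists (repr a); exact: quoK.
by split=> [/quoP|Jh]; [rewrite subr0 | apply/quoP; rewrite subr0].
Qed.

End QuotientAlgebra.

(** * Modules *)

Section TensorAction.
Variables (K : fieldType) (H : algType K) (hH : hopf_structure H).
Variables (V W : lmodType K) (actV : H -> V -> V) (actW : H -> W -> W).
Hypotheses (aV : is_action actV) (aW : is_action actW).

Lemma action_tmap_bilinear a b : bilinear_for *:%R *:%R
  (fun u v => tens (actV a u) (actW b v) : V ⊗ W).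
Proof.
have [_ lV _ _] := aV; have [_ lW _ _] := aW.
by split=> [v k u u'|u k v v'] /=; rewrite ?lV ?lW ?linearPl ?linearPr.
Qed.

Lemma tmap_action_bilinear (t : V ⊗ W) : bilinear_for *:%R *:%R
  (fun a b => tmap (actV a) (actW b) t).
Proof.
have [lV _ _ _] := aV; have [lW _ _ _] := aW.
split=> [b k a a'|a k b b'] /=; rewrite /tmap /tlift /sum_eval scaler_sumr -big_split;
  apply: eq_bigr => p _ /=.
- by rewrite lV linearPl.
- by rewrite lW linearPr.
Qed.

Lemma tensor_act_sum (r : seq (H * H)) h t : comul hH h = \sum_(p <- r) tens p.1 p.2 ->
  tensor_act hH actV actW h t = \sum_(p <- r) tmap (actV p.1) (actW p.2) t.
Proof.
by move=> hE; rewrite /tensor_act hE tlift_tens_sum //; exact: tmap_action_bilinear.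
Qed.

Lemma tmap_linear a b : linear (tmap (actV a) (actW b)).
Proof. exact: (tlift_is_linear (action_tmap_bilinear a b)). Qed.

Lemma tensor_action : is_action (tensor_act hH actV actW).
Proof.
have [lV lV' V1 VM] := aV; have [lW lW' W1 WM] := aW.
split=> [t k g h|h k t t'|t|g h t].
- by rewrite /tensor_act linearP; exact: (tlift_is_linear (tmap_action_bilinear t)).
- rewrite !(tensor_act_sum _ (tensorE (comul hH h))) scaler_sumr -big_split.
  by apply: eq_bigr => p _; exact: tmap_linear.
- rewrite (tensor_act_sum (r := [:: (1, 1)])) ?big_seq1 ?comul1 //=.
  rewrite [RHS]tensorE /tmap /tlift /sum_eval; apply: eq_bigr => p _.
  by rewrite V1 W1.
pose r := repr (comul hH g); pose s := repr (comul hH h).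
rewrite (tensor_act_sum (r := [seq (p.1 * q.1, p.2 * q.2) | p <- r, q <- s])); last first.
  by rewrite comulM {1}[comul hH g]tensorE {1}[comul hH h]tensorE tmul_sum big_allpairs_dep.
rewrite big_allpairs_dep !(tensor_act_sum _ (tensorE _)); apply: eq_bigr => p _.
rewrite (linear_big _ _ (tmap_linear _ _)); apply: eq_bigr => q _ /=.
have tE a b : tmap (actV a) (actW b) t =
  \sum_(u <- repr t) tens (actV a u.1) (actW b u.2) by [].
rewrite !tE (linear_big _ _ (tmap_linear _ _)).
apply: eq_bigr => u _; rewrite VM WM.
by rewrite /tmap tliftE //; exact: action_tmap_bilinear.
Qed.

End TensorAction.

(** The quotient of [H] by the left ideal [ker (phi \o pi)] of finite codimension,
    carried by row vectors to be a finite-dimensional vector space. *)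
Section CyclicModule.
Variables (K : fieldType) (H A : algType K) (pi : {lrmorphism H -> A}).
Variables (r : nat) (phi : {linear A -> 'rV[K]_r}) (sigma : 'rV[K]_r -> A).
Hypothesis phiK : forall w, phi (sigma w) = w.
Hypothesis ker_left : forall a x, phi x = 0 -> phi (a * x) = 0.

Definition cyclic_act (h : H) (w : 'rV[K]_r) : 'rV[K]_r := phi (pi h * sigma w).

Lemma cyclic_actE h a : cyclic_act h (phi a) = phi (pi h * a).
Proof.
apply/eqP; rewrite -subr_eq0 -linearB -mulrBr; apply/eqP; apply: ker_left.
by rewrite linearB phiK subrr.
Qed.

Lemma cyclic_action : is_action cyclic_act.
Proof.
split=> [w k g h|h k v w|w|g h w].
- by rewrite /cyclic_act linearP mulrDl -scalerAl linearP.
- rewrite -{1}[v]phiK -{1}[w]phiK -[k *: phi _ + phi _]linearP cyclic_actE mulrDr -scalerAr.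
  exact: linearP.
- by rewrite /cyclic_act rmorph1 mul1r phiK.
- by rewrite -[w]phiK !cyclic_actE rmorphM mulrA.
Qed.

Lemma cyclic_irreducible : (forall a, exists h, pi h = a) -> phi 1 != 0 ->
  (forall a, phi a != 0 -> exists b, phi (b * a) = phi 1) ->
  irreducible cyclic_act predT.
Proof.
move=> sur phi1 max; split; first by [].
  by exists (phi 1).
move=> L [[L0 LL] Lact] _; have [[v [vL v0]]|noL] := pselect (exists v, v \in L /\ v != 0).
  right=> w; rewrite inE; have [|b bv] := max (sigma v); first by rewrite phiK.
  have [h hb] := sur b; have [g gw] := sur (sigma w).
  have -> : w = cyclic_act (g * h) v.
    have -> : cyclic_act (g * h) v = phi (sigma w * (b * sigma v)).
      by rewrite /cyclic_act rmorphM -hb -gw mulrA.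
    rewrite -[in RHS](subrK 1 (b * _)) mulrDr mulr1 linearD ker_left ?add0r ?phiK //.
    by rewrite linearB bv subrr.
  exact: Lact.
left=> w; apply/idP/idP => [wL|]; last by rewrite !inE => /eqP ->.
by rewrite !inE; apply: contrapT => w0; apply: noL; exists w; split=> //; exact/negP.
Qed.

End CyclicModule.

(** * Fibres of [H] over the points of [C] *)

Section Fibres.
Variables (K : closedFieldType) (charK : [pchar K] =i pred0).
Variables (H : algType K) (C : central_subalg H).
Variables (tr : H -> C) (n : nat) (CH : cayley_hamilton tr n).

Local Notation point := (@point K H C).

Let natn_neq0 : n%:R != 0 :> K.
Proof. by have := degree_gt0 CH; case: n => // m _; exact: natK_neq0. Qed.

(** [tr / n] is such a map, because [tr 1 = n]. *)
Lemma retraction_exists : exists E : {linear H -> C}, forall c, E (incl c) = c.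
Proof.
pose E h : C := (n%:R : K)^-1 *: tr h.
have E_lin : linear E.
  by move=> k x y; rewrite /E (trD CH) (trZ CH) scalerDr !scalerA mulrC.
pose ELin := GRing.isLinear.Build K H C *:%R E E_lin.
exists (HB.pack E ELin : {linear H -> C}) => c /=.
rewrite /E -[incl c]mulr1 (trM CH) (tr1 CH) mulr_natr -scaler_nat scalerA.
by rewrite mulVf // scale1r.
Qed.

Definition trace_radical (chi : point) (h : H) : Prop := forall b, chi (tr (h * b)) = 0.

Section Radical.
Variable chi : point.
Local Notation J := (trace_radical chi).

Lemma radical_subspace : subspace J.
Proof.
split=> [b|k x y Jx Jy b]; first by rewrite mul0r (tr0 CH) linear0.
by rewrite mulrDl -scalerAl (trD CH) (trZ CH) linearD linearform_scale /= Jx Jy mulr0 addr0.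
Qed.

Lemma radical1 : ~ J 1.
Proof.
move/(_ 1); rewrite mulr1 (tr1 CH) rmorph_nat => n0.
by move: natn_neq0; rewrite -[n%:R]/(n%:R : K^o) n0 eqxx.
Qed.

Lemma radicalMl a x : J x -> J (a * x).
Proof. by move=> Jx b; rewrite -mulrA (trC CH) -mulrA. Qed.

Lemma radicalMr a x : J x -> J (x * a).
Proof. by move=> Jx b; rewrite -mulrA. Qed.

Lemma radical_central c x : J (incl c * x - (chi c : K) *: x).
Proof.
move=> b; rewrite mulrBl -scalerAl -mulrA -scaleNr (trD CH) (trZ CH) (trM CH).
by rewrite linearD linearform_scale rmorphM /= mulNr subrr.
Qed.

Lemma radical_trace x : J x -> chi (tr x) = 0.
Proof. by move/(_ 1); rewrite mulr1. Qed.

Lemma point_ch_coef k a :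
  chi (ch_coef tr k a) = (k`!%:R : K)^-1 * \det (map_mx chi (ch_mx tr k a)).
Proof. by rewrite /ch_coef linearform_scale det_map_mx. Qed.

Lemma ch_coef_radical k a : J a -> (0 < k)%N -> chi (ch_coef tr k a) = 0.
Proof.
move=> Ja; case: k => // k _; rewrite point_ch_coef (expand_det_col _ ord0) big1 ?mulr0 // => i _.
by rewrite !mxE /= addn1 subn0 exprS Ja mul0r.
Qed.

(** At the point, the characteristic polynomial of an element of [J] is [t ^ n],
    because the coefficients are polynomials in its traces. *)
Lemma radical_nil (V : lmodType K) (act : H -> V -> V) a : is_action act ->
  (forall c v, act (incl c) v = (chi c : K) *: v) -> J a -> forall v, act (a ^+ n) v = 0.
Proof.
move=> [aL aL' a1 aM] central Ja v.
have a0 : act 0 v = 0.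
  by have := aL v (-1) 0 0; rewrite !scaleN1r !addNr.
have := cayley_hamilton_sum CH a => /(congr1 (fun h => act h v)); rewrite a0.
have -> : forall x y, act (x + y) v = act x v + act y v.
  by move=> x y; have := aL v 1 x y; rewrite !scale1r.
rewrite (linear_big _ _ (aL v)) big_seq_cond [X in _ + X]big1 ?addr0 // => k.
rewrite mem_index_iota andbT => /andP[k0 _].
by rewrite aM central rmorphM /= ch_coef_radical // mulr0 scale0r.
Qed.

(** If [b v] were not [0], it would generate [N], so [v = h b v = (h b) ^ n v], while
    [h b] lies in [J] and its [n]-th power acts by [0]. *)
Lemma radical_kills (V : lmodType K) (act : H -> V -> V) (N : {pred V}) b : is_action act ->
  (forall c v, act (incl c) v = (chi c : K) *: v) -> irreducible act N -> J b ->
  forall v, v \in N -> act b v = 0.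
Proof.
move=> aA central [[[N0 NL] Nact] _ Nmax] Jb v vN; apply: contrapT => bv0.
have [aL aL' a1 aM] := aA.
pose L : {pred V} := [pred w | `[< exists h, w = act h (act b v) >]].
have sL : submodule act L.
  split; first split.
  - apply/asboolP; exists 0.
    by have := aL (act b v) (-1) 0 0; rewrite !scaleN1r !addNr.
  - move=> k _ _ /asboolP[g ->] /asboolP[h ->]; apply/asboolP; exists (k *: g + h).
    by rewrite aL.
  - by move=> h _ /asboolP[g ->]; apply/asboolP; exists (h * g); rewrite aM.
have LN : {subset L <= N} by move=> _ /asboolP[h ->]; exact: Nact (Nact _ _ vN).
have [L0|LE] := Nmax L sL LN.
  have : act b v \in pred1 0 by rewrite -L0; apply/asboolP; exists 1; rewrite a1.
  by rewrite inE => /eqP.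
have /asboolP[h vE] : v \in L by rewrite LE.
have pow k : act ((h * b) ^+ k) v = v.
  elim: k => [|k IH]; first by rewrite expr0 a1.
  by rewrite exprSr aM aM -vE.
apply: bv0; rewrite -(pow n) (radical_nil aA central (radicalMl h Jb)).
by have := aL' b (-1) 0 0; rewrite !scaleN1r !addNr.
Qed.

Lemma radical_kills_semisimple (V : lmodType K) (act : H -> V -> V) b : is_action act ->
  (forall c v, act (incl c) v = (chi c : K) *: v) -> completely_reducible act -> J b ->
  forall v, act b v = 0.
Proof.
move=> aA central [m [N [irr dec]]] Jb v; have [u [[uN ->] _]] := dec v.
have [_ aL' _ _] := aA; rewrite (linear_big _ _ (aL' b)) big1 // => i _.
exact: (radical_kills aA central (irr i) Jb).
Qed.

(** Besides the quotient by [J], what the comparison of fibres requires of it: its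
    dimension [r], and left ideals [A e_i], of sum [A], that are irreducible. *)
Record fibre r := Fibre {
  fib : algType K;
  fib_pi : {lrmorphism H -> fib};
  fib_sur : forall a, exists h, fib_pi h = a;
  fib_ker : forall h, fib_pi h = 0 <-> J h;
  fib_coord : {linear fib -> 'rV[K]_r};
  fib_vec : 'rV[K]_r -> fib;
  fib_vecK : forall w, fib_coord (fib_vec w) = w;
  fib_coord0 : forall a, fib_coord a = 0 -> a = 0;
  fib_m : nat;
  fib_e : 'I_fib_m -> fib;
  fib_e1 : \sum_i fib_e i = 1;
  fib_e0 : forall i, fib_e i != 0;
  fib_irr : forall i x, x * fib_e i != 0 -> exists h, h * x * fib_e i = fib_e i
}.

(** The trace descends to a nondegenerate one on [H / J], and the characteristic
    polynomials at the point meet the requirements of [peirce].  If the traces of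
    [a ^ j] vanish for [j >= 2], the matrix in the constant term is triangular, and
    the term is [(tr a) ^ n / n!] up to sign. *)
Lemma fibre_exists : exists r, inhabited (fibre r).
Proof.
have [A [pi [sur ker]]] :=
  quotient_algebraP radical_subspace radical1 radicalMl radicalMr.
have [s sP] := choice sur.
pose t a : K^o := chi (tr (s a)).
have tE h : t (pi h) = chi (tr h).
  apply/eqP; rewrite -subr_eq0 -linearB; apply/eqP.
  have -> : tr (s (pi h)) - tr h = tr (s (pi h) - h).
    by rewrite (trD CH) -[- h]scaleN1r (trZ CH) scaleN1r.
  by apply: radical_trace; apply/ker; rewrite linearB /= sP subrr.
have t_lin : linear t.
  move=> k a b; rewrite -[a]sP -[b]sP -linearP !tE (trD CH) (trZ CH).
  exact: linearP.
pose tLin := GRing.isLinear.Build K A K^o *:%R t t_lin.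
pose tA : {linear A -> K^o} := HB.pack t tLin.
have tC a b : tA (a * b) = tA (b * a).
  by rewrite /= -[a]sP -[b]sP -!rmorphM !tE (trC CH).
have nondeg a : (forall b, tA (a * b) = 0) -> a = 0.
  move=> ta; rewrite -[a]sP; apply/ker => b.
  by rewrite -tE rmorphM /= sP; exact: ta.
have pi_central c h : pi (incl c * h) = (chi c : K) *: pi h.
  by apply/eqP; rewrite -subr_eq0 -linearZ -linearB; apply/eqP/ker/radical_central.
have char_poly a : exists p : {poly K}, [/\ size p = n.+1, horner_alg a p = 0 &
    (forall j, (1 < j)%N -> tA (a ^+ j) = 0) -> tA a != 0 -> p`_0 != 0].
  pose h := s a; pose c k : K := chi ((-1) ^+ k * ch_coef tr k h).
  exists ('X^n + \sum_(1 <= k < n.+1) c k *: 'X^(n - k)); split.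
  - rewrite size_polyDl ?size_polyXn // ltnS.
    rewrite big_seq_cond; apply: (big_ind (fun q : {poly K} => size q <= n)%N).
    + by rewrite size_poly0.
    + by move=> q q' qn q'n; rewrite (leq_trans (size_polyD _ _)) // geq_max qn.
    + move=> k; rewrite mem_index_iota andbT => /andP[k0 _].
      rewrite (leq_trans (size_scale_leq _ _)) // size_polyXn.
      by rewrite ltn_subrL k0 (degree_gt0 CH).
  - have := congr1 pi (cayley_hamilton_sum CH h); rewrite rmorph0 => <-.
    rewrite !rmorphD rmorphXn /= rmorphXn /= horner_algX sP; congr (_ + _).
    rewrite !rmorph_sum; apply: eq_bigr => k _.
    rewrite /= linearZ /= rmorphXn /= horner_algX pi_central rmorphXn /= sP mulr_algl.
    reflexivity.
  move=> ta2 ta; rewrite coefD coefXn (ltn_eqF (degree_gt0 CH)) add0r coef_sum.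
  have n0 := degree_gt0 CH.
  rewrite big_nat_recr //= big_nat big1 => [|k /andP[k0 kn]]; last first.
    by rewrite coefZ coefXn eq_sym subn_eq0 leqNgt kn mulr0.
  rewrite add0r coefZ coefXn subnn mulr1 /c rmorphM rmorphXn rmorphN rmorph1 /=.
  have -> : chi (ch_coef tr n h) = (n`!%:R : K)^-1 * (chi (tr h) : K) ^+ n.
    rewrite point_ch_coef -det_tr det_trig; last first.
      apply/is_trig_mxP => i j ij; rewrite !mxE (ltnW ij) -tE.
      have := ta2 (j - i + 1)%N; rewrite /= -[a]sP -rmorphXn tE; apply.
      by rewrite addn1 ltnS subn_gt0.
    congr (_ * _); rewrite -[n in RHS]card_ord -prodr_const; apply: eq_bigr => i _.
    by rewrite !mxE leqnn subnn expr1.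
  have fact0 : n`!%:R != 0 :> K by rewrite -(prednK (fact_gt0 n)) natK_neq0.
  by rewrite !mulf_neq0 ?invr_eq0 ?expf_neq0 ?oppr_eq0 ?oner_eq0 //.
have [m [e [e1 eirr [k [x span_x]]]]] := peirce charK tC nondeg char_poly.
have s0 : subspace (fun a : A => a = 0).
  by split=> // l a b -> ->; rewrite scaler0 addr0.
have [|r [phi [sigma [phiK phi0]]]] := finite_codim s0 (x := x).
  by move=> v; have [c ->] := span_x v; exists c; rewrite subrr.
exists r; constructor; apply: (@Fibre r A pi sur ker phi sigma phiK _ m e e1).
- by move=> a /phi0.
- by move=> i; have [] := eirr i.
- by move=> i; have [] := eirr i.
Qed.

End Radical.
End Fibres.

(** * Products of fibres *)

Section FibreModule.
Variables (K : closedFieldType) (H : algType K) (C : central_subalg H).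
Variables (tr : H -> C) (n : nat) (CH : cayley_hamilton tr n).
Variables (chi : point C) (r : nat) (F : fibre tr chi r).

(** The irreducible module [A e_i] on a space of row vectors: [phi] presents it as a
    quotient of [A], and [kappa] embeds it into [A]. *)
Lemma fibre_module (i : 'I_(fib_m F)) :
  exists d (act : H -> 'rV[K]_d -> 'rV[K]_d) (phi : fib F -> 'rV[K]_d) (kappa : 'rV[K]_d -> fib F),
  [/\ is_action act /\ irreducible act predT,
      forall c v, act (incl c) v = (chi c : K) *: v,
      forall h a, act h (phi a) = phi (fib_pi F h * a), linear kappa
    & forall a, kappa (phi a) = a * fib_e i].
Proof.
set e := fib_e i; have e0 : e != 0 := fib_e0 i.
have sL : subspace (fun a : fib F => a * e = 0).
  split=> [|k a b ae be]; first by rewrite mul0r.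
  by rewrite mulrDl -scalerAl ae be scaler0 addr0.
have [|d [phi [sigma [phiK phi0]]]] := finite_codim sL (x := fun j => fib_vec F (delta_mx 0 j)).
  move=> v; exists (fib_coord F v).
  have -> : v - \sum_j fib_coord F v 0 j *: fib_vec F (delta_mx 0 j) = 0; last by rewrite mul0r.
  apply: (@fib_coord0 _ _ _ _ _ _ F); rewrite linearB linear_sum /=.
  apply/eqP; rewrite subr_eq0 {1}[fib_coord F v]row_sum_delta; apply/eqP.
  by apply: eq_bigr => j _; rewrite linearZ /= fib_vecK.
have kl a x : phi x = 0 -> phi (a * x) = 0.
  by move/phi0 => xe; apply/phi0; rewrite -mulrA xe mulr0.
have kphi a : sigma (phi a) * e = a * e.
  apply/eqP; rewrite -subr_eq0 -mulrBl; apply/eqP/phi0.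
  by rewrite linearB phiK subrr.
exists d, (cyclic_act (fib_pi F) phi sigma), phi, (fun w => sigma w * e); split.
- split; first exact: cyclic_action.
  apply: cyclic_irreducible => //; first exact: fib_sur.
    by apply: contraNneq e0 => /phi0; rewrite mul1r => ->.
  move=> a phia; have [|b be] := fib_irr (f := F) (i := i) (x := a).
    by apply: contraNneq phia => ae; apply/eqP/phi0.
  exists b; apply/eqP; rewrite -subr_eq0 -linearB; apply/eqP/phi0.
  by rewrite mulrBl be mul1r subrr.
- move=> c v; rewrite -[v]phiK cyclic_actE // -linearZ.
  apply/eqP; rewrite -subr_eq0 -linearB.
  have [h hv] := fib_sur (sigma v); rewrite -hv.
  have -> : fib_pi F (incl c) * fib_pi F h - (chi c : K) *: fib_pi F h = 0.
    by rewrite -rmorphM -linearZ -linearB; apply/fib_ker; exact: radical_central CH _ _ _.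
  by rewrite linear0.
- by move=> h a; rewrite cyclic_actE.
- move=> k v w; rewrite -[v]phiK -[w]phiK -[k *: phi _ + phi _]linearP !kphi.
  by rewrite mulrDl -scalerAl.
- exact: kphi.
Qed.

End FibreModule.

Lemma linear_through_coordinates (K : fieldType) (V W : lmodType K) k
    (p : V -> 'rV[K]_k) (z : 'I_k -> V) (f : V -> W) a :
  linear p -> linear f -> (forall i, p (z i) = delta_mx 0 i) ->
  (forall x, p x = 0 -> f x = 0) -> f a = \sum_i p a 0 i *: f (z i).
Proof.
move=> pL fL pz ker; pose S := \sum_i p a 0 i *: z i.
have pS : p (-1 *: S + a) = 0.
  rewrite pL scaleN1r (linear_big _ _ pL) addrC [X in X - _]row_sum_delta -sumrB big1 // => i _.
  by rewrite (linear_funZ _ _ pL) pz subrr.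
have := ker _ pS; rewrite fL scaleN1r addrC => /eqP; rewrite subr_eq0 => /eqP ->.
by rewrite (linear_big _ _ fL); apply: eq_bigr => i _; rewrite (linear_funZ _ _ fL).
Qed.

Section Comparison.
Variables (K : closedFieldType) (H : algType K) (hH : hopf_structure H).
Variables (C : central_subalg H) (hC : hopf_subalg hH C).
Variables (tr : H -> C) (n : nat) (CH : cayley_hamilton tr n).
Hypothesis chev : chevalley hH.
Local Notation Delta := (comul hH).

Variables (g h gamma : point C).
Hypothesis ghE : forall c, gamma c = \sum_(p <- coproduct hC c) g p.1 * h p.2.
Variables (s r' r : nat).
Variables (Fg : fibre tr g s) (Fh : fibre tr h r') (Fgamma : fibre tr gamma r).

(** By the Chevalley property [A_g e_i ⊗ A_h e_j] is a semisimple [H]-module over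
    the point [g h], so the radical of that fibre acts on it by zero. *)
Lemma comul_radical b : trace_radical tr gamma b ->
  \sum_(p <- repr (Delta b)) tens (fib_pi Fg p.1) (fib_pi Fh p.2) = 0.
Proof.
move=> Jb.
have part (i : 'I_(fib_m Fg)) (j : 'I_(fib_m Fh)) : \sum_(p <- repr (Delta b))
    tens (fib_pi Fg p.1 * fib_e i) (fib_pi Fh p.2 * fib_e j) = 0.
  have [d [actV [phi [kappa [[aV iV] cV phiE kL kE]]]]] := fibre_module CH i.
  have [d' [actW [phi' [kappa' [[aW iW] cW phiE' kL' kE']]]]] := fibre_module CH j.
  have aT := tensor_action hH aV aW.
  have cT c t : tensor_act hH actV actW (incl c) t = (gamma c : K) *: t.
    rewrite (tensor_act_sum aV aW (r := [seq (incl p.1, incl p.2) | p <- coproduct hC c])).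
      rewrite big_map ghE scaler_suml; apply: eq_bigr => p _ /=.
      rewrite [in RHS](tensorE t) scaler_sumr; apply: eq_bigr => u _.
      rewrite cV cW linearZl_LR linearZr_LR; exact: scalerA.
    by rewrite big_map; exact: coproductE.
  have cr := chev aV iV aW iW.
  have := radical_kills_semisimple CH aT cT cr Jb (tens (phi 1) (phi' 1)).
  move/(congr1 (tlift (fun u v => tens (kappa u) (kappa' v)))).
  have kP : bilinear_for *:%R *:%R (fun u v => tens (kappa u) (kappa' v)).
    by split=> [v k u u'|u k v v'] /=; rewrite ?kL ?kL' ?linearPl ?linearPr.
  rewrite (tensor_act_sum aV aW _ (tensorE (Delta b))) (tlift_sum _ _ kP).
  rewrite (tlift0 kP) => eq0; rewrite -[RHS]eq0; apply: eq_bigr => p _.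
  rewrite [tmap _ _ _](tliftE (action_tmap_bilinear aV aW _ _)) (tliftE kP).
  by rewrite phiE phiE' !mulr1 kE kE'.
have split_tens (x : fib Fg) (y : fib Fh) : tens x y =
    \sum_(i < fib_m Fg) \sum_(j < fib_m Fh) tens (x * fib_e i) (y * fib_e j).
  rewrite -{1}[x]mulr1 -(fib_e1 Fg) mulr_sumr (linear_big _ _ ((tensP _ _).1 _)).
  apply: eq_bigr => i _; rewrite -{1}[y]mulr1 -(fib_e1 Fh) mulr_sumr.
  by rewrite (linear_big _ _ ((tensP _ _).2 _)).
under eq_bigr => p _ do rewrite split_tens.
by rewrite exchange_big big1 // => i _; rewrite exchange_big big1.
Qed.

Let pg x := fib_coord Fg (fib_pi Fg x).
Let ph x := fib_coord Fh (fib_pi Fh x).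
Let pgamma x := fib_coord Fgamma (fib_pi Fgamma x).

Let pg_linear : linear pg.
Proof. by move=> k x y; rewrite /pg !linearP. Qed.
Let ph_linear : linear ph.
Proof. by move=> k x y; rewrite /ph !linearP. Qed.
Let pgamma_linear : linear pgamma.
Proof. by move=> k x y; rewrite /pgamma !linearP. Qed.

Let outer x y : 'M[K]_(s, r') := (pg x)^T *m ph y.

Let outerP : bilinear_for *:%R *:%R outer.
Proof.
split=> [y k x x'|x k y y'] /=; rewrite /outer.
  by rewrite pg_linear linearP mulmxDl -scalemxAl.
by rewrite ph_linear mulmxDr -scalemxAr.
Qed.

(** The canonical Galois map [a ⊗ b |-> a b_1 ⊗ b_2], with values in
    [A_g ⊗ A_h], which is the space of matrices in coordinates. *)
Let can a b : 'M[K]_(s, r') := tlift (fun b1 b2 => outer (a * b1) b2) (Delta b).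

Let can_outerP a : bilinear_for *:%R *:%R (fun b1 b2 => outer (a * b1) b2).
Proof.
split=> [y k x x'|x] /=; last exact: outerP.2.
by rewrite mulrDr -scalerAr outerP.1.
Qed.

Let can_linearl b : linear (can^~ b).
Proof.
move=> k a a'; rewrite /can /tlift /sum_eval scaler_sumr -big_split.
by apply: eq_bigr => p _; rewrite mulrDl -scalerAl; exact: outerP.1.
Qed.

Let can_linearr a : linear (can a).
Proof. by move=> k b b'; rewrite /can linearP; exact: (tlift_is_linear (can_outerP a)). Qed.

Let can_kernell a b : pg a = 0 -> can a b = 0.
Proof.
move=> pa; rewrite /can /tlift /sum_eval big1 // => p _.
by rewrite /outer /pg rmorphM /= (fib_coord0 pa) mul0r linear0 trmx0 mul0mx.
Qed.

Let can_kernelr a b : pgamma b = 0 -> can a b = 0.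
Proof.
move=> pb; have Jb : trace_radical tr gamma b by apply/(fib_ker Fgamma)/(fib_coord0 pb).
pose f (x : fib Fg) (y : fib Fh) : 'M[K]_(s, r') :=
  (fib_coord Fg (fib_pi Fg a * x))^T *m fib_coord Fh y.
have fP : bilinear_for *:%R *:%R f.
  split=> [y k x x'|x k y y'] /=; rewrite /f.
    by rewrite mulrDr -scalerAr !linearP mulmxDl -scalemxAl.
  by rewrite linearP mulmxDr -scalemxAr.
have := congr1 (tlift f) (comul_radical Jb); rewrite (tlift_sum _ _ fP).
rewrite (tlift0 fP) => eq0; rewrite -[RHS]eq0; apply: eq_bigr => p _.
by rewrite (tliftE fP) /f /outer /pg rmorphM.
Qed.

(** [a ⊗ b |-> a b_1 ⊗ b_2] is onto: [x ⊗ y] is the image of [x S(y_1) ⊗ y_2]. *)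
Let outer_can x y : outer x y =
  tlift (fun y1 y2 => can (x * antipode hH y1) y2) (Delta y).
Proof.
rewrite /can -(coassoc_sum hH (f := fun a b c => outer (x * antipode hH a * b) c)).
- rewrite -{1}(counitl hH y) /tlift /sum_eval (linear_big _ _ (outerP.2 x)).
  apply: eq_bigr => p _; rewrite (linear_funZ _ _ (outerP.2 x)).
  have antE := antipodel hH p.1.
  have : outer (x * (counit hH p.1)%:A) p.2 = counit hH p.1 *: outer x p.2.
    by rewrite mulr_algr; exact: linear_funZ (outerP.1 p.2).
  rewrite -antE => <-; rewrite /tlift /sum_eval mulr_sumr (linear_big _ _ (outerP.1 p.2)).
  by apply: eq_bigr => q _; rewrite mulrA.
- by move=> b c k a a'; rewrite linearP mulrDr mulrDl -scalerAr -scalerAl; exact: outerP.1.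
- by move=> a c k b b'; rewrite mulrDr -scalerAr; exact: outerP.1.
- by move=> a b; exact: outerP.2.
Qed.

(** The canonical map is onto and factors through [A_g ⊗ A_gamma], so
    [s r' <= s r]. *)
Theorem fibre_dim_le : (0 < s)%N -> (r' <= r)%N.
Proof.
move=> s0.
have [u uP] := choice (fun a => fib_sur (f := Fg) a).
have [v vP] := choice (fun a => fib_sur (f := Fgamma) a).
have [w wP] := choice (fun a => fib_sur (f := Fh) a).
pose ug i := u (fib_vec Fg (delta_mx 0 i)).
pose vg j := v (fib_vec Fgamma (delta_mx 0 j)).
have canE a b : can a b = \sum_i \sum_j (pg a 0 i * pgamma b 0 j) *: can (ug i) (vg j).
  have pug i : pg (ug i) = delta_mx 0 i by rewrite /pg uP fib_vecK.
  have pvg j : pgamma (vg j) = delta_mx 0 j by rewrite /pgamma vP fib_vecK.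
  rewrite (linear_through_coordinates a pg_linear (can_linearl b) pug); last first.
    by move=> x; exact: can_kernell.
  apply: eq_bigr => i _.
  rewrite (linear_through_coordinates b pgamma_linear (can_linearr (ug i)) pvg); last first.
    by move=> x; exact: can_kernelr.
  by rewrite scaler_sumr; apply: eq_bigr => j _; rewrite scalerA.
pose f (N : 'M[K]_(s, r)) : 'M[K]_(s, r') := \sum_i \sum_j N i j *: can (ug i) (vg j).
have f_lin : linear f.
  move=> k N N'; rewrite /f scaler_sumr -big_split; apply: eq_bigr => i _.
  rewrite scaler_sumr -big_split; apply: eq_bigr => j _.
  by rewrite !mxE scalerDl scalerA.
pose fLin := GRing.isLinear.Build K 'M[K]_(s, r) 'M[K]_(s, r') *:%R f f_lin.
pose fl : {linear 'M[K]_(s, r) -> 'M[K]_(s, r')} := HB.pack f fLin.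
have f_outer x y : exists N, f N = outer x y.
  exists (\sum_(p <- repr (Delta y)) (pg (x * antipode hH p.1))^T *m pgamma p.2).
  rewrite (linear_big _ _ f_lin) outer_can; apply: eq_bigr => p _.
  rewrite canE; apply: eq_bigr => i _; apply: eq_bigr => j _.
  by rewrite mxE big_ord1 !mxE.
have f_sur N' : exists N, f N = N'.
  have [N NP] := choice (fun ij : 'I_s * 'I_r' => f_outer
    (u (fib_vec Fg (delta_mx 0 ij.1))) (w (fib_vec Fh (delta_mx 0 ij.2)))).
  exists (\sum_i \sum_j N' i j *: N (i, j)).
  rewrite (linear_big _ _ f_lin) [RHS]matrix_sum_delta; apply: eq_bigr => i _.
  rewrite (linear_big _ _ f_lin); apply: eq_bigr => j _.
  have fZ k M : f (k *: M) = k *: f M by exact: (linearZ_LR fl).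
  rewrite fZ NP /outer /pg /ph uP wP !fib_vecK; congr (_ *: _).
  by rewrite trmx_delta mul_delta_mx.
have full : row_full (lin_mx fl).
  rewrite -sub1mx; apply/row_subP => i; apply/submxP.
  have [N NE] := f_sur (vec_mx (row i 1%:M)); exists (mxvec N).
  by rewrite mul_vec_lin /= NE vec_mxK.
have := rank_leq_row (lin_mx fl); rewrite (eqP full).
by rewrite leq_pmul2l.
Qed.

End Comparison.

(** * Gram determinants *)

Section Gram.
Variables (K : fieldType) (charK : [pchar K] =i pred0) (V : lmodType K).
Variable beta : V -> V -> K^o.
Hypotheses (betaL : forall b, linear (beta^~ b)) (betaC : forall a b, beta a b = beta b a).

Definition gram k (a : 'I_k -> V) : 'M[K]_k := \matrix_(i, j) (beta (a i) (a j) : K).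

(** Adjoining to [a] a vector [v] orthogonal to it multiplies the Gram determinant
    by [beta v v].  So if this determinant always vanishes, every vector orthogonal to
    [a] is isotropic, and by polarization two such vectors are orthogonal to each
    other. *)
Lemma gram_maximal k (a : 'I_k -> V) : \det (gram a) != 0 ->
  (forall a' : 'I_k.+1 -> V, \det (gram a') = 0) ->
  forall v, exists c : 'rV[K]_k, forall b, beta (v - \sum_i c 0 i *: a i) b = 0.
Proof.
move=> G0 sing; have Gu : gram a \in unitmx by rewrite unitmxE unitfE.
have betaLr b : linear (beta b) by move=> k' x y; rewrite !(betaC b) betaL.
pose c v := (\row_i (beta v (a i) : K)) *m invmx (gram a).
pose pr v := v - \sum_i c v 0 i *: a i.
have sumE (d : 'rV[K]_k) b : beta (\sum_i d 0 i *: a i) b = \sum_i d 0 i * beta (a i) b.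
  rewrite (linear_big _ _ (betaL b)); apply: eq_bigr => i _.
  exact: (linear_funZ _ _ (betaL b)).
have betaB x y b : beta (x - y) b = beta x b - beta y b.
  by rewrite -scaleN1r addrC betaL scaleN1r addrC.
have pr_orth v l : beta (pr v) (a l) = 0.
  rewrite betaB sumE.
  have -> : \sum_i c v 0 i * beta (a i) (a l) = (c v *m gram a) 0 l.
    by rewrite mxE; apply: eq_bigr => i _; congr (_ * _); rewrite mxE.
  by rewrite /c mulmxKV // mxE subrr.
have isotropic v : (forall l, beta v (a l) = 0) -> beta v v = 0.
  move=> va; pose a' i := if unlift ord0 i is Some l then a l else v.
  have := sing a'; rewrite (expand_det_row _ ord0) big_ord_recl big1 ?addr0 => [|l _].
    rewrite mxE /a' unlift_none /cofactor => /eqP; rewrite mulf_eq0 => /orP[/eqP //|].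
    rewrite expr0 mul1r; have -> : row' ord0 (col' ord0 (gram a')) = gram a.
      by apply/matrixP => i j; rewrite !mxE /a' !liftK.
    by rewrite (negPf G0).
  by rewrite mxE /a' unlift_none liftK va mul0r.
move=> v; exists (c v) => b; rewrite -/(pr v).
have orth w : (forall l, beta w (a l) = 0) -> beta (pr v) w = 0.
  move=> wa; have vwa l : beta (1 *: pr v + w) (a l) = 0.
    by rewrite betaL pr_orth wa scaler0 addr0.
  have := isotropic _ vwa; rewrite betaL !betaLr !scale1r.
  rewrite (isotropic w wa) (isotropic _ (pr_orth v)) addr0 add0r (betaC w).
  by rewrite -mulr2n => /(mulrn_inj_lmod charK).
rewrite -[b](subrK (\sum_i c b 0 i *: a i)) betaC -[X in X + _]scale1r betaL scale1r.
rewrite betaC orth ?add0r ?sumE; last by move=> l; exact: pr_orth.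
by apply: big1 => i _; rewrite betaC pr_orth mulr0.
Qed.

End Gram.

(** * Discriminant ideals *)

Section Discriminants.
Variables (K : closedFieldType) (charK : [pchar K] =i pred0).
Variables (H : algType K) (hH : hopf_structure H).
Variables (C : central_subalg H) (hC : hopf_subalg hH C).
Variables (tr : H -> C) (n : nat) (CH : cayley_hamilton tr n).
Hypotheses (affH : affine H) (chev : chevalley hH).
Implicit Types chi psi : point C.

Lemma fibre_dim_gt0 chi r : fibre tr chi r -> (0 < r)%N.
Proof.
case: r => [F|//]; have : (1 : fib F) = 0 by apply: fib_coord0; rewrite [LHS]thinmx0.
by move/eqP; rewrite oner_eq0.
Qed.

(** The two points are arbitrary, so this is an equality: the points form a group,
    and every point is the product of any other with a third. *)
Lemma fibre_dim_const chi psi r r' : fibre tr chi r -> fibre tr psi r' -> (r' <= r)%N.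
Proof.
move=> Fchi Fpsi; have [E EK] := retraction_exists charK CH.
have [g ghE] := point_left_quotient hC EK chi psi.
have [s [Fg]] := fibre_exists charK CH g.
exact: (fibre_dim_le CH chev ghE Fg Fpsi Fchi (fibre_dim_gt0 Fg)).
Qed.

Section AtPoint.
Variable chi : point C.
Let beta (a b : H) : K^o := chi (tr (a * b)).

Let betaL b : linear (beta^~ b).
Proof.
move=> k x y; rewrite /beta mulrDl -scalerAl (trD CH) (trZ CH); exact: linearP.
Qed.

Let betaC a b : beta a b = beta b a. Proof. by rewrite /beta (trC CH). Qed.

Lemma point_discriminant k (a : 'I_k -> H) : chi (discriminant tr a) = \det (gram beta a).
Proof.
by rewrite /discriminant -det_map_mx; congr (\det _); apply/matrixP => i j; rewrite !mxE.
Qed.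

Variables (r : nat) (F : fibre tr chi r).

(** The Gram matrix factors through the fibre. *)
Lemma discriminant_le_dim k (a : 'I_k -> H) : chi (discriminant tr a) != 0 -> (k <= r)%N.
Proof.
rewrite point_discriminant => G0; have Gu : gram beta a \in unitmx by rewrite unitmxE unitfE.
have [u uP] := choice (fun x => fib_sur (f := F) x).
pose p x := fib_coord F (fib_pi F x).
have pL : linear p by move=> l x y; rewrite /p !linearP.
pose z i := u (fib_vec F (delta_mx 0 i)).
have pz i : p (z i) = delta_mx 0 i by rewrite /p uP fib_vecK.
have GE : gram beta a = (\matrix_(i, l) p (a i) 0 l) *m (\matrix_(l, j) (beta (z l) (a j) : K)).
  apply/matrixP => i j; rewrite !mxE.
  rewrite (linear_through_coordinates (a i) pL (betaL (a j)) pz) => [|x px].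
    by apply: eq_bigr => l _; rewrite !mxE.
  by apply: (fib_ker F x).1; exact: fib_coord0 px.
have := mxrankM_maxl (\matrix_(i, l) p (a i) 0 l) (\matrix_(l, j) (beta (z l) (a j) : K)).
rewrite -GE mxrank_unit // => kr; exact: leq_trans kr (rank_leq_col _).
Qed.

(** A longest family with nonzero Gram determinant spans the fibre. *)
Lemma dim_lt_discriminant k : (forall a : 'I_k -> H, chi (discriminant tr a) = 0) -> (r < k)%N.
Proof.
move=> sing; pose P j := `[< exists a : 'I_j -> H, chi (discriminant tr a) != 0 >] && (j <= k)%N.
have exP : exists j, P j.
  exists 0%N; rewrite /P andbT; apply/asboolP; exists (fun=> 0).
  by rewrite point_discriminant det_mx00 oner_eq0.
have Pk j : P j -> (j <= k)%N by case/andP.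
have [j /andP[/asboolP[a a0] jk] jmax] := ex_maxnP exP Pk.
have {}jk : (j < k)%N.
  rewrite ltn_neqAle jk andbT; apply/eqP => jk'; rewrite jk' in a a0.
  by rewrite sing eqxx in a0.
have next (a' : 'I_j.+1 -> H) : \det (gram beta a') = 0.
  rewrite -point_discriminant; apply/eqP; apply: contraT => a'0.
  suff /jmax : P j.+1 by rewrite ltnn.
  by rewrite /P jk andbT; apply/asboolP; exists a'.
rewrite point_discriminant in a0.
have span_a := gram_maximal charK betaL betaC a0 next.
apply: leq_ltn_trans jk.
pose p x := fib_coord F (fib_pi F x).
have pL : linear p by move=> l x y; rewrite /p !linearP.
suff full : row_full (\matrix_(i < j) p (a i)).
  by have := rank_leq_row (\matrix_(i < j) p (a i)); rewrite (eqP full).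
rewrite -sub1mx; apply/row_subP => i; apply/submxP.
have [x xE] := fib_sur (f := F) (fib_vec F (row i 1%:M)).
have [c cP] := span_a x; exists c.
have xJ : p x = p (\sum_i c 0 i *: a i).
  rewrite -[x](subrK (\sum_i c 0 i *: a i)) /p (linearD (fib_pi F)) linearD /=.
  by rewrite (_ : fib_pi F (x - _) = 0) ?linear0 ?add0r //; apply/fib_ker.
have <- : p x = row i 1%:M by rewrite /p xE fib_vecK.
rewrite xJ (linear_big _ _ pL) mulmx_sum_row; apply: eq_bigr => l _.
by rewrite (linear_funZ _ _ pL) rowK.
Qed.

End AtPoint.

Lemma ideal_gen_ideal (R : comNzRingType) (X : set R) : is_ideal (ideal_gen X).
Proof.
split; first by exists [::]; rewrite ?big_nil.
- move=> _ _ [q [qX ->]] [q' [qX' ->]]; exists (q ++ q'); rewrite big_cat; split=> // p.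
  by rewrite mem_cat => /orP[/qX|/qX'].
- move=> c _ [q [qX ->]]; exists [seq (c * p.1, p.2) | p <- q]; split.
    by move=> p /mapP[p' /qX Xp ->].
  by rewrite big_map mulr_sumr; apply: eq_bigr => p _; rewrite mulrA.
Qed.

(** A nonzero discriminant is nonzero at a point [chi], and a proper discriminant
    ideal vanishes at a point [psi]; their fibres would differ in dimension. *)
Theorem discriminant_ideal_trivial k :
  discriminant_ideal tr k = [set 0]%classic \/ discriminant_ideal tr k = [set: C]%classic.
Proof.
have [ts [B finite]] := affine_finite charK CH affH.
have [E EK] := retraction_exists charK CH.
have iD : is_ideal (discriminant_ideal tr k) := ideal_gen_ideal _.
have [D0 DD DM] := iD.
have [[a /eqP a0]|no] := pselect (exists a : 'I_k -> H, discriminant tr a <> 0); last first.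
  left; apply/seteqP; split=> [x [q [qX ->]]|x ->] //=.
  rewrite big_seq big1 // => p /qX[a _ <-].
  by rewrite (_ : discriminant tr a = 0) ?mulr0 //; apply: contrapT => a0; apply: no; exists a.
right; apply/seteqP; split=> // x _; rewrite -[x]mulr1; apply: DM.
apply: contrapT => D1.
have [|psi [psiD _]] := point_avoiding finite (d := 1) iD.
  by move=> s; rewrite expr1n; exact: D1.
have [||chi [_ chi_a]] := point_avoiding finite (I := fun c => c = 0) (d := discriminant tr a).
  - split=> // [x' y -> ->|c x' ->]; by rewrite ?addr0 ?mulr0.
  - move=> s as0; move: a0.
    by rewrite (central_reduced charK hC EK finite as0) eqxx.
have [r [Fchi]] := fibre_exists charK CH chi.
have [r' [Fpsi]] := fibre_exists charK CH psi.
have : (r' < k)%N.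
  apply: (dim_lt_discriminant Fpsi) => a'; apply: psiD.
  exists [:: (1, discriminant tr a')]; split=> [p|]; last by rewrite big_seq1 mul1r.
  by rewrite inE => /eqP ->; exists a'.
by rewrite ltnNge (leq_trans (discriminant_le_dim Fchi chi_a) (fibre_dim_const Fpsi Fchi)).
Qed.

End Discriminants.

Theorem theorem0p4 (K : closedFieldType) (charK : [pchar K] =i pred0)
    (H : algType K) (hH : hopf_structure H) (C : central_subalg H) (tr : H -> C)
    (affH : affine H) (CHH : cayley_hamilton_hopf hH tr) (chev : chevalley hH) :
  forall k : nat, (0 < k)%N ->
    discriminant_ideal tr k = [set 0]%classic \/
    discriminant_ideal tr k = [set: C]%classic.
Proof.
move=> k _; have [hC [n CH]] := CHH.
exact: (discriminant_ideal_trivial charK hC CH affH chev).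
Qed.
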